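(* Let $L\subset\mathbb C$ be a simply connected domain with coordinate $z=x+iy$. (1) If $\check f:L\to S^5\subset\mathbb C^3$ is a conformal immersion parametrizing the link of a Lagrangian cone in $\mathbb C^3$, then there is a map $\check F:L\to U(3)$ with $\check F\epsilon_3=\check f$ whose Maurer-Cartan form $\check\alpha=\check F^{-1}d\check F$ is a flat $\mathfrak u(3)$-valued 1-form satisfying $\check\alpha_{\mathfrak m}=\check\alpha'_{-1}+\check\alpha''_1$ (hence $\check\alpha_2$ takes values in $\mathbb C\check Y$). (2) Conversely, if $\check\alpha$ is a $\mathfrak u(3)$-valued 1-form on $L$ which is flat, $d\check\alpha+\frac12[\check\alpha\wedge\check\alpha]=0$, and satisfies $\check\alpha_{\mathfrak m}=\check\alpha'_{-1}+\check\alpha''_1$, then integrating $d\check F=\check F\check\alpha$ with $\check F:L\to U(3)$ yields a weakly conformal map $\check f=\check F\epsilon_3:L\to S^5$ which, where it is an immersion, parametrizes the link of a Lagrangian cone in $\mathbb C^3$. Furthermore, the (cone over the) immersion is Hamiltonian stationary (resp. special Lagrangian) if $\check\alpha_2$ is coclosed (resp. vanishes).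
   Context: $\mathbb C^3$ carries its standard Hermitian product and symplectic form; $(\epsilon_1,\epsilon_2,\epsilon_3)$ in $\check F\epsilon_3$ refers to the standard basis, $\epsilon_3=(0,0,1)$. A Lagrangian cone is a cone centered at the origin that is a Lagrangian 3-dimensional submanifold of $\mathbb C^3\setminus\{0\}$; its link is its intersection with the unit sphere $S^5$; a map $\check f$ into $S^5$ parametrizes such a link (possibly as an immersion, so the cone may be immersed). ''Weakly conformal'' means that at each point the differential is either zero or injective and conformal. View $S^5=\check G/\check H=U(3)/\check H$ via $g\mapsto g\epsilon_3$, where $\check H=\left\{\begin{pmatrix}A&0\\0&1\end{pmatrix}:A\in U(2)\right\}$. Then $\check{\mathfrak g}=\mathfrak u(3)=\check{\mathfrak h}\oplus\check{\mathfrak m}$ with $$\check{\mathfrak h}=\left\{\begin{pmatrix}X&0\\0&0\end{pmatrix}:X\in\mathfrak u(2)\right\},\qquad \check{\mathfrak m}=\left\{\begin{pmatrix}0&u\\-u^*&ia\end{pmatrix}:a\in\mathbb R,\ u\in\mathbb C^2\right\},$$ and $\check\alpha_{\mathfrak m}$ denotes the $\check{\mathfrak m}$-component of $\check\alpha$. The order four automorphism $\tau$ of $\mathfrak{gl}(3,\mathbb C)=\check{\mathfrak g}^{\mathbb C}$ is $$\tau(X)=-T\,{}^tX\,T^{-1},\qquad T=\begin{pmatrix}0&1&0\\-1&0&0\\0&0&1\end{pmatrix}.$$ $\check{\mathfrak g}^{\mathbb C}_a$ ($a\in\{0,2,-1,1\}$) is its $i^a$-eigenspace, and $\check\alpha_a$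 is the $\check{\mathfrak g}_a^{\mathbb C}$-component of $\check\alpha$. Explicitly $\check{\mathfrak g}_0=\check{\mathfrak g}\cap\check{\mathfrak g}^{\mathbb C}_0=\left\{\begin{pmatrix}X&0\\0&0\end{pmatrix}:X\in\mathfrak{su}(2)\right\}$, $\check{\mathfrak g}_2=\check{\mathfrak g}\cap\check{\mathfrak g}^{\mathbb C}_2=\mathbb R\check Y\oplus\mathbb R\check Z$ with $\check Y=\operatorname{diag}(i,i,0)$, $\check Z=\operatorname{diag}(0,0,i)$, and $$\check{\mathfrak g}^{\mathbb C}_{-1}=\left\{\begin{pmatrix}0&0&-ia\\ 0&0&b\\ -ib&a&0\end{pmatrix}:a,b\in\mathbb C\right\},\qquad \check{\mathfrak g}^{\mathbb C}_{1}=\left\{\begin{pmatrix}0&0&ia\\ 0&0&b\\ {ib}&a&0\end{pmatrix}:a,b\in\mathbb C\right\}.$$ Primes $'$ and $''$ denote $(1,0)$ and $(0,1)$ parts of complex-valued 1-forms on $L$. The condition $\check\alpha_{\mathfrak m}=\check\alpha'_{-1}+\check\alpha''_1$ thus says that $\check\alpha_{\mathfrak m}$ has no $\check Z$-component and that $\check\alpha''_{-1}=\check\alpha'_1=0$. Coclosed means $d\star\check\alpha_2=0$, $\star$ being the Hodge star of the conformal structure of $L$. The Lagrangian angle $\beta$ of a Lagrangian cone is defined by $e^{i\beta}=(dz^1\wedge dz^2\wedge dz^3)(e_1,e_2,e_3)$ for an oriented orthonormal basis $(e_1,e_2,e_3)$ of its tangent space. The cone is Hamiltonian stationary (H-minimal)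 if $\beta$ is harmonic on it, and special Lagrangian if $\beta$ is constant. *)

(* Defs.v *)
From HB Require Import structures.
From mathcomp Require Import all_boot all_order all_algebra.
From mathcomp Require Import all_classical all_reals all_analysis.
From mathcomp Require Import complex ring.

Set Implicit Arguments.
Unset Strict Implicit.
Unset Printing Implicit Defensive.

Import Order.TTheory GRing.Theory Num.Theory.
Import numFieldNormedType.Exports.
Local Open Scope classical_set_scope.
Local Open Scope ring_scope.

Section Topology.
Context {R : realType} {T : topologicalType}.

Definition is_domain (L : set T) : Prop := [/\ open L, connected L & L !=set0].

Definition path_in (A : set T) (g : R -> T) : Prop :=
  {within `[0, 1]%classic, continuous g} /\ g @` `[0, 1]%classic `<=` A.

(* Trivial fundamental group: loops contract in [A] with fixed base point. *)
Definition simply_connected (A : set T) : Prop :=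
  (forall x y, A x -> A y -> exists g, [/\ path_in A g, g 0 = x & g 1 = y]) /\
  (forall g, path_in A g -> g 0 = g 1 ->
    exists H : R * R -> T,
      [/\ {within `[0, 1]%classic `*` `[0, 1]%classic, continuous H},
          H @` (`[0, 1]%classic `*` `[0, 1]%classic) `<=` A,
          forall t, t \in `[0, 1] -> H (0, t) = g t,
          forall t, t \in `[0, 1] -> H (1, t) = g 0 &
          forall s, s \in `[0, 1] -> H (s, 0) = g 0 /\ H (s, 1) = g 0]).

End Topology.
Arguments simply_connected R {T} A.

Section Calculus.
Context {R : realType}.
Local Notation C := R[i].

Fixpoint Ck {n} (k : nat) (U : set 'rV[R]_n) (f : 'rV[R]_n -> R) : Prop :=
  match k with
  | 0 => forall x, U x -> {for x, continuous f}
  | k'.+1 => (forall x, U x -> differentiable f x) /\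
             (forall i : 'I_n, Ck k' U ('D_(delta_mx 0 i) f))
  end.

(* To be used on open sets [U] only. *)
Definition smooth {n} (U : set 'rV[R]_n) (f : 'rV[R]_n -> R) : Prop :=
  forall k, Ck k U f.

Definition smooth_mx {n p q} (U : set 'rV[R]_n) (f : 'rV[R]_n -> 'M[C]_(p, q)) :=
  forall i j, smooth U (fun x => complex.Re (f x i j)) /\
              smooth U (fun x => complex.Im (f x i j)).

(* The value at [v] of the differential of [f] at [x]; the derivative is taken
   entrywise, on real and imaginary parts. *)
Definition dmx {n p q} (f : 'rV[R]_n -> 'M[C]_(p, q)) (x v : 'rV[R]_n) :
    'M[C]_(p, q) :=
  \matrix_(i, j) ('D_v (fun y => complex.Re (f y i j)) x
                   +i* 'D_v (fun y => complex.Im (f y i j)) x)%C.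

Definition pdmx {n p q} (k : 'I_n) (f : 'rV[R]_n -> 'M[C]_(p, q)) x :=
  dmx f x (delta_mx 0 k).

(* The Euclidean product [Re <u, v>] and the symplectic form
   [Im (\sum_k conj(u_k) v_k) = (\sum_k dx_k /\ dy_k)(u, v)] of C^m. *)
Definition cdot {m} (u v : 'cV[C]_m) : R :=
  complex.Re (\sum_k u k 0 * (v k 0)^*)%C.

Definition omega {m} (u v : 'cV[C]_m) : R :=
  complex.Im (\sum_k (u k 0)^* * v k 0)%C.

Definition rdot {n} (v w : 'rV[R]_n) : R := \sum_k v 0 k * w 0 k.

Definition immersive {n m} (f : 'rV[R]_n -> 'cV[C]_m) (x : 'rV[R]_n) : Prop :=
  injective (dmx f x).

Definition conformal {n m} (f : 'rV[R]_n -> 'cV[C]_m) (x : 'rV[R]_n) : Prop :=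
  exists2 c : R, 0 < c &
    forall v w, cdot (dmx f x v) (dmx f x w) = c * rdot v w.

Definition weakly_conformal {n m} (f : 'rV[R]_n -> 'cV[C]_m) x : Prop :=
  (forall v, dmx f x v = 0) \/ (immersive f x /\ conformal f x).

Definition immersion_locus {n m} (L : set 'rV[R]_n) (f : 'rV[R]_n -> 'cV[C]_m) :=
  [set z | L z /\ immersive f z].

Definition lagrangian_immersion {n} (U : set 'rV[R]_n)
    (Phi : 'rV[R]_n -> 'cV[C]_n) : Prop :=
  smooth_mx U Phi /\
  forall p, U p -> immersive Phi p /\
    forall v w, omega (dmx Phi p v) (dmx Phi p w) = 0.

Definition metric {n m} (Phi : 'rV[R]_n -> 'cV[C]_m) p : 'M[R]_n :=
  \matrix_(i, j) cdot (pdmx i Phi p) (pdmx j Phi p).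

Definition laplace_beltrami {n m} (Phi : 'rV[R]_n -> 'cV[C]_m)
    (b : 'rV[R]_n -> R) (p : 'rV[R]_n) : R :=
  let rho q := Num.sqrt (\det (metric Phi q)) in
  (rho p)^-1 * \sum_i
    'D_(delta_mx 0 i) (fun q => rho q *
       \sum_j invmx (metric Phi q) i j * 'D_(delta_mx 0 j) b q) p.

(* The columns of [E] are an orthonormal basis of the tangent space, positively
   oriented for the orientation that [Phi] transports from its domain. *)
Definition oriented_onb {n m} (Phi : 'rV[R]_n -> 'cV[C]_m) p (E : 'M[C]_(m, n)) :=
  (exists2 P : 'M[R]_n, 0 < \det P & forall k, col k E = dmx Phi p (row k P)) /\
  (forall j k, cdot (col j E) (col k E) = (j == k)%:R).

(* [\det E] is [(dz^1 /\ .. /\ dz^n)(e_1, .., e_n)], the [e_k] being the columns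
   of [E]. *)
Definition lagrangian_angle {n} (Phi : 'rV[R]_n -> 'cV[C]_n) p (b : R) : Prop :=
  exists2 E, oriented_onb Phi p E & \det E = (cos b +i* sin b)%C.

(* The angle is defined modulo [2 pi], hence the local lifts [b]. *)
Definition harmonic_angle {n} (U : set 'rV[R]_n) (Phi : 'rV[R]_n -> 'cV[C]_n) :=
  forall p, U p -> exists W, exists b : 'rV[R]_n -> R,
    [/\ open W, W p, W `<=` U, smooth W b &
        forall q, W q -> lagrangian_angle Phi q (b q) /\
                         laplace_beltrami Phi b q = 0].

Definition constant_angle {n} (U : set 'rV[R]_n) (Phi : 'rV[R]_n -> 'cV[C]_n) :=
  exists b : R, forall p, U p -> lagrangian_angle Phi p b.

End Calculus.

Section Cones.
Context {R : realType}.
Local Notation C := R[i].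

(* The plane C is 'rV[R]_2, with coordinates (x, y); the cone over a map [f] on
   the plane is parametrized by (x, y, r) |-> r f(x, y), r > 0. *)
Definition base_pt (p : 'rV[R]_3) : 'rV[R]_2 := \row_j p 0 (lift ord_max j).

Definition cone_domain (U : set 'rV[R]_2) : set 'rV[R]_3 :=
  [set p | U (base_pt p) /\ 0 < p 0 ord_max].

Definition cone_map (f : 'rV[R]_2 -> 'cV[C]_3) (p : 'rV[R]_3) : 'cV[C]_3 :=
  (p 0 ord_max)%:C%C *: f (base_pt p).

Definition maps_to_sphere (U : set 'rV[R]_2) (f : 'rV[R]_2 -> 'cV[C]_3) : Prop :=
  smooth_mx U f /\ forall z, U z -> cdot (f z) (f z) = 1.

Definition conformal_immersion (U : set 'rV[R]_2) (f : 'rV[R]_2 -> 'cV[C]_3) :=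
  forall z, U z -> immersive f z /\ conformal f z.

Definition parametrizes_lagrangian_link (U : set 'rV[R]_2) f : Prop :=
  maps_to_sphere U f /\ lagrangian_immersion (cone_domain U) (cone_map f).

Definition hamiltonian_stationary_cone (U : set 'rV[R]_2) f : Prop :=
  harmonic_angle (cone_domain U) (cone_map f).

Definition special_lagrangian_cone (U : set 'rV[R]_2) f : Prop :=
  constant_angle (cone_domain U) (cone_map f).

End Cones.

Section OrderFour.
Variables (F : fieldType) (V : lmodType F) (t : V -> V).
Hypotheses (tD : {morph t : x y / x + y}) (tZ : forall c, {morph t : x / c *: x}).
Hypothesis (t4 : forall x, t (t (t (t x))) = x).

Lemma order4_eigen (w : F) x : w ^+ 4 = 1 ->
  t (\sum_(k < 4) w ^- k *: iter k t x) = w *: \sum_(k < 4) w ^- k *: iter k t x.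
Proof.
move=> w4; have w0 : w != 0.
  by apply/eqP => w0; have/eqP := w4; rewrite w0 expr0n /= eq_sym oner_eq0.
rewrite 4!big_ord_recl big_ord0 /= addr0 !tD !tZ t4 !scalerDr !scalerA.
rewrite /bump /= !addn0 !addn1 expr0 invr1 expr1 mulr1 divff //.
have -> : w / w ^+ 2 = w^-1 by field.
have -> : w / w ^+ 3 = w ^- 2 by field.
have -> : w ^- 3 = w by rewrite -[LHS]mul1r -w4; field.
by rewrite scale1r [RHS]addrC !addrA.
Qed.

Lemma order4_sum (w : F) x : w ^+ 2 = -1 ->
  let s a := \sum_(k < 4) (w ^ a) ^- k *: iter k t x in
  s 0 + s 2 + s (-1) + s 1 = 4%:R *: x.
Proof.
move=> w2 s; have wV : w^-1 = - w.
  have w0 : w != 0.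
    apply/eqP => w0; have/eqP := w2.
    by rewrite w0 expr0n /= eq_sym oppr_eq0 oner_eq0.
  by apply: (mulfI w0); rewrite divff // mulrN -expr2 w2 opprK.
have c k : iter k t x + (w ^+ 2) ^- k *: iter k t x + w^-1 ^- k *: iter k t x
    + w ^- k *: iter k t x
    = (1 + (-1) ^+ k + w ^+ k + (- w) ^+ k) *: iter k t x.
  by rewrite w2 -!exprVn wV invrN1 invrN wV opprK !scalerDl scale1r.
have s0 : s 0 = \sum_(k < 4) iter k t x.
  by apply: eq_bigr => k _; rewrite expr0z expr1n invr1 scale1r.
have s2 : s 2 = \sum_(k < 4) (w ^+ 2) ^- k *: iter k t x by [].
have sN : s (-1) = \sum_(k < 4) w^-1 ^- k *: iter k t x by [].
have s1 : s 1 = \sum_(k < 4) w ^- k *: iter k t x by [].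
rewrite {}s0 {}s1 {}s2 {}sN -!big_split /=; under eq_bigr => k _ do rewrite c.
rewrite 4!big_ord_recl big_ord0 /= addr0 /bump /= !addn0 !addn1.
have e1 : 1 + (-1) ^+ 1 + w ^+ 1 + (- w) ^+ 1 = 0 by ring.
have e2 : 1 + (-1) ^+ 2 + w ^+ 2 + (- w) ^+ 2 = 0.
  by rewrite !sqrrN w2; ring.
have e3 : 1 + (-1) ^+ 3 + w ^+ 3 + (- w) ^+ 3 = 0 by ring.
have e0 : 1 + (-1) ^+ 0 + w ^+ 0 + (- w) ^+ 0 = 4%:R by ring.
by rewrite e0 e1 e2 e3 !scale0r !addr0.
Qed.
End OrderFour.

Section Automorphism.
Context {R : realType}.
Local Notation C := R[i].
Local Notation i := ('i%C : C).

Definition mx3 (s : seq (seq C)) : 'M[C]_3 := \matrix_(j, k) nth 0 (nth [::] s j) k.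

Definition eps3 : 'cV[C]_3 := delta_mx ord_max 0.

Definition T3 : 'M[C]_3 :=
  mx3 [:: [:: 0; 1; 0]; [:: -1; 0; 0]; [:: 0; 0; 1]].

Definition Yc : 'M[C]_3 := mx3 [:: [:: i; 0; 0]; [:: 0; i; 0]; [:: 0; 0; 0]].

Definition tau (X : 'M[C]_3) : 'M[C]_3 := - (T3 *m X^T *m invmx T3).

(* Component in the [i^a]-eigenspace of [tau]: as [tau] has order 4, the
   projector is the average of the [i^(- a k) tau^k]; see [tau_tau_comp] and
   [sum_tau_comp]. *)
Definition tau_comp (a : int) (X : 'M[C]_3) : 'M[C]_3 :=
  4^-1 *: \sum_(k < 4) (i ^ a) ^- k *: iter k tau X.

(* The projection of gl(3, C) onto the complexification of [m] along that of
   [h], the matrices supported in the upper left 2 x 2 block. *)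
Definition m_comp (X : 'M[C]_3) : 'M[C]_3 :=
  \matrix_(j, k) if (j == ord_max) || (k == ord_max) then X j k else 0.

Lemma T3_mulT : T3 *m T3^T = 1%:M.
Proof.
apply/matrixP => -[[|[|[|//]]] ?] [[|[|[|//]]] ?];
by rewrite !mxE !big_ord_recr big_ord0 /= !mxE /=
  ?(mulr0, mul0r, addr0, add0r, mulr1, mul1r, mulrNN).
Qed.

Lemma T3V : invmx T3 = T3^T.
Proof.
have [uT _] := mulmx1_unit T3_mulT.
by rewrite -[RHS]mul1mx -(mulVmx uT) -mulmxA T3_mulT mulmx1.
Qed.

Lemma tau2 X : tau (tau X) = T3 *m T3 *m X *m (T3 *m T3)^T.
Proof.
by rewrite /tau T3V linearN mulmxN mulNmx opprK /= !trmx_mul !trmxK !mulmxA.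
Qed.

Lemma T3_square : T3 *m T3 = mx3 [:: [:: -1; 0; 0]; [:: 0; -1; 0]; [:: 0; 0; 1]].
Proof.
apply/matrixP => -[[|[|[|//]]] ?] [[|[|[|//]]] ?];
by rewrite !mxE !big_ord_recr big_ord0 /= !mxE /=
  ?(mulr0, mul0r, addr0, add0r, mulr1, mul1r).
Qed.

Lemma tau4 X : iter 4 tau X = X.
Proof.
have T4 : T3 *m T3 *m (T3 *m T3) = 1%:M.
  rewrite T3_square; apply/matrixP => -[[|[|[|//]]] ?] [[|[|[|//]]] ?];
  by rewrite !mxE !big_ord_recr big_ord0 /= !mxE /=
    ?(mulr0, mul0r, addr0, add0r, mulr1, mul1r, mulrNN).
rewrite /= !tau2; move: (T3 *m T3) T4 => S T4.
have -> : S *m (S *m X *m S^T) *m S^T = S *m S *m X *m (S *m S)^T.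
  by rewrite trmx_mul !mulmxA.
by rewrite T4 trmx1 mulmx1 mul1mx.
Qed.

Lemma tauD X Y : tau (X + Y) = tau X + tau Y.
Proof. by rewrite /tau linearD mulmxDr mulmxDl opprD. Qed.

Lemma tauZ c X : tau (c *: X) = c *: tau X.
Proof. by rewrite /tau linearZ -scalemxAr -scalemxAl scalerN. Qed.

Lemma i4 : i ^+ 4 = 1.
Proof. by rewrite (exprM i 2 2) sqr_i sqrrN expr1n. Qed.

Lemma i_neq0 : i != 0.
Proof. by apply/eqP => i0; have/eqP := i4; rewrite i0 expr0n /= eq_sym oner_eq0. Qed.

Lemma tau_tau_comp a X : tau (tau_comp a X) = i ^ a *: tau_comp a X.
Proof.
have w4 : (i ^ a) ^+ 4 = 1 by rewrite exprnP exprzAC -exprnP i4 exp1rz.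
rewrite /tau_comp; move: (i ^ a) w4 => w w4.
have w0 : w != 0.
  by apply/eqP => w0; have/eqP := w4; rewrite w0 expr0n /= eq_sym oner_eq0.
rewrite tauZ scalerA mulrC -scalerA; congr (_ *: _).
by apply: order4_eigen => // [? ?|c ?|?]; [exact: tauD|exact: tauZ|exact: tau4].
Qed.

Lemma sum_tau_comp X :
  tau_comp 0 X + tau_comp 2 X + tau_comp (-1) X + tau_comp 1 X = X.
Proof.
rewrite /tau_comp -!scalerDr.
rewrite (order4_sum tau X (sqr_i R)).
by rewrite scalerA mulVf ?scale1r // pnatr_eq0.
Qed.

End Automorphism.

Section Forms.
Context {R : realType}.
Local Notation C := R[i].
Local Notation i := ('i%C : C).
Local Notation plane := 'rV[R]_2.

(* A matrix-valued 1-form [A dx + B dy] is the function [z |-> (A z, B z)]. *)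
Definition covector : Type := 'M[C]_3 * 'M[C]_3.
Definition form1 : Type := plane -> covector.

Definition cov_eval (w : covector) (v : plane) : 'M[C]_3 :=
  (v 0 0)%:C%C *: w.1 + (v 0 1)%:C%C *: w.2.

Definition cov_map (h : 'M[C]_3 -> 'M[C]_3) (w : covector) : covector :=
  (h w.1, h w.2).

(* [w(d/dz) dz] and [w(d/dzbar) dzbar], with [dz = dx + i dy]. *)
Definition part10 (w : covector) : covector :=
  let wz := 2^-1 *: (w.1 - i *: w.2) in (wz, i *: wz).

Definition part01 (w : covector) : covector :=
  let wzbar := 2^-1 *: (w.1 + i *: w.2) in (wzbar, - i *: wzbar).

(* [*dx = dy], [*dy = - dx]. *)
Definition hodge (w : covector) : covector := (- w.2, w.1).

(* 2-forms are given by their coefficient on [dx /\ dy]. *)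
Definition ext_d (a : form1) (z : plane) : 'M[C]_3 :=
  pdmx 0 (fun w => (a w).2) z - pdmx 1 (fun w => (a w).1) z.

Definition lie (X Y : 'M[C]_3) : 'M[C]_3 := X *m Y - Y *m X.

Definition wedge_bracket (v w : covector) : 'M[C]_3 := lie v.1 w.2 - lie v.2 w.1.

Definition flat (L : set plane) (a : form1) : Prop :=
  forall z, L z -> ext_d a z + 2^-1 *: wedge_bracket (a z) (a z) = 0.

Definition in_u3 (X : 'M[C]_3) : Prop := (X ^t*)%sesqui = - X.

Definition u3_form (L : set plane) (a : form1) : Prop :=
  [/\ smooth_mx L (fun z => (a z).1), smooth_mx L (fun z => (a z).2) &
      forall z, L z -> in_u3 (a z).1 /\ in_u3 (a z).2].

Definition form_comp (k : int) (a : form1) : form1 :=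
  fun z => cov_map (tau_comp k) (a z).

Definition m_condition (L : set plane) (a : form1) : Prop :=
  forall z, L z -> cov_map m_comp (a z)
    = part10 (form_comp (-1) a z) + part01 (form_comp 1 a z).

Definition takes_values_in_CY (L : set plane) (a : form1) : Prop :=
  forall z v, L z -> exists c : C, cov_eval (a z) v = c *: Yc.

Definition coclosed (L : set plane) (a : form1) : Prop :=
  forall z, L z -> ext_d (fun w => hodge (a w)) z = 0.

Definition vanishes (L : set plane) (a : form1) : Prop :=
  forall z, L z -> a z = 0.

Definition maurer_cartan (F : plane -> 'M[C]_3) : form1 :=
  fun z => (invmx (F z) *m pdmx 0 F z, invmx (F z) *m pdmx 1 F z).

Definition U3_map (L : set plane) (F : plane -> 'M[C]_3) : Prop :=
  smooth_mx L F /\ forall z, L z -> F z \is unitarymx.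

(* [dF = F a] *)
Definition integrates (L : set plane) (a : form1) (F : plane -> 'M[C]_3) : Prop :=
  forall z, L z ->
    pdmx 0 F z = F z *m (a z).1 /\ pdmx 1 F z = F z *m (a z).2.

Definition last_column (F : plane -> 'M[C]_3) : plane -> 'cV[C]_3 :=
  fun z => F z *m eps3.

End Forms.

(* Main.v *)
Require Import Defs.
From HB Require Import structures.
From mathcomp Require Import all_boot all_order all_algebra.
From mathcomp Require Import all_classical all_reals all_analysis.
From mathcomp Require Import complex ring lra.

Set Implicit Arguments.
Unset Strict Implicit.
Unset Printing Implicit Defensive.

Import Order.TTheory GRing.Theory Num.Theory.
Import numFieldNormedType.Exports.
Local Open Scope classical_set_scope.
Local Open Scope ring_scope.

(** The theorem is a dictionary between a map f into S^5 and a unitary frame F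
    with last column f.

    Geometry.  For a u(3)-valued form the condition on the m-component says that
    the last columns of its dx- and dy-coefficients are (s, t, 0) and
    (- conj t, conj s, 0) for some functions s, t ([m_conditionP]).  If F
    integrates the form, these are the coordinates of f_x and f_y in F
    ([frame_of_form]).  As F is unitary, the hermitian products of f_x, f_y, f are
    those of these columns: f_x, f_y are hermitian-orthogonal to each other and
    to f, with common squared norm |s|^2 + |t|^2.  The real parts say that f is
    weakly conformal and the imaginary parts that its cone is Lagrangian
    ([link_herm], [cone_herm]).  Conversely, for a conformal immersion whose cone is
    Lagrangian, the normalized f_x, f_y together with f form such a frame, with
    t = 0 ([link_frame_unitary], [link_frame_m_condition]); its Maurer-Cartan form is
    flat by the symmetry of second derivatives ([mc_flat]).

    Angle.  An oriented orthonormal basis of a tangent space of the cone is F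
    times a matrix of determinant 1, so exp(i beta) = det F ([cone_angle]).  By
    Jacobi's formula d beta is the trace of the form divided by i, and the trace
    only sees the degree 2 component ([trace_tau_comp_2]).  The Laplacian of the
    cone on functions of z is a multiple of the flat one ([cone_laplace]).
    Therefore beta is harmonic if that component is coclosed and constant if it
    vanishes.

    Integration.  That a flat form on a simply connected domain is F^-1 dF
    ([flat_integrable]) takes most of the work.  Locally, one solves the linear
    equation on a horizontal line and then on vertical lines by Picard
    iteration; flatness makes F(x + h, y) - F(x, y) - h F A of order h^2, because
    this quantity, suitably conjugated, has a y-derivative of order h^2
    ([frame_x_estimate], [local_frame]).  Globally, local solutions are unique up
    to a constant factor, so they can be continued along paths and over squares
    by gluing; a contraction of a loop shows that continuation around it is
    trivial ([trivial_monodromy]), and the value at the end of any path from a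
    base point is the global solution ([global_frame]). *)

(** * Differential calculus of real functions *)

Lemma near_on_open {T : topologicalType} (U : set T) (P : T -> Prop) z : open U ->
  (forall w, U w -> P w) -> U z -> \near z, P z.
Proof. by move=> oU UP Uz; apply: filterS (open_nbhs_nbhs (conj oU Uz)). Qed.

Section RealCk.
Context {R : realType} {n : nat}.
Implicit Types (U W : set 'rV[R]_n) (f g : 'rV[R]_n -> R) (k : nat).

Lemma differentiable_eps f x (L : {linear 'rV[R]_n -> R}) : continuous L ->
  (forall e : R, 0 < e ->
     \forall h \near (0 : 'rV[R]_n), `|f (h + x) - f x - L h| <= e * `|h|) ->
  differentiable f x /\ 'd f x = L :> ('rV[R]_n -> R).
Proof.
move=> cL H; suff [dfc dfe] : continuous ('d f x) /\
   f \o shift x = cst (f x) + 'd f x +o_ (0 : 'rV[R]_n) id.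
  split; first by apply/diff_locallyP.
  apply: diff_unique cL _; apply/eqaddoP => e e0; move: (H e e0).
  apply: filter_app; near=> h => Hh; by rewrite /= !fctE /= opprD addrA.
have E : f \o shift x = cst (f x) + L +o_ (0 : 'rV[R]_n) id.
  apply/eqaddoP => e e0; move: (H e e0); apply: filter_app; near=> h => Hh.
  by rewrite /= !fctE /= opprD addrA.
have dE := diff_unique cL E; rewrite dE; split => //.
Unshelve. all: by end_near. Qed.

(** Differentiability is a statement on the values near the point; the little-o
    expansion of f at x is one of g. *)
Lemma near_eq_differentiable f g x :
  (\near x, f x = g x) -> differentiable f x -> differentiable g x.
Proof.
move=> fg df; have [cd dd] := (diff_locallyP _ _).1 df.
suff [] : differentiable g x /\ 'd g x = 'd f x :> ('rV[R]_n -> R) by [].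
apply: differentiable_eps => // e e0.
have /eqaddoP /(_ e e0) := dd => H1.
have fg' : \forall h \near (0 : 'rV[R]_n), f (h + x) = g (h + x).
  by have := fg; rewrite (near_shift 0) /= subr0.
near=> h; have -> : g (h + x) = f (h + x) by apply/esym; near: h.
have <- : f x = g x by exact: nbhs_singleton fg.
have : `|(f \o shift x - (cst (f x) + 'd f x)) h| <= e * `|id h| by near: h.
by rewrite /= !fctE /= opprD addrA.
Unshelve. all: by end_near. Qed.

Lemma near_eq_continuous f g x :
  (\near x, f x = g x) -> {for x, continuous f} -> {for x, continuous g}.
Proof.
move=> fg; rewrite /prop_for /continuous_at -(nbhs_singleton fg) => cf.
exact: cvg_trans (near_eq_cvg fg) cf.
Qed.

(** Restates the recursion without unfolding [Ck] further down. *)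
Lemma CkSP k U f : Ck k.+1 U f ->
  (forall x, U x -> differentiable f x) /\ (forall i, Ck k U ('D_(delta_mx 0 i) f)).
Proof. by []. Qed.

Lemma Ck_eq k U f g : open U -> (forall x, U x -> f x = g x) ->
  Ck k U f -> Ck k U g.
Proof.
move=> oU; elim: k f g => [|k IH] f g fg /=.
  by move=> H x Ux; apply: near_eq_continuous (H x Ux); exact: near_on_open fg Ux.
move=> [H1 H2]; split=> [x Ux|i].
  by apply: near_eq_differentiable (H1 x Ux); exact: near_on_open fg Ux.
apply: IH (H2 i) => x Ux; apply: near_eq_derive; exact: near_on_open fg Ux.
Qed.

Lemma Ck_subset k U W f : W `<=` U -> Ck k U f -> Ck k W f.
Proof.
move=> WU; elim: k f => [|k IH] f /=; first by move=> H x /WU; apply: H.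
by move=> [H1 H2]; split=> [x /WU/H1 //|i]; apply: IH.
Qed.

Lemma CkS_continuous k U f x : Ck k U f -> U x -> {for x, continuous f}.
Proof.
by case: k => [|k] /= => [H|[H _]] Ux; [|apply: differentiable_continuous]; apply: H.
Qed.

Lemma CkW k U f : Ck k.+1 U f -> Ck k U f.
Proof.
elim: k f => [|k IH] f [H1 H2]; first by move=> x /H1; exact: differentiable_continuous.
by split => // i; apply: IH; apply: H2.
Qed.

Lemma Ck_differentiable k U f x : Ck k.+1 U f -> U x -> differentiable f x.
Proof. by move=> [H _]; apply: H. Qed.

Lemma Ck_cst k U (c : R) : Ck k U (fun=> c).
Proof.
elim: k c => [|k IH] c /=; first by move=> x _; exact: cst_continuous.
split=> [x _|i]; first exact: differentiable_cst.
have -> : 'D_(delta_mx 0 i) (fun=> c) = (fun=> 0) :> ('rV[R]_n -> R).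
  by apply/funext => x; rewrite derive_cst.
exact: IH.
Qed.

Lemma CkD k U f g : Ck k U f -> Ck k U g -> open U ->
  Ck k U (fun x => f x + g x).
Proof.
move=> + + oU; elim: k f g => [|k IH] f g /=.
  by move=> cf cg x Ux; apply: continuousD; [apply: cf|apply: cg].
move=> [df Df] [dg Dg]; split=> [x Ux|i].
  by apply: differentiableD; [apply: df|apply: dg].
apply: (Ck_eq oU) (IH _ _ (Df i) (Dg i)) => x Ux.
by rewrite [RHS]deriveD //; apply: diff_derivable; [apply: df|apply: dg].
Qed.

Lemma CkN k U f : Ck k U f -> open U -> Ck k U (fun x => - f x).
Proof.
move=> + oU; elim: k f => [|k IH] f /=.
  by move=> cf x Ux; apply: continuousN; apply: cf.
move=> [df Df]; split=> [x Ux|i].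
  by apply: differentiableN; apply: df.
apply: (Ck_eq oU) (IH _ (Df i)) => x Ux.
by rewrite [RHS]deriveN //; apply: diff_derivable; apply: df.
Qed.

Lemma CkM k U f g : Ck k U f -> Ck k U g -> open U ->
  Ck k U (fun x => f x * g x).
Proof.
move=> + + oU; elim: k f g => [|k IH] f g.
  by move=> cf cg x Ux; apply: continuousM; [apply: cf|apply: cg].
move=> Hf Hg; have [df Df] := CkSP Hf; have [dg Dg] := CkSP Hg; split=> [x Ux|i].
  by apply: differentiableM; [apply: df|apply: dg].
apply: (@Ck_eq _ _ (fun x => f x * 'D_(delta_mx 0 i) g x
                             + g x * 'D_(delta_mx 0 i) f x)) => //.
  by move=> x Ux; rewrite [RHS]deriveM //; apply: diff_derivable; [apply: df|apply: dg].
by apply: CkD => //; apply: IH => //; exact: CkW.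
Qed.

Lemma Ck_coord k U i : open U -> Ck k U (fun x : 'rV[R]_n => x 0 i).
Proof.
case: k => [|k] oU; first by move=> x _; exact: coord_continuous.
split=> [x _|j]; first exact: differentiable_coord.
apply: (Ck_eq oU _ (Ck_cst k U ((delta_mx 0 j : 'rV[R]_n) 0 i))) => x Ux.
rewrite deriveE; last exact: differentiable_coord.
have @L : {linear 'rV[R]_n -> R}.
  by exists (fun N : 'rV[R]_n => N 0 i); do 2![eexists]; do ?[constructor];
     rewrite ?mxE// => ? *; rewrite ?mxE//; move=> ?; rewrite !mxE.
by rewrite (_ : (fun _ => _) = L) // diff_lin //; exact: coord_continuous.
Qed.

Lemma is_derive_comp1 (phi : R -> R) (d : R) f x v :
  is_derive (f x) 1 phi d -> differentiable f x ->
  differentiable (fun y => phi (f y)) x /\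
  'D_v (fun y => phi (f y)) x = d * 'D_v f x.
Proof.
move=> [d1 d2] df; have dphi : differentiable phi (f x) by apply/derivable1_diffP.
have dc : differentiable (phi \o f) x by exact: differentiable_comp.
split; first exact: dc.
rewrite -[LHS]/('D_v (phi \o f) x) deriveE // diff_comp //= deriveE //.
by rewrite diff1E // derive1E d2 [RHS]mulrC.
Qed.

(** The induction step for composing with a function phi of one variable: the
    partial derivatives of phi o f are those of f times phi' o f.  Reciprocals,
    square roots and arctangents follow by induction, since their derivatives
    are expressed through the functions themselves. *)
Lemma CkS_comp1 k U (phi psi : R -> R) f : open U ->
  (forall x, U x -> is_derive (f x) 1 phi (psi (f x))) ->
  Ck k U (fun x => psi (f x)) -> Ck k.+1 U f -> Ck k.+1 U (fun x => phi (f x)).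
Proof.
move=> oU H C [df Df]; split=> [x Ux|i].
  by have [] := is_derive_comp1 0 (H x Ux) (df x Ux).
apply: (Ck_eq oU _ (CkM C (Df i) oU)) => x Ux.
by have [_ ->] := is_derive_comp1 (delta_mx 0 i) (H x Ux) (df x Ux).
Qed.

Lemma Ck_inv k U f : open U -> (forall x, U x -> f x != 0) ->
  Ck k U f -> Ck k U (fun x => (f x)^-1).
Proof.
move=> oU f0; elim: k => [|k IH] Hf.
  by move=> x Ux; apply: continuousV; [exact: f0|exact: Hf].
apply: (@CkS_comp1 _ _ _ (fun y => - (y^-1 * y^-1))) => //.
  move=> x Ux; apply: DeriveDef; first by apply: derivableV => //; exact: f0.
  rewrite (@deriveV _ _ id (f x) 1 (f0 x Ux)); last exact: derivable_id.
  by rewrite derive_id expr2 invfM scaleNr [_ *: _]mulr1.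
by apply: CkN => //; apply: CkM => //; apply: IH; apply: CkW.
Qed.

Lemma Ck_sqrt k U f : open U -> (forall x, U x -> 0 < f x) ->
  Ck k U f -> Ck k U (fun x => Num.sqrt (f x)).
Proof.
move=> oU f0; elim: k => [|k IH] Hf.
  move=> x Ux; apply: (@continuous_comp _ _ _ f Num.sqrt); first exact: Hf.
  exact: sqrt_continuous.
apply: (@CkS_comp1 _ _ _ (fun y => (2 * Num.sqrt y)^-1)) => //.
  by move=> x Ux; apply: is_derive1_sqrt; exact: f0.
apply: Ck_inv => //.
  by move=> x Ux; rewrite mulf_neq0 // ?pnatr_eq0 // gt_eqF // sqrtr_gt0 f0.
by apply: CkM => //; [exact: Ck_cst|apply: IH; apply: CkW].
Qed.

Lemma Ck_atan k U f : open U -> Ck k U f -> Ck k U (fun x => atan (f x)).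
Proof.
move=> oU; elim: k => [|k IH] Hf.
  move=> x Ux; apply: (@continuous_comp _ _ _ f atan); first exact: Hf.
  exact: continuous_atan.
apply: (@CkS_comp1 _ _ _ (fun y => (1 + y ^+ 2)^-1)) => //.
have Hf' := CkW Hf; apply: Ck_inv => //.
  by move=> x Ux; rewrite gt_eqF // ltr_pwDl // sqr_ge0.
apply: CkD => //; first exact: Ck_cst.
exact: CkM.
Qed.

End RealCk.

(** * Complex- and matrix-valued functions *)

Section ComplexCalculus.
Context {R : realType} {n : nat}.
Local Notation C := R[i].
Local Notation V := 'rV[R]_n.
Implicit Types (U : set V) (h : V -> C).

Definition CkC k U h :=
  Ck k U (fun x => complex.Re (h x)) /\ Ck k U (fun x => complex.Im (h x)).

Definition cdiff h x :=
  differentiable (fun y => complex.Re (h y)) x /\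
  differentiable (fun y => complex.Im (h y)) x.

(** The entrywise counterpart of [dmx]. *)
Definition dC h (x v : V) : C :=
  ('D_v (fun y => complex.Re (h y)) x +i* 'D_v (fun y => complex.Im (h y)) x)%C.

Lemma complex_ext (x y : C) :
  complex.Re x = complex.Re y -> complex.Im x = complex.Im y -> x = y.
Proof. by case: x => a b; case: y => c d /= -> ->. Qed.

Lemma cReD (x y : C) : complex.Re (x + y) = complex.Re x + complex.Re y.
Proof. by case: x; case: y. Qed.
Lemma cImD (x y : C) : complex.Im (x + y) = complex.Im x + complex.Im y.
Proof. by case: x; case: y. Qed.
Lemma cReN (x : C) : complex.Re (- x) = - complex.Re x.
Proof. by case: x. Qed.
Lemma cImN (x : C) : complex.Im (- x) = - complex.Im x.
Proof. by case: x. Qed.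
Lemma cReM (x y : C) : complex.Re (x * y) =
  complex.Re x * complex.Re y - complex.Im x * complex.Im y.
Proof. by case: x; case: y. Qed.
Lemma cImM (x y : C) : complex.Im (x * y) =
  complex.Re x * complex.Im y + complex.Im x * complex.Re y.
Proof. by case: x; case: y. Qed.
Lemma cReJ (x : C) : complex.Re (x^*)%C = complex.Re x.
Proof. by case: x. Qed.
Lemma cImJ (x : C) : complex.Im (x^*)%C = - complex.Im x.
Proof. by case: x. Qed.
Definition ReImE := (cReD, cImD, cReN, cImN, cReM, cImM, cReJ, cImJ).

Lemma Re_sum (I : Type) (r : seq I) (F : I -> C) :
  complex.Re (\sum_(i <- r) F i) = \sum_(i <- r) complex.Re (F i).
Proof. by elim: r => [|i r IH]; rewrite ?big_nil // !big_cons cReD IH. Qed.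
Lemma Im_sum (I : Type) (r : seq I) (F : I -> C) :
  complex.Im (\sum_(i <- r) F i) = \sum_(i <- r) complex.Im (F i).
Proof. by elim: r => [|i r IH]; rewrite ?big_nil // !big_cons cImD IH. Qed.

Lemma derive_ext (f g : V -> R) x v : (forall y, f y = g y) -> 'D_v f x = 'D_v g x.
Proof. by move=> /funext ->. Qed.

Lemma dC_ext h h' x v : (forall y, h y = h' y) -> dC h x v = dC h' x v.
Proof. by move=> /funext ->. Qed.

Lemma cdiff_ext h h' x : (forall y, h y = h' y) -> cdiff h x -> cdiff h' x.
Proof. by move=> /funext ->. Qed.

Lemma CkC_ext k U h h' : open U -> (forall x, U x -> h x = h' x) ->
  CkC k U h -> CkC k U h'.
Proof.
by move=> oU E [H1 H2]; split; [apply: Ck_eq H1|apply: Ck_eq H2] => // x Ux; rewrite E.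
Qed.

Lemma CkC_cst k U c : CkC k U (fun=> c).
Proof. by split; exact: Ck_cst. Qed.

Lemma CkCD k U h h' : open U -> CkC k U h -> CkC k U h' -> CkC k U (fun x => h x + h' x).
Proof.
move=> oU [H1 H2] [H3 H4]; split.
  by apply: (Ck_eq oU _ (CkD H1 H3 oU)) => x _; rewrite cReD.
by apply: (Ck_eq oU _ (CkD H2 H4 oU)) => x _; rewrite cImD.
Qed.

Lemma CkCN k U h : open U -> CkC k U h -> CkC k U (fun x => - h x).
Proof.
move=> oU [H1 H2]; split.
  by apply: (Ck_eq oU _ (CkN H1 oU)) => x _; rewrite cReN.
by apply: (Ck_eq oU _ (CkN H2 oU)) => x _; rewrite cImN.
Qed.

Lemma CkCJ k U h : open U -> CkC k U h -> CkC k U (fun x => (h x)^*)%C.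
Proof.
move=> oU [H1 H2]; split.
  by apply: (Ck_eq oU _ H1) => x _; rewrite cReJ.
by apply: (Ck_eq oU _ (CkN H2 oU)) => x _; rewrite cImJ.
Qed.

Lemma CkCM k U h h' : open U -> CkC k U h -> CkC k U h' -> CkC k U (fun x => h x * h' x).
Proof.
move=> oU [H1 H2] [H3 H4]; split.
  apply: (Ck_eq oU _ (CkD (CkM H1 H3 oU) (CkN (CkM H2 H4 oU) oU) oU)) => x _.
  by rewrite cReM.
by apply: (Ck_eq oU _ (CkD (CkM H1 H4 oU) (CkM H2 H3 oU) oU)) => x _; rewrite cImM.
Qed.

Lemma CkC_sum k U (I : Type) (r : seq I) (F : I -> V -> C) : open U ->
  (forall i, CkC k U (F i)) -> CkC k U (fun x => \sum_(i <- r) F i x).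
Proof.
move=> oU H; elim: r => [|i r IH].
  by apply: (CkC_ext oU _ (CkC_cst k U 0)) => x _; rewrite big_nil.
apply: (CkC_ext oU _ (CkCD oU (H i) IH)) => x _; by rewrite big_cons.
Qed.

Lemma CkC_real k U (f : V -> R) : Ck k U f -> CkC k U (fun x => (f x)%:C%C).
Proof. by move=> H; split => //; exact: Ck_cst. Qed.

Lemma CkC_cdiff k U h x : CkC k.+1 U h -> U x -> cdiff h x.
Proof. by move=> [[H1 _] [H2 _]] Ux; split; [apply: H1|apply: H2]. Qed.

Lemma CkC_dC k U h i : CkC k.+1 U h -> CkC k U (dC h ^~ (delta_mx 0 i)).
Proof. by move=> [[_ H1] [_ H2]]; split; [apply: H1|apply: H2]. Qed.

Lemma cdiff_near h h' x : (\near x, h x = h' x) -> cdiff h x -> cdiff h' x.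
Proof.
move=> E [H1 H2]; split.
  by apply: near_eq_differentiable H1; near do idtac; near=> y; congr complex.Re; near: y.
by apply: near_eq_differentiable H2; near=> y; congr complex.Im; near: y.
Unshelve. all: by end_near. Qed.

Lemma dC_near h h' x v : (\near x, h x = h' x) -> dC h x v = dC h' x v.
Proof.
move=> E; rewrite /dC; congr Complex; apply: near_eq_derive; near=> y.
  by congr complex.Re; near: y.
by congr complex.Im; near: y.
Unshelve. all: by end_near. Qed.

Lemma cdiff_cst c x : cdiff (fun=> c) x.
Proof. by split; exact: differentiable_cst. Qed.

Lemma dC_cst c x v : dC (fun=> c) x v = 0.
Proof. by rewrite /dC !derive_cst. Qed.

Lemma cdiffD h h' x : cdiff h x -> cdiff h' x -> cdiff (fun y => h y + h' y) x.
Proof.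
move=> [H1 H2] [H3 H4]; split.
  rewrite (_ : (fun y => _) = (fun y => complex.Re (h y)) + (fun y => complex.Re (h' y))).
    exact: differentiableD.
  by apply/funext => y; rewrite cReD.
rewrite (_ : (fun y => _) = (fun y => complex.Im (h y)) + (fun y => complex.Im (h' y))).
  exact: differentiableD.
by apply/funext => y; rewrite cImD.
Qed.

Lemma dCD h h' x v : cdiff h x -> cdiff h' x ->
  dC (fun y => h y + h' y) x v = dC h x v + dC h' x v.
Proof.
move=> [H1 H2] [H3 H4]; rewrite /dC; apply: complex_ext => /=.
  rewrite -[RHS]deriveD; try exact: diff_derivable.
  by apply: derive_ext => y; rewrite cReD.
rewrite -[RHS]deriveD; try exact: diff_derivable.
by apply: derive_ext => y; rewrite cImD.
Qed.

Lemma cdiffJ h x : cdiff h x -> cdiff (fun y => (h y)^*)%C x.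
Proof.
move=> [H1 H2]; split.
  by rewrite (_ : (fun y => _) = (fun y => complex.Re (h y))) //; apply/funext => y; rewrite cReJ.
rewrite (_ : (fun y => _) = - (fun y => complex.Im (h y))); first exact: differentiableN.
by apply/funext => y; rewrite cImJ.
Qed.

Lemma dCJ h x v : cdiff h x -> dC (fun y => (h y)^*)%C x v = ((dC h x v)^*)%C.
Proof.
move=> [H1 H2]; rewrite /dC; apply: complex_ext => /=.
  by apply: derive_ext => y; rewrite cReJ.
rewrite -[RHS]deriveN; last exact: diff_derivable.
by apply: derive_ext => y; rewrite cImJ.
Qed.

Lemma cdiffM h h' x : cdiff h x -> cdiff h' x -> cdiff (fun y => h y * h' y) x.
Proof.
move=> [H1 H2] [H3 H4]; split.
  rewrite (_ : (fun y => _) = (fun y => complex.Re (h y)) * (fun y => complex.Re (h' y))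
             - (fun y => complex.Im (h y)) * (fun y => complex.Im (h' y))).
    by apply: differentiableB; apply: differentiableM.
  by apply/funext => y; rewrite cReM.
rewrite (_ : (fun y => _) = (fun y => complex.Re (h y)) * (fun y => complex.Im (h' y))
             + (fun y => complex.Im (h y)) * (fun y => complex.Re (h' y))).
  by apply: differentiableD; apply: differentiableM.
by apply/funext => y; rewrite cImM.
Qed.

Lemma dCM h h' x v : cdiff h x -> cdiff h' x ->
  dC (fun y => h y * h' y) x v = dC h x v * h' x + h x * dC h' x v.
Proof.
move=> [H1 H2] [H3 H4]; rewrite /dC; apply: complex_ext => /=.
  rewrite (_ : (fun y => _) = (fun y => complex.Re (h y)) * (fun y => complex.Re (h' y))
             - (fun y => complex.Im (h y)) * (fun y => complex.Im (h' y))); last first.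
    by apply/funext => y; rewrite cReM.
  rewrite deriveB; [|by apply: diff_derivable; apply: differentiableM..].
  rewrite !deriveM; try exact: diff_derivable.
  rewrite !ReImE /= /GRing.scale /=.
  by move: (derive _ _ _) (derive _ _ _) (derive _ _ _) (derive _ _ _) => d1 d2 d3 d4; ring.
rewrite (_ : (fun y => _) = (fun y => complex.Re (h y)) * (fun y => complex.Im (h' y))
             + (fun y => complex.Im (h y)) * (fun y => complex.Re (h' y))); last first.
  by apply/funext => y; rewrite cImM.
rewrite deriveD; [|by apply: diff_derivable; apply: differentiableM..].
rewrite !deriveM; try exact: diff_derivable.
rewrite !ReImE /= /GRing.scale /=.
by move: (derive _ _ _) (derive _ _ _) (derive _ _ _) (derive _ _ _) => d1 d2 d3 d4; ring.
Qed.

Lemma cdiff_sum (I : Type) (r : seq I) (F : I -> V -> C) x :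
  (forall i, cdiff (F i) x) -> cdiff (fun y => \sum_(i <- r) F i y) x.
Proof.
move=> H; elim: r => [|i r IH].
  by rewrite (_ : (fun y => _) = fun=> 0); [exact: cdiff_cst|apply/funext => y; rewrite big_nil].
rewrite (_ : (fun y => _) = fun y => F i y + \sum_(i <- r) F i y); first exact: cdiffD.
by apply/funext => y; rewrite big_cons.
Qed.

Lemma dC_sum (I : Type) (r : seq I) (F : I -> V -> C) x v :
  (forall i, cdiff (F i) x) ->
  dC (fun y => \sum_(i <- r) F i y) x v = \sum_(i <- r) dC (F i) x v.
Proof.
move=> H; elim: r => [|i r IH].
  rewrite big_nil (_ : (fun y => _) = fun=> 0) ?dC_cst //.
  by apply/funext => y; rewrite big_nil.
rewrite big_cons -IH -dCD //; last exact: cdiff_sum.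
by apply: dC_ext => y; rewrite big_cons.
Qed.

Lemma derive_lin (f : V -> R) x v w (a b : R) : differentiable f x ->
  'D_(a *: v + b *: w) f x = a * 'D_v f x + b * 'D_w f x.
Proof. by move=> df; rewrite !deriveE // linearD !linearZ. Qed.

Lemma dC_lin h x v w (a b : R) : cdiff h x ->
  dC h x (a *: v + b *: w) = (a%:C)%C * dC h x v + (b%:C)%C * dC h x w.
Proof.
move=> [H1 H2]; rewrite /dC !derive_lin //.
move: (derive _ _ _) (derive _ _ _) (derive _ _ _) (derive _ _ _) => d1 d2 d3 d4.
by apply: complex_ext; rewrite !ReImE /= !mul0r ?subr0 ?addr0.
Qed.

End ComplexCalculus.

Section MatrixCalculus.
Context {R : realType} {n : nat}.
Local Notation C := R[i].
Local Notation V := 'rV[R]_n.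
Implicit Types (U : set V).

(** [Ckmx], [mxdiff] and [adj] stand for smoothness of finite order, real
    differentiability and the conjugate transpose, in the entrywise form in
    which [smooth_mx] and [dmx] are given. *)
Definition Ckmx {p q} k U (f : V -> 'M[C]_(p, q)) :=
  forall i j, CkC k U (fun x => f x i j).

Definition mxdiff {p q} (f : V -> 'M[C]_(p, q)) x :=
  forall i j, cdiff (fun y => f y i j) x.

Definition adj {p q} (X : 'M[C]_(p, q)) : 'M[C]_(q, p) := (map_mx (@conjc R) X)^T.

Lemma smooth_mxP {p q} U (f : V -> 'M[C]_(p, q)) :
  smooth_mx U f <-> forall k, Ckmx k U f.
Proof.
split=> [H k i j|H i j]; first by have [H1 H2] := H i j; split; [apply: H1|apply: H2].
by split=> k; have [] := H k i j.
Qed.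

Lemma dmxE {p q} (f : V -> 'M[C]_(p, q)) x v i j :
  dmx f x v i j = dC (fun y => f y i j) x v.
Proof. by rewrite mxE. Qed.

Lemma Ckmx_ext {p q} k U (f g : V -> 'M[C]_(p, q)) : open U ->
  (forall x, U x -> f x = g x) -> Ckmx k U f -> Ckmx k U g.
Proof. by move=> oU E H i j; apply: CkC_ext (H i j) => // x Ux; rewrite E. Qed.

Lemma Ckmx_subset {p q} k U W (f : V -> 'M[C]_(p, q)) : W `<=` U ->
  Ckmx k U f -> Ckmx k W f.
Proof. by move=> WU H i j; have [H1 H2] := H i j; split; apply: Ck_subset WU _. Qed.

Lemma Ckmx_cst {p q} k U (c : 'M[C]_(p, q)) : Ckmx k U (fun=> c).
Proof. by move=> i j; exact: CkC_cst. Qed.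

Lemma CkmxM {p q r} k U (f : V -> 'M[C]_(p, q)) (g : V -> 'M[C]_(q, r)) : open U ->
  Ckmx k U f -> Ckmx k U g -> Ckmx k U (fun x => f x *m g x).
Proof.
move=> oU Hf Hg i j.
apply: (@CkC_ext _ _ _ _ (fun x => \sum_l f x i l * g x l j)) => //.
  by move=> x _; rewrite mxE.
by apply: CkC_sum => // l; apply: CkCM; [|apply: Hf|apply: Hg].
Qed.

Lemma Ckmx_adj {p q} k U (f : V -> 'M[C]_(p, q)) : open U ->
  Ckmx k U f -> Ckmx k U (fun x => adj (f x)).
Proof.
move=> oU Hf i j; apply: (CkC_ext oU _ (CkCJ oU (Hf j i))) => x _.
by rewrite !mxE.
Qed.

Lemma CkmxS_dmx {p q} k U (f : V -> 'M[C]_(p, q)) i :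
  Ckmx k.+1 U f -> Ckmx k U (pdmx i f).
Proof.
move=> H j l; rewrite /pdmx.
rewrite (_ : (fun x => _) = (dC (fun y => f y j l) ^~ (delta_mx 0 i))); first exact: CkC_dC.
by apply/funext => x; rewrite dmxE.
Qed.

Lemma Ckmx_step {p q} k U (f : V -> 'M[C]_(p, q)) :
  (forall x, U x -> mxdiff f x) -> (forall i, Ckmx k U (pdmx i f)) -> Ckmx k.+1 U f.
Proof.
move=> df Df i j; split; split=> [x Ux|l].
- by have [] := df x Ux i j.
- have [+ _] := Df l i j; congr Ck; apply/funext => x.
  by rewrite /pdmx dmxE.
- by have [] := df x Ux i j.
- have [_ +] := Df l i j; congr Ck; apply/funext => x.
  by rewrite /pdmx dmxE.
Qed.

Lemma Ckmx_mxdiff {p q} k U (f : V -> 'M[C]_(p, q)) x : Ckmx k.+1 U f -> U x -> mxdiff f x.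
Proof. by move=> H Ux i j; apply: CkC_cdiff (H i j) Ux. Qed.

Lemma mxdiff_near {p q} (f g : V -> 'M[C]_(p, q)) x :
  (\near x, f x = g x) -> mxdiff f x -> mxdiff g x.
Proof.
move=> E H i j; apply: cdiff_near (H i j); near=> y.
by have -> : f y = g y by near: y.
Unshelve. all: by end_near. Qed.

Lemma dmx_near {p q} (f g : V -> 'M[C]_(p, q)) x v :
  (\near x, f x = g x) -> dmx f x v = dmx g x v.
Proof.
move=> E; apply/matrixP => i j; rewrite !dmxE; apply: dC_near; near=> y.
by have -> : f y = g y by near: y.
Unshelve. all: by end_near. Qed.

Lemma dmx_cst {p q} (c : 'M[C]_(p, q)) (x v : V) : dmx (fun=> c) x v = 0.
Proof. by apply/matrixP => i j; rewrite dmxE dC_cst mxE. Qed.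

Lemma mxdiff_cst {p q} (c : 'M[C]_(p, q)) (x : V) : mxdiff (fun=> c) x.
Proof. by move=> i j; exact: cdiff_cst. Qed.

Lemma mxdiffM {p q r} (f : V -> 'M[C]_(p, q)) (g : V -> 'M[C]_(q, r)) x :
  mxdiff f x -> mxdiff g x -> mxdiff (fun y => f y *m g y) x.
Proof.
move=> Hf Hg i j; apply: (@cdiff_ext _ _ (fun y => \sum_l f y i l * g y l j)) => [y|].
  by rewrite mxE.
by apply: cdiff_sum => l; apply: cdiffM.
Qed.

Lemma dmxM {p q r} (f : V -> 'M[C]_(p, q)) (g : V -> 'M[C]_(q, r)) x v :
  mxdiff f x -> mxdiff g x ->
  dmx (fun y => f y *m g y) x v = dmx f x v *m g x + f x *m dmx g x v.
Proof.
move=> Hf Hg; apply/matrixP => i j; rewrite dmxE (@dC_ext _ _ _ (fun y => \sum_l f y i l * g y l j)); last first.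
  by move=> y; rewrite mxE.
rewrite dC_sum; last by move=> l; apply: cdiffM.
rewrite mxE [X in X + _]mxE [X in _ + X]mxE -big_split /=; apply: eq_bigr => l _.
by rewrite dCM // !dmxE.
Qed.

Lemma mxdiff_adj {p q} (f : V -> 'M[C]_(p, q)) x :
  mxdiff f x -> mxdiff (fun y => adj (f y)) x.
Proof.
move=> Hf i j; rewrite (_ : (fun y => _) = fun y => ((f y j i)^*)%C); first exact: cdiffJ.
by apply/funext => y; rewrite !mxE.
Qed.

Lemma dmx_adj {p q} (f : V -> 'M[C]_(p, q)) x v : mxdiff f x ->
  dmx (fun y => adj (f y)) x v = adj (dmx f x v).
Proof.
move=> Hf; apply/matrixP => i j; rewrite dmxE mxE mxE dmxE -dCJ //.
by apply: dC_ext => y; rewrite !mxE.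
Qed.

Lemma dmx_lin {p q} (f : V -> 'M[C]_(p, q)) x v w (a b : R) : mxdiff f x ->
  dmx f x (a *: v + b *: w) = (a%:C)%C *: dmx f x v + (b%:C)%C *: dmx f x w.
Proof. by move=> Hf; apply/matrixP => i j; rewrite dmxE dC_lin // !mxE. Qed.

Lemma adjK {p q} (X : 'M[C]_(p, q)) : adj (adj X) = X.
Proof. by apply/matrixP => i j; rewrite !mxE conjcK. Qed.

Lemma adjM {p q r} (X : 'M[C]_(p, q)) (Y : 'M[C]_(q, r)) :
  adj (X *m Y) = adj Y *m adj X.
Proof. by rewrite /adj map_mxM trmx_mul. Qed.

Lemma adj_sesqui {p q} (X : 'M[C]_(p, q)) : (X ^t*)%sesqui = adj X.
Proof. by apply/matrixP => i j; rewrite !mxE. Qed.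

End MatrixCalculus.

Lemma dmx2 {R : realType} {p q} (f : 'rV[R]_2 -> 'M[R[i]]_(p, q)) x v : mxdiff f x ->
  dmx f x v = ((v 0 0)%:C)%C *: pdmx 0 f x + ((v 0 1)%:C)%C *: pdmx 1 f x.
Proof.
move=> Hf; rewrite /pdmx -dmx_lin //; congr dmx; apply/rowP => j.
by rewrite !mxE; case: j => -[|[|//]] Hj /=; rewrite ?(mulr1, mulr0, addr0, add0r);
  congr (v _ _); apply/val_inj.
Qed.

(** * Mean value estimates and their consequences *)

Section OneVariable.
Context {R : realType}.

Lemma mvt_abs (f df : R -> R) (K a b : R) :
  (forall t, Num.min a b <= t <= Num.max a b -> is_derive t 1 f (df t)) ->
  (forall t, Num.min a b <= t <= Num.max a b -> `|df t| <= K) ->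
  `|f b - f a| <= K * `|b - a|.
Proof.
wlog ab : a b / a <= b => [W H1 H2|].
  have [ab|/ltW ba] := leP a b; first exact: W.
  by rewrite distrC [X in _ * X]distrC; apply: W => // t;
    rewrite minC maxC; [apply: H1|apply: H2].
rewrite (min_idPl ab) (max_idPr ab) => H1 H2.
have cf : {within `[a, b], continuous f}.
  apply: derivable_within_continuous => t; rewrite in_itv /= => tab.
  by have [] := H1 t tab.
have [t|c + ->] := @MVT_segment R f df a b ab _ cf.
  by rewrite in_itv /= => /andP[/ltW ta /ltW tb]; apply: H1; rewrite ta tb.
rewrite in_itv /= => cab; rewrite normrM ler_wpM2r //; exact: H2.
Qed.

(** Two applications of the mean value theorem: the second difference over a
    square of side h is h^2 times the mixed derivative, up to its oscillation. *)
Lemma second_difference (F Fx Fxy : R -> R -> R) (x y h A e : R) : 0 <= h -> 0 <= e ->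
  (forall t s, x <= t <= x + h -> y <= s <= y + h ->
     [/\ is_derive t 1 (F ^~ s) (Fx t s), is_derive s 1 (Fx t) (Fxy t s)
       & `|Fxy t s - A| <= e]) ->
  `|F (x + h) (y + h) - F (x + h) y - F x (y + h) + F x y - h ^+ 2 * A| <= e * h ^+ 2.
Proof.
move=> h0 e0 H.
have xh : x <= x + h by rewrite lerDl.
have yh : y <= y + h by rewrite lerDl.
pose g t := F t (y + h) - F t y - t * (h * A).
have -> : F (x + h) (y + h) - F (x + h) y - F x (y + h) + F x y - h ^+ 2 * A
   = g (x + h) - g x by rewrite /g; ring.
have -> : e * h ^+ 2 = (e * h) * `|x + h - x|.
  by rewrite addrAC subrr add0r ger0_norm // expr2 mulrA.
apply: (mvt_abs (df := fun t => Fx t (y + h) - Fx t y - h * A)) => t;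
  rewrite (min_idPl xh) (max_idPr xh) => Ht.
  have [d1 _ _] := H t (y + h) Ht ltac:(by rewrite yh lexx).
  have [d2 _ _] := H t y Ht ltac:(by rewrite yh lexx).
  rewrite /g; apply: is_derive_eq.
  by rewrite /GRing.scale /= mulr1 mulr0 add0r.
pose k s := Fx t s - s * A.
have -> : Fx t (y + h) - Fx t y - h * A = k (y + h) - k y by rewrite /k; ring.
have -> : e * h = e * `|y + h - y| by rewrite addrAC subrr add0r ger0_norm.
apply: (mvt_abs (df := fun s => Fxy t s - A)) => s;
  rewrite (min_idPl yh) (max_idPr yh) => Hs; have [_ d1 b1] := H t s Ht Hs => //.
rewrite /k; apply: is_derive_eq.
by rewrite /GRing.scale /= mulr1 mulr0 add0r.
Qed.

End OneVariable.

Section LocallyConstant.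

Lemma connected_locally_const {T : topologicalType} {Y : Type} (A : set T) (f : T -> Y) :
  connected A -> (forall x, A x -> \forall y \near x, A y -> f y = f x) ->
  forall x y, A x -> A y -> f x = f y.
Proof.
move=> cA lc x y Ax Ay.
pose B := [set z | A z /\ f z = f x].
suff BA : B = A by have [] : B y by rewrite BA.
apply: cA; first by exists x.
- exists (interior [set z | A z -> f z = f x]); first exact: open_interior.
  apply/seteqP; split=> z.
    move=> [Az fz]; split=> //; apply: filterS (lc z Az) => w H /H ->; exact: fz.
  by move=> [Az /interior_subset H]; split=> //; exact: H.
- exists (~` interior [set z | A z -> f z <> f x]).
    exact/open_closedC/open_interior.
  apply/seteqP; split=> z.
    by move=> [Az fz]; split=> // /interior_subset /(_ Az).
  move=> [Az nz]; split=> //; apply: contrapT => fz; apply: nz.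
  by apply: filterS (lc z Az) => w H /H ->.
Qed.

End LocallyConstant.

Section Plane.
Context {R : realType}.
Local Notation V := 'rV[R]_2.

Definition pt (x y : R) : V := \row_j [:: x; y]`_j.

Lemma pt_x x y : pt x y 0 0 = x. Proof. by rewrite mxE. Qed.
Lemma pt_y x y : pt x y 0 1 = y. Proof. by rewrite mxE. Qed.

Lemma row2P (u v : V) : u 0 0 = v 0 0 -> u 0 1 = v 0 1 -> u = v.
Proof.
move=> H0 H1; apply/rowP => -[[|[|//]] Hj].
  by rewrite (_ : Ordinal Hj = 0) //; apply/val_inj.
by rewrite (_ : Ordinal Hj = 1) //; apply/val_inj.
Qed.

Lemma ptE (z : V) : z = pt (z 0 0) (z 0 1).
Proof. by apply: row2P; rewrite ?pt_x ?pt_y. Qed.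

Lemma norm2_le (z : V) (e : R) : (`|z| <= e) = (`|z 0 0| <= e) && (`|z 0 1| <= e).
Proof.
apply/idP/andP => [H|[H0 H1]].
  by split; apply: le_trans H; rewrite [leRHS]/Num.Def.normr /= mx_normrE;
    [apply: (le_bigmax _ (fun i => `|z i.1 i.2|) (0,0)) | apply: (le_bigmax _ (fun i => `|z i.1 i.2|) (0,1))].
rewrite [leLHS]/Num.Def.normr /= mx_normrE.
apply: bigmax_le => [|[i j] _ /=]; first exact: le_trans H0.
rewrite (ord1 i); case: j => -[|[|//]] Hj.
  by rewrite (_ : Ordinal Hj = 0) //; apply/val_inj.
by rewrite (_ : Ordinal Hj = 1) //; apply/val_inj.
Qed.

Lemma norm2_lt (z : V) (e : R) : (`|z| < e) = (`|z 0 0| < e) && (`|z 0 1| < e).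
Proof.
apply/idP/andP => [H|[H0 H1]].
  by have := lexx `|z|; rewrite norm2_le => /andP[H0 H1]; split; apply: le_lt_trans H.
have := lexx (Num.max `|z 0 0| `|z 0 1|).
rewrite ge_max -norm2_le => H; apply: le_lt_trans H _.
by rewrite gt_max H0 H1.
Qed.

Lemma ball2P (z w : V) (e : R) :
  ball z e w <-> `|w 0 0 - z 0 0| < e /\ `|w 0 1 - z 0 1| < e.
Proof.
rewrite -ball_normE /= distrC norm2_lt !mxE; split; first by move/andP.
by move=> [-> ->].
Qed.

Lemma is_derive_slice {n} (f : 'rV[R]_n -> R) (p v : 'rV[R]_n) (t : R) :
  differentiable f (p + t *: v) ->
  is_derive t 1 (fun s => f (p + s *: v)) ('D_v f (p + t *: v)).
Proof.
move=> df; have E : (fun h : R => h^-1 *: (((fun s => f (p + s *: v)) \o shift t) (h *: 1)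
      - f (p + t *: v)))
   = (fun h : R => h^-1 *: ((f \o shift (p + t *: v)) (h *: v) - f (p + t *: v))).
  apply/funext => h /=; congr (_ *: (f _ - _)).
  by rewrite [_%:A]mulr1 scalerDl addrCA.
by apply: DeriveDef; rewrite /derivable /derive E //; exact: (diff_derivable (v := v) df).
Qed.

Lemma is_derive_pt_x (f : V -> R) (x y : R) : differentiable f (pt x y) ->
  is_derive x 1 (fun t => f (pt t y)) ('D_(delta_mx 0 0) f (pt x y)).
Proof.
have E t : pt t y = pt 0 y + t *: delta_mx 0 0.
  by apply: row2P; rewrite !mxE /= ?mulr1 ?mulr0 ?add0r ?addr0.
rewrite E => /is_derive_slice; congr is_derive; apply/funext => t; by rewrite -E.
Qed.

Lemma is_derive_pt_y (f : V -> R) (x y : R) : differentiable f (pt x y) ->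
  is_derive y 1 (fun t => f (pt x t)) ('D_(delta_mx 0 1) f (pt x y)).
Proof.
have E t : pt x t = pt x 0 + t *: delta_mx 0 1.
  by apply: row2P; rewrite !mxE /= ?mulr1 ?mulr0 ?add0r ?addr0.
rewrite E => /is_derive_slice; congr is_derive; apply/funext => t; by rewrite -E.
Qed.

(** A function of two variables with continuous partial derivatives is
    differentiable: the increment is split along a horizontal and a vertical
    segment, each being handled by the mean value inequality. *)
Lemma C1_differentiable (f fx fy : V -> R) (p : V) (r : R) : 0 < r ->
  (forall z, ball p r z -> is_derive (z 0 0) 1 (fun t => f (pt t (z 0 1))) (fx z)) ->
  (forall z, ball p r z -> is_derive (z 0 1) 1 (fun t => f (pt (z 0 0) t)) (fy z)) ->
  {for p, continuous fx} -> {for p, continuous fy} ->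
  [/\ differentiable f p, 'D_(delta_mx 0 0) f p = fx p & 'D_(delta_mx 0 1) f p = fy p].
Proof.
move=> r0 Hx Hy cx cy.
have lin : linear (fun h : V => h 0 0 * fx p + h 0 1 * fy p : R^o).
  by move=> a u v /=; rewrite !mxE /GRing.scale /=; ring.
pose LM := GRing.isLinear.Build _ _ _ _ _ lin.
pose L : {linear V -> R^o} := HB.pack (fun h : V => h 0 0 * fx p + h 0 1 * fy p : R^o) LM.
have cL : continuous (L : V -> R).
  move=> h; apply: (@continuousD _ _ _ (fun h : V => h 0 0 * fx p) (fun h : V => h 0 1 * fy p));
  apply: continuousM; try exact: coord_continuous; exact: cst_continuous.
have [|df dL] := @differentiable_eps R 2 f p L cL; last first.
- split=> //; rewrite deriveE // dL /L /= !mxE /=; ring.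
- move=> e e0.
  have e20 : 0 < e / 2 by rewrite divr_gt0.
  have /cvgrPdist_le /(_ _ e20) /nbhs_ballP[d1 /= d10 Hd1] := cx.
  have /cvgrPdist_le /(_ _ e20) /nbhs_ballP[d2 /= d20 Hd2] := cy.
  pose d := Num.min r (Num.min d1 d2).
  have d0 : 0 < d by rewrite /d !lt_min r0 d10 d20.
  have [dr [dd1 dd2]] : d <= r /\ d <= d1 /\ d <= d2.
    by rewrite /d !ge_min !lexx !orbT.
  apply/nbhs_ballP; exists d => //= h; rewrite -ball_normE /= sub0r normrN norm2_lt.
  move=> /andP[h0 h1].
  set x := p 0 0; set y := p 0 1; set a := h 0 0; set b := h 0 1.
  have -> : h + p = pt (x + a) (y + b).
    by apply: row2P; rewrite !mxE /= addrC.
  have -> : f p = f (pt x y) by rewrite -ptE.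
  have between (u c t : R) : `|c| < d -> Num.min u (u + c) <= t <= Num.max u (u + c) ->
      `|t - u| < d.
    move=> cd /andP[]; rewrite ge_min le_max => H1 H2.
    by move: cd; rewrite !ltr_norml; lra.
  have key t s : `|t - x| < d -> `|s - y| < d -> ball p d (pt t s).
    by move=> Ht Hs; apply/ball2P; rewrite pt_x pt_y.
  have A1 : `|f (pt (x + a) (y + b)) - f (pt x (y + b)) - a * fx p| <= e / 2 * `|a|.
    pose g t := f (pt t (y + b)) - t * fx p.
    rewrite (_ : f _ - _ - _ = g (x + a) - g x); last by rewrite /g; ring.
    have -> : `|a| = `|x + a - x| by rewrite addrAC subrr add0r.
    apply: (mvt_abs (df := fun t => fx (pt t (y + b)) - fx p)) => t Ht.
      have Hb : ball p d (pt t (y + b)).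
        by apply: key; [exact: between Ht|rewrite addrAC subrr add0r].
      have := Hx _ (le_ball dr Hb); rewrite pt_x pt_y => D; rewrite /g.
      by apply: is_derive_eq; rewrite /GRing.scale /= mulr1 mulr0 add0r.
    rewrite distrC; apply: Hd1; apply: (le_ball dd1); apply: key; first exact: between Ht.
    by rewrite addrAC subrr add0r.
  have A2 : `|f (pt x (y + b)) - f (pt x y) - b * fy p| <= e / 2 * `|b|.
    pose g t := f (pt x t) - t * fy p.
    rewrite (_ : f _ - _ - _ = g (y + b) - g y); last by rewrite /g; ring.
    have -> : `|b| = `|y + b - y| by rewrite addrAC subrr add0r.
    apply: (mvt_abs (df := fun t => fy (pt x t) - fy p)) => t Ht.
      have Hb : ball p d (pt x t).
        by apply: key; [rewrite subrr normr0|exact: between Ht].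
      have := Hy _ (le_ball dr Hb); rewrite pt_x pt_y => D; rewrite /g.
      by apply: is_derive_eq; rewrite /GRing.scale /= mulr1 mulr0 add0r.
    rewrite distrC; apply: Hd2; apply: (le_ball dd2); apply: key; last exact: between Ht.
    by rewrite subrr normr0.
  have := lexx `|h|; rewrite norm2_le => /andP[ha hb].
  rewrite /L /= -/a -/b (_ : _ - _ - _ = (f (pt (x + a) (y + b)) - f (pt x (y + b)) - a * fx p)
     + (f (pt x (y + b)) - f (pt x y) - b * fy p)); last by ring.
  apply: le_trans (ler_normD _ _) _; apply: le_trans (lerD A1 A2) _.
  rewrite [leRHS](_ : _ = e / 2 * `|h| + e / 2 * `|h|); last by field.
  by apply: lerD; rewrite ler_pM2l.
Qed.

(** The second difference over a small square does not depend on the order in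
    which the two variables are moved, and it approximates either mixed
    derivative. *)
Lemma schwarz (U : set V) (f : V -> R) (p : V) : open U -> Ck 2 U f -> U p ->
  'D_(delta_mx 0 0) ('D_(delta_mx 0 1) f) p = 'D_(delta_mx 0 1) ('D_(delta_mx 0 0) f) p.
Proof.
move=> oU [df Df] Up.
have [d0 D0] := Df 0; have [d1 D1] := Df 1.
have c01 := D0 1 _ Up; have c10 := D1 0 _ Up.
set A := 'D_(delta_mx 0 0) _ p; set B := 'D_(delta_mx 0 1) _ p.
apply/eqP; rewrite -subr_eq0 -normr_le0; apply/ler_addgt0Pr => e e0; rewrite add0r.
have e20 : 0 < e / 2 by rewrite divr_gt0.
have /cvgrPdist_le /(_ _ e20) /nbhs_ballP[r1 /= r10 Hr1] := c01.
have /cvgrPdist_le /(_ _ e20) /nbhs_ballP[r2 /= r20 Hr2] := c10.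
have /nbhs_ballP[r3 /= r30 Hr3] := open_nbhs_nbhs (conj oU Up).
pose r := Num.min r1 (Num.min r2 r3).
have r0 : 0 < r by rewrite /r !lt_min r10 r20 r30.
have [rr1 [rr2 rr3]] : r <= r1 /\ r <= r2 /\ r <= r3.
  by rewrite /r !ge_min !lexx !orbT.
pose h := r / 2; have h0 : 0 < h by rewrite divr_gt0.
pose x := p 0 0; pose y := p 0 1.
have key t s : x <= t <= x + h -> y <= s <= y + h -> ball p r (pt t s).
  move=> Ht Hs; apply/ball2P; rewrite pt_x pt_y -/x -/y; move: Ht Hs h0.
  by rewrite /h !ltr_norml; split; lra.
have H1 := @second_difference R (fun t s => f (pt t s))
   (fun t s => 'D_(delta_mx 0 0) f (pt t s))
   (fun t s => 'D_(delta_mx 0 1) ('D_(delta_mx 0 0) f) (pt t s)) x y h B (e / 2) (ltW h0) (ltW e20).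
have H2 := @second_difference R (fun s t => f (pt t s))
   (fun s t => 'D_(delta_mx 0 1) f (pt t s))
   (fun s t => 'D_(delta_mx 0 0) ('D_(delta_mx 0 1) f) (pt t s)) y x h A (e / 2) (ltW h0) (ltW e20).
have {}H1 := H1 ltac:(move=> t s Ht Hs; have Hb := key t s Ht Hs; have Ub := Hr3 _ (le_ball rr3 Hb); split;
  [apply: is_derive_pt_x; exact: df|apply: is_derive_pt_y; exact: d0
  |rewrite distrC; apply: Hr1; exact: le_ball Hb]).
have {}H2 := H2 ltac:(move=> t s Ht Hs; have Hb := key s t Hs Ht; have Ub := Hr3 _ (le_ball rr3 Hb); split;
  [apply: is_derive_pt_y; exact: df|apply: is_derive_pt_x; exact: d1
  |rewrite distrC; apply: Hr2; exact: le_ball Hb]).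
have h2 : 0 < h ^+ 2 by rewrite exprn_gt0.
rewrite -(ler_pM2r h2) -[X in _ * X <= _](ger0_norm (ltW h2)) -normrM.
set S := f (pt (x + h) (y + h)) - f (pt (x + h) y) - f (pt x (y + h)) + f (pt x y) in H1.
set S' := f (pt (x + h) (y + h)) - _ - _ + _ in H2.
have SS : S' = S by rewrite /S /S'; ring.
rewrite SS in H2.
rewrite (_ : _ * _ = (S - h ^+ 2 * B) - (S - h ^+ 2 * A)); last by ring.
apply: le_trans (ler_normB _ _) _; apply: le_trans (lerD H1 H2) _.
by rewrite -mulrDl -splitr.
Qed.

End Plane.

Lemma ball_segment {R : realType} {n} (p z w : 'rV[R]_n) (r t : R) : 0 <= t <= 1 ->
  ball p r z -> ball p r w -> ball p r (z + t *: (w - z)).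
Proof.
move=> /andP[t0 t1]; rewrite -ball_normE /= => Hz Hw.
rewrite (_ : p - _ = (1 - t) *: (p - z) + t *: (p - w)); last first.
  by rewrite !scalerBr !scalerBl !scale1r; apply/rowP => j; rewrite !mxE; ring.
apply: le_lt_trans (ler_normD _ _) _; rewrite !normrZ (ger0_norm t0).
have t1' : 0 <= 1 - t by rewrite subr_ge0.
rewrite (ger0_norm t1') [ltRHS](_ : r = (1 - t) * r + t * r); last by ring.
have [t0'|tn0] := eqVneq t 0.
  by rewrite t0' subr0 !mul0r !addr0 !mul1r.
apply: ler_ltD; first by rewrite ler_wpM2l // ltW.
by rewrite ltr_pM2l // lt_neqAle eq_sym tn0.
Qed.

Lemma zero_derivative_ball {R : realType} {n} (p : 'rV[R]_n) (r : R) (f : 'rV[R]_n -> R) :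
  (forall z, ball p r z -> differentiable f z) ->
  (forall z v, ball p r z -> 'D_v f z = 0) ->
  forall z w, ball p r z -> ball p r w -> f z = f w.
Proof.
move=> df Df z w Hz Hw.
have H t : Num.min (0 : R) 1 <= t <= Num.max (0 : R) 1 -> ball p r (z + t *: (w - z)).
  by rewrite (min_idPl (@ler01 R)) (max_idPr (@ler01 R)) => Ht; exact: ball_segment.
have := @mvt_abs R (fun t => f (z + t *: (w - z))) (fun=> 0) 0 0 1.
rewrite scale0r addr0 scale1r [z + _]addrC subrK mul0r => K.
apply/eqP; rewrite eq_sym -subr_eq0 -normr_le0; apply: K => t Ht; last by rewrite normr0.
have Hb := H t Ht; rewrite -(Df _ (w - z) Hb); apply: is_derive_slice; exact: df.
Qed.

(** Only local constancy uses the derivative; a connected open set may fail to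
    be star-shaped, so that no segment joins two given points. *)
Lemma zero_derivative_connected {R : realType} {n} (L : set 'rV[R]_n) (f : 'rV[R]_n -> R) :
  open L -> connected L ->
  (forall z, L z -> differentiable f z) ->
  (forall z v, L z -> 'D_v f z = 0) ->
  forall z w, L z -> L w -> f z = f w.
Proof.
move=> oL cL df Df; apply: connected_locally_const => // z Lz.
have /nbhs_ballP[r /= r0 Hr] := open_nbhs_nbhs (conj oL Lz).
apply/nbhs_ballP; exists r => //= w Hw _.
apply: (@zero_derivative_ball _ _ z r) => // [u Hu|u v Hu|]; last exact: ballxx.
- exact/df/Hr.
- exact/Df/Hr.
Qed.

(** * Linear matrix equations on an interval *)

Section Primitive.
Context {R : realType}.
Notation mu := (@lebesgue_measure R).

Lemma continuous_primitive (g : R -> R) (a : R) : continuous g ->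
  exists G : R -> R, forall t, a < t -> is_derive t 1 G (g t).
Proof.
move=> cg; exists (fun x => (\int[mu]_(s in [set` `[a, x]]) g s)%R) => t at_.
have int : mu.-integrable `[a, t + 1] (EFin \o g).
  apply: continuous_compact_integrable; first exact: segment_compact.
  exact: continuous_subspaceT.
have [|d1 d2] := @continuous_FTC1_closed R g a t (t + 1) _ int at_ (cg t).
  by rewrite ltrDl.
exact: (DeriveDef d1 (etrans (esym (derive1E _ _)) d2)).
Qed.

Definition clamp (a b t : R) : R := Num.max a (Num.min b t).

Lemma clamp_in a b t : a <= b -> a <= clamp a b t <= b.
Proof. by move=> ab; rewrite /clamp le_max lexx /= ge_max ab ge_min lexx. Qed.

Lemma clamp_id a b t : a <= t <= b -> clamp a b t = t.
Proof. by move=> /andP[ta tb]; rewrite /clamp (min_idPr tb) (max_idPr ta). Qed.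

Lemma continuous_clamp a b : continuous (clamp a b).
Proof.
move=> t; apply: continuous_max; first exact: cst_continuous.
by apply: continuous_min; [exact: cst_continuous|exact: cvg_id].
Qed.

(** A primitive operator on continuous functions, made total by freezing the
    variable outside of the interval.  It contracts sup norms by the factor r,
    which is what the Picard iteration needs. *)
Lemma clamped_primitive (t0 r : R) : 0 < r ->
  exists P : (R -> R) -> R -> R,
  (forall g, continuous g ->
    [/\ continuous (P g), P g t0 = 0 &
        forall t, t0 - r < t < t0 + r -> is_derive t 1 (P g) (g t)]) /\
  (forall g g' e, continuous g -> continuous g' -> (forall s, `|g s - g' s| <= e) ->
     forall t, `|P g t - P g' t| <= r * e) /\
  (forall g e, continuous g -> (forall s, `|g s| <= e) -> forall t, `|P g t| <= r * e).
Proof.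
move=> r0; have /choice[prim Hprim] : forall g : R -> R, exists G : R -> R,
    continuous g -> forall t, t0 - r - 1 < t -> is_derive t 1 G (g t).
  move=> g; have [cg|ncg] := pselect (continuous g); last by exists g.
  by have [G HG] := continuous_primitive (t0 - r - 1) cg; exists G.
have ab : t0 - r <= t0 + r by lra.
pose cl := clamp (t0 - r) (t0 + r).
have clP t : t0 - r <= cl t <= t0 + r by exact: clamp_in.
have key (G dG : R -> R) e : (forall s, t0 - r - 1 < s -> is_derive s 1 G (dG s)) ->
    (forall s, `|dG s| <= e) -> forall t, `|G (cl t) - G t0| <= r * e.
  move=> HG He t; have e0 : 0 <= e by apply: le_trans (He t0).
  have := clP t; move: (cl t) => c Hc.
  apply: (@le_trans _ _ (e * `|c - t0|)); last first.
    by rewrite mulrC ler_wpM2r // ler_norml; lra.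
  apply: mvt_abs => s // Hs; apply: HG; move: Hs.
  by rewrite ge_min => /andP[/orP[]]; lra.
exists (fun g t => prim g (cl t) - prim g t0); split=> [g cg|].
  split.
  - move=> t; apply: (@continuousB _ _ _ (fun t => prim g (cl t)) (fun=> prim g t0));
      last exact: cst_continuous.
    apply: (@continuous_comp _ _ _ cl (prim g)); first exact: continuous_clamp.
    apply: differentiable_continuous; apply/derivable1_diffP.
    have [] // := Hprim g cg (cl t) _; have /andP[H _] := clP t; lra.
  - by rewrite /cl clamp_id ?subrr //; lra.
  - move=> t Ht.
    apply: (@near_eq_is_derive _ _ _ (fun t => prim g t - prim g t0)).
      have : \forall s \near t, s \in `](t0 - r), (t0 + r)[ by apply: near_in_itvoo; rewrite in_itv.
      apply: filterS => s; rewrite in_itv /= => Hs.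
      by rewrite /cl clamp_id //; lra.
    have D : is_derive t 1 (prim g) (g t) by apply: Hprim => //; lra.
    by apply: is_derive_eq; rewrite subr0.
split=> [g g' e cg cg' H t|g e cg H t]; last exact: key (Hprim g cg) H t.
set G := prim g; set G' := prim g'.
rewrite (_ : _ - _ = (G (cl t) - G' (cl t)) - (G t0 - G' t0)); last by ring.
apply: (key (fun s => G s - G' s) (fun s => g s - g' s)) => // s Hs.
have D1 := Hprim g cg s Hs; have D2 := Hprim g' cg' s Hs.
exact: is_deriveB.
Qed.

(** Completeness through nested intervals, with the rate of convergence. *)
Lemma geometric_limit (u : nat -> R) :
  (forall n, `|u n.+1 - u n| <= 2^-1 ^+ n) ->
  exists l, forall n, `|l - u n| <= 2 * 2^-1 ^+ n.
Proof.
move=> H; pose q n : R := 2^-1 ^+ n.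
have q0 n : 0 < q n by rewrite exprn_gt0.
have qS n : q n = 2 * q n.+1 by rewrite /q exprS mulrA divff ?mul1r // pnatr_eq0.
pose v n := u n - 2 * q n; pose w n := u n + 2 * q n.
have vS n : v n <= v n.+1.
  by have := H n; rewrite -/(q n) ler_norml /v; have := qS n; lra.
have wS n : w n.+1 <= w n.
  by have := H n; rewrite -/(q n) ler_norml /w; have := qS n; lra.
have vm n m : (n <= m)%N -> v n <= v m.
  elim: m => [|m IH]; first by rewrite leqn0 => /eqP ->.
  by rewrite leq_eqVlt => /orP[/eqP -> //|/IH K]; apply: le_trans K (vS m).
have wm n m : (n <= m)%N -> w m <= w n.
  elim: m => [|m IH]; first by rewrite leqn0 => /eqP ->.
  by rewrite leq_eqVlt => /orP[/eqP -> //|/IH K]; apply: le_trans (wS m) K.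
have vw n m : v n <= w m.
  have [nm|/ltnW mn] := leqP n m.
    by apply: le_trans (vm _ _ nm) _; rewrite /v /w; have := q0 m; lra.
  by apply: le_trans _ (wm _ _ mn); rewrite /v /w; have := q0 n; lra.
have hs : has_sup (range v).
  by split; [exists (v 0%N), 0%N|exists (w 0%N) => _ [n _ <-]].
exists (sup (range v)) => n.
have H1 : v n <= sup (range v) by apply: ub_le_sup; [exact: hs.2|exists n].
have H2 : sup (range v) <= w n by apply: ge_sup; [exact: hs.1|move=> _ [m _ <-]].
by rewrite ler_norml; move: H1 H2; rewrite /v /w /q; lra.
Qed.

Lemma le0_geometric (x c : R) : (forall n, x <= c * 2^-1 ^+ n) -> x <= 0.
Proof.
move=> H; apply/ler_addgt0Pr => e e0; rewrite add0r.
have c0 : 0 < `|c| + 1 by rewrite ltr_wpDl.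
have [n Hn] : exists n : nat, (`|c| + 1) / e < n%:R.
  by exists (Num.truncn ((`|c| + 1) / e)).+1; rewrite truncnS_gt.
apply: le_trans (H n) _.
have n2 : n%:R <= 2 ^+ n :> R by rewrite -natrX ler_nat ltnW // ltn_expl.
rewrite exprVn ler_pdivrMr ?exprn_gt0 //.
rewrite ltr_pdivrMr // in Hn.
have := ler_norm c; have : n%:R * e <= 2 ^+ n * e by rewrite ler_pM2r.
by rewrite [e * _]mulrC; lra.
Qed.

End Primitive.

Section MatrixDerivative.
Context {R : realType}.

(** A bound on all entries: products then cost a factor equal to the inner
    dimension, and an orthogonal matrix is bounded by 1. *)
Definition bnd {p q} (e : R) (X : 'M[R]_(p, q)) := forall i j, `|X i j| <= e.

Lemma mxBE {p q} (X Y : 'M[R]_(p, q)) i j : (X - Y) i j = X i j - Y i j.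
Proof. by rewrite !mxE. Qed.

Lemma bndM {p q s} a b (X : 'M[R]_(p, q)) (Y : 'M[R]_(q, s)) :
  0 <= a -> bnd a X -> bnd b Y -> bnd (q%:R * (a * b)) (X *m Y).
Proof.
move=> a0 HX HY i j; rewrite mxE; apply: le_trans (ler_norm_sum _ _ _) _.
apply: (@le_trans _ _ (\sum_(l < q) a * b)); last first.
  by rewrite sumr_const card_ord mulr_natl.
by apply: ler_sum => l _; rewrite normrM ler_pM.
Qed.

Lemma bndD {p q} a b (X Y : 'M[R]_(p, q)) : bnd a X -> bnd b Y -> bnd (a + b) (X + Y).
Proof. by move=> HX HY i j; rewrite mxE; apply: le_trans (ler_normD _ _) _; rewrite lerD. Qed.

Lemma bndW {p q} a b (X : 'M[R]_(p, q)) : bnd a X -> a <= b -> bnd b X.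
Proof. by move=> HX ab i j; apply: le_trans (HX i j) ab. Qed.

Lemma bndT {p q} a (X : 'M[R]_(p, q)) : bnd a X -> bnd a X^T.
Proof. by move=> HX i j; rewrite mxE. Qed.

Lemma bnd_orth {m} (X : 'M[R]_m) : X *m X^T = 1%:M -> bnd 1 X.
Proof.
move=> H i j; have := congr1 (fun Y : 'M[R]_m => Y i i) H; rewrite !mxE eqxx [RHS]mulr1n => E.
have : `|X i j| ^+ 2 <= 1.
  rewrite -E real_normK ?num_real // (bigD1 j) //= !mxE -expr2 lerDl.
  by apply: sumr_ge0 => l _; rewrite mxE -expr2 sqr_ge0.
by rewrite expr_le1.
Qed.

Definition mxderiv {p q} (X : R -> 'M[R]_(p, q)) (t : R) (D : 'M[R]_(p, q)) :=
  forall i j, is_derive t 1 (fun s => X s i j) (D i j).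

Lemma mxderivM {p q s} (X : R -> 'M[R]_(p, q)) (Y : R -> 'M[R]_(q, s)) t D E :
  mxderiv X t D -> mxderiv Y t E ->
  mxderiv (fun s => X s *m Y s) t (D *m Y t + X t *m E).
Proof.
move=> HX HY i j.
rewrite (_ : (fun s => _) = \sum_(l < q) ((fun s => X s i l) * (fun s => Y s l j))).
  apply: is_derive_eq.
    by apply: is_derive_sum => l; apply: is_deriveM; [exact: HX|exact: HY].
  rewrite !mxE -big_split; apply: eq_bigr => l _ /=.
  by rewrite /GRing.scale /= addrC [_ * D i l]mulrC.
apply/funext => u; rewrite mxE fct_sumE; exact: eq_bigr.
Qed.

Lemma mxderivD {p q} (X Y : R -> 'M[R]_(p, q)) t D E :
  mxderiv X t D -> mxderiv Y t E -> mxderiv (fun s => X s + Y s) t (D + E).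
Proof.
move=> HX HY i j; rewrite mxE.
rewrite (_ : (fun s => _) = (fun s => X s i j) + (fun s => Y s i j)).
  by apply: is_deriveD; [exact: HX|exact: HY].
by apply/funext => u; rewrite mxE.
Qed.

Lemma mxderivZ {p q} (X : R -> 'M[R]_(p, q)) t D (c : R) :
  mxderiv X t D -> mxderiv (fun s => c *: X s) t (c *: D).
Proof.
move=> HX i j; rewrite mxE.
rewrite (_ : (fun s => _) = c *: (fun s => X s i j)).
  by apply: is_deriveZ; exact: HX.
by apply/funext => u; rewrite mxE.
Qed.

Lemma mxderivT {p q} (X : R -> 'M[R]_(p, q)) t D :
  mxderiv X t D -> mxderiv (fun s => (X s)^T) t D^T.
Proof.
move=> HX i j; rewrite mxE (_ : (fun s => _) = (fun s => X s j i)); first exact: HX.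
by apply/funext => u; rewrite mxE.
Qed.

Lemma mxderiv_cst {p q} (X : 'M[R]_(p, q)) t : mxderiv (fun=> X) t 0.
Proof. by move=> i j; rewrite mxE; exact: is_derive_cst. Qed.

Lemma mxmvt {p q} (X : R -> 'M[R]_(p, q)) (D : R -> 'M[R]_(p, q)) K a b :
  (forall t, Num.min a b <= t <= Num.max a b -> mxderiv X t (D t)) ->
  (forall t, Num.min a b <= t <= Num.max a b -> bnd K (D t)) ->
  bnd (K * `|b - a|) (X b - X a).
Proof.
move=> H1 H2 i j; rewrite !mxE.
apply: (@mvt_abs _ (fun s => X s i j) (fun s => D s i j)) => t Ht; first exact: H1.
exact: H2.
Qed.

Lemma mxmvt_affine {p q} (X D : R -> 'M[R]_(p, q)) (Y : 'M[R]_(p, q)) K a b :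
  (forall t, Num.min a b <= t <= Num.max a b -> mxderiv X t (D t)) ->
  (forall t, Num.min a b <= t <= Num.max a b -> bnd K (D t - Y)) ->
  bnd (K * `|b - a|) (X b - X a - (b - a) *: Y).
Proof.
move=> H1 H2 i j; pose g t := X t i j - t * Y i j.
rewrite (_ : _ i j = g b - g a); last by rewrite /g !mxE; ring.
apply: (@mvt_abs _ g (fun t => D t i j - Y i j)) => t Ht; last by rewrite -mxBE; exact: H2.
have Dt := H1 t Ht i j; rewrite /g; apply: is_derive_eq.
by rewrite /GRing.scale /= mulr1 mulr0 add0r.
Qed.

Lemma continuous_sum {T : topologicalType} (I : Type) (s : seq I) (f : I -> T -> R) (x : T) :
  (forall i, {for x, continuous (f i)}) -> {for x, continuous (fun t => \sum_(i <- s) f i t)}.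
Proof.
move=> cf; elim: s => [|i s IH].
  rewrite (_ : (fun t => _) = fun=> 0); first exact: cst_continuous.
  by apply/funext => u; rewrite big_nil.
rewrite (_ : (fun t => _) = (fun t => f i t + \sum_(i <- s) f i t)).
  by apply: (@continuousD _ _ _ (f i)); [exact: cf|exact: IH].
by apply/funext => u; rewrite big_cons.
Qed.

(** Existence for X' = X M, X(t0) = 1, on an interval so short that the integral
    operator contracts by 1/2; the iterates then converge geometrically, uniformly
    in t, and the limit is a continuous fixed point. *)
Lemma picard {m} (M : R -> 'M[R]_m) (t0 r K : R) : 0 < r ->
  (forall i j, continuous (fun t => M t i j)) -> (forall t, bnd K (M t)) ->
  m.+1%:R * K * r <= 2^-1 ->
  exists X : R -> 'M[R]_m, X t0 = 1%:M /\
    forall t, t0 - r < t < t0 + r -> mxderiv X t (X t *m M t).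
Proof.
move=> r0 cM bM small.
case: m M cM bM small => [|m] M cM bM small.
  by exists (fun=> 1%:M); split=> // t _ [].
have K0 : 0 <= K by apply: le_trans (bM 0 0 0).
have mKr : r * (m.+1%:R * K) <= 2^-1.
  apply: le_trans small; rewrite mulrC ler_pM2r // ler_wpM2r // ler_nat //.
have Kr : r * K <= 1.
  apply: le_trans (_ : 2^-1 <= 1); last by rewrite invf_le1 ?ler1n.
  apply: le_trans mKr; rewrite ler_pM2l // ler_peMl // ler1n //.
have [P [P1 [P2 P3]]] := clamped_primitive t0 r0.
pose op (X : R -> 'M[R]_m.+1) t : 'M[R]_m.+1 :=
  1%:M + \matrix_(i, j) P (fun s => (X s *m M s) i j) t.
pose ctn (X : R -> 'M[R]_m.+1) := forall i j, continuous (fun t => X t i j).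
have cXM X i j : ctn X -> continuous (fun s => (X s *m M s) i j).
  move=> cX t; rewrite (_ : (fun s => _) = (fun s => \sum_(l < m.+1) X s i l * M s l j)); last first.
    by apply/funext => s; rewrite mxE.
  apply: continuous_sum => l; apply: continuousM; [exact: cX|exact: cM].
have cop X : ctn X -> ctn (op X).
  move=> cX i j t; rewrite (_ : (fun s => _) = (fun s => (1%:M : 'M[R]_m.+1) i j + P (fun s => (X s *m M s) i j) s)); last first.
    by apply/funext => s; rewrite !mxE.
  have [cP _ _] := P1 _ (cXM X i j cX).
  apply: (@continuousD _ _ _ (fun=> _) (P (fun s => (X s *m M s) i j))); last exact: cP.
  exact: cst_continuous.
have lip X Y e : ctn X -> ctn Y -> 0 <= e -> (forall t, bnd e (X t - Y t)) ->
    forall t, bnd (e / 2) (op X t - op Y t).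
  move=> cX cY e0 H t i j; rewrite /op !mxE opprD addrACA subrr add0r.
  apply: le_trans (P2 _ _ (m.+1%:R * (e * K)) (cXM X i j cX) (cXM Y i j cY) _ t) _.
    move=> s; have := @bndM _ _ _ e K (X s - Y s) (M s) e0 (H s) (bM s) i j.
    by rewrite mulmxBl !mxE.
  rewrite [leLHS](_ : _ = r * (m.+1%:R * K) * e); last by ring.
  by rewrite [leRHS]mulrC ler_wpM2r.
pose X n := iter n op (fun=> 1%:M).
have cX n : ctn (X n).
  by elim: n => [|n IH]; [move=> i j; exact: cst_continuous|exact: cop].
have dX n t : bnd (2^-1 ^+ n) (X n.+1 t - X n t).
  elim: n t => [|n IH] t.
    move=> i j; rewrite /X /= /op addrAC subrr add0r mxE expr0.
    apply: le_trans Kr; apply: P3 => [|s]; last by rewrite mul1mx; exact: bM.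
    by rewrite (_ : (fun s => _) = (fun s => M s i j)) //; apply/funext => s; rewrite mul1mx.
  have q0 : 0 <= (2^-1 : R) ^+ n by rewrite exprn_ge0.
  by rewrite exprSr; exact: (lip (X n.+1) (X n) _ (cX n.+1) (cX n) q0 IH t).
have /choice[Y HY] : forall t, exists Yt : 'M[R]_m.+1, forall n, bnd (2 * 2^-1 ^+ n) (Yt - X n t).
  move=> t; have /choice[f Hf] : forall ij : 'I_m.+1 * 'I_m.+1, exists l : R,
      forall n, `|l - X n t ij.1 ij.2| <= 2 * 2^-1 ^+ n.
    by move=> ij; apply: geometric_limit => n; have := dX n t ij.1 ij.2; rewrite !mxE.
  by exists (\matrix_(i, j) f (i, j)) => n i j; rewrite !mxE; exact: Hf (i, j) n.
have cY : ctn Y.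
  move=> i j t; apply/cvgrPdist_le => e e0.
  have [n Hn] : exists n, 2 * 2^-1 ^+ n <= e / 4.
    apply: contrapT => /forallNP H.
    have : e / 4 <= 0.
      apply: (@le0_geometric _ _ 2) => n; have := H n => /negP; rewrite -ltNge; exact: ltW.
    by apply/negP; rewrite -ltNge divr_gt0.
  have e20 : 0 < e / 2 by rewrite divr_gt0.
  have /cvgrPdist_le /(_ _ e20) := cX n i j t; apply: filterS => s Hs.
  have := HY t n i j; have := HY s n i j; rewrite !mxE => H1 H2.
  rewrite (_ : _ - _ = (Y t i j - X n t i j) - (Y s i j - X n s i j) + (X n t i j - X n s i j)); last by ring.
  apply: le_trans (ler_normD _ _) _.
  apply: le_trans (lerD (ler_normB _ _) (lexx _)) _; lra.
have fix_ t : Y t = op Y t.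
  apply/matrixP => i j; apply/eqP; rewrite -subr_eq0 -normr_le0.
  apply: (@le0_geometric _ _ 2) => n.
  have H1 : `|Y t i j - X n.+1 t i j| <= 2 * 2^-1 ^+ n.+1.
    by rewrite -mxBE; exact: HY.
  have H2 := @lip Y (X n) (2 * 2^-1 ^+ n) cY (cX n) _ (HY ^~ n) t i j.
  have {}H2 : `|op Y t i j - X n.+1 t i j| <= 2 * 2^-1 ^+ n / 2.
    by have := H2 ltac:(by rewrite mulr_ge0 // exprn_ge0); rewrite mxBE.
  rewrite (_ : _ - _ = (Y t i j - X n.+1 t i j) - (op Y t i j - X n.+1 t i j)); last by ring.
  apply: le_trans (ler_normB _ _) _; apply: le_trans (lerD H1 H2) _.
  by rewrite exprS; lra.
exists Y; split.
  rewrite fix_ /op; apply/matrixP => i j; rewrite !mxE.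
  by have [_ -> _] := P1 _ (cXM Y i j cY); rewrite addr0.
move=> t Ht i j.
have [_ _ D] := P1 _ (cXM Y i j cY); have {}D := D t Ht.
rewrite (_ : (fun s => _) = (fun s => (1%:M : 'M[R]_m.+1) i j + P (fun s => (Y s *m M s) i j) s)); last first.
  by apply/funext => s; rewrite {1}fix_ /op !mxE.
by apply: is_derive_eq; rewrite add0r mul1r.
Qed.

End MatrixDerivative.

(** * Parallel frames of a flat connection on a small disc *)

(** Products are made atoms so that the remaining identities are additive, and
    [ring] can check them entry by entry. *)
Ltac mx_abel :=
  repeat match goal with |- context [?P *m ?Q] =>
    let X := fresh in set X := (P *m Q); clearbody X end;
  apply/matrixP => ? ?; rewrite ?mxE; ring.

Section LocalFrame.
Context {R : realType}.
Local Notation V := 'rV[R]_2.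

Lemma eq_ler (x y : R) : x = y -> x <= y.
Proof. by move->. Qed.

Lemma between_abs (u v t c r : R) : `|u - c| < r -> `|v - c| < r ->
  Num.min u v <= t <= Num.max u v -> `|t - c| < r /\ `|t - u| <= `|v - u|.
Proof.
wlog uv : u v / u <= v => [W|].
  have /orP[uv|vu] := le_total u v; first exact: W.
  move=> H1 H2 H3; have [|] := W v u vu H2 H1; first by rewrite minC maxC.
  move=> H4 _; split=> //; move: H3.
  rewrite (min_idPr vu) (max_idPl vu) => /andP[H3 H5].
  by rewrite [leRHS]ler0_norm ?subr_le0 // ler_norml; lra.
rewrite (min_idPl uv) (max_idPr uv) => H1 H2 H3.
move: H1 H2; rewrite !ltr_norml => H1 H2; split; first by lra.
by rewrite (ger0_norm (_ : 0 <= v - u)) ?subr_ge0 // ler_norml; lra.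
Qed.

(** The derivative of X X^T is X (M + M^T) X^T = 0. *)
Lemma orth_of_skew {m} (X M : R -> 'M[R]_m) (t0 r : R) :
  X t0 = 1%:M -> (forall t, `|t - t0| < r -> mxderiv X t (X t *m M t)) ->
  (forall t, (M t)^T = - M t) -> forall t, `|t - t0| < r -> X t *m (X t)^T = 1%:M.
Proof.
move=> X0 dX sM t Ht.
have r0 : `|t0 - t0| < r by rewrite subrr normr0; apply: le_lt_trans Ht.
have H i j : `|(X t *m (X t)^T - X t0 *m (X t0)^T) i j| <= 0 * `|t - t0|.
  apply: (@mxmvt _ _ _ (fun s => X s *m (X s)^T) (fun=> 0)) => s Hs; last first.
    by move=> a b; rewrite mxE normr0.
  have [Hs' _] := between_abs r0 Ht Hs.
  have D := mxderivM (dX s Hs') (mxderivT (dX s Hs')).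
  move: D; rewrite trmx_mul sM mulNmx mulmxN mulmxA addrN; exact.
apply/matrixP => i j; have := H i j.
rewrite mxBE mul0r normr_le0 subr_eq0 X0 trmx1 mulmx1 => /eqP; exact.
Qed.

(** The frame F solves the equation in y on every vertical line and the equation
    in x on the line y = y0 only; this is where flatness yields the equation in
    x everywhere.  With E = F(x',y) F(x,y)^T and N = F A F^T, both E - 1 and
    D = E - 1 - (x' - x) N satisfy equations in y.  That for E has a right-hand
    side of size |x' - x|, so F is Lipschitz in x.  By flatness N has
    y-derivative F (dB/dx) F^T, so the y-derivative of D is of size
    |x' - x|^2; and D(y0) is of the same size.  Hence
    F(x',y) - F(x,y) = (x' - x) F A + O(|x' - x|^2), with no need for
    differentiability of solutions with respect to parameters. *)
Lemma frame_x_estimate {m} (F A B Ax Ay Bx Bxx : R -> R -> 'M[R]_m) (x0 y0 r K : R) :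
  0 < r -> 0 <= K ->
  (forall x t, `|x - x0| < r -> `|t - y0| < r ->
    [/\ F x t *m (F x t)^T = 1%:M, (A x t)^T = - A x t & (B x t)^T = - B x t] /\
    [/\ mxderiv (F x) t (F x t *m B x t), mxderiv (A x) t (Ay x t),
        mxderiv (A ^~ t) x (Ax x t), mxderiv (B ^~ t) x (Bx x t) &
        mxderiv (Bx ^~ t) x (Bxx x t)] /\
    [/\ bnd K (A x t), bnd K (Ax x t), bnd K (Bx x t), bnd K (Bxx x t) &
        Bx x t - Ay x t + (A x t *m B x t - B x t *m A x t) = 0]) ->
  (forall x, `|x - x0| < r -> mxderiv (F ^~ y0) x (F x y0 *m A x y0)) ->
  exists C, 0 <= C /\ forall x x' t, `|x - x0| < r -> `|x' - x0| < r -> `|t - y0| < r ->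
    bnd (C * `|x' - x|) (F x' t - F x t) /\
    bnd (C * `|x' - x| ^+ 2) (F x' t - F x t - (x' - x) *: (F x t *m A x t)).
Proof.
move=> r0 K0 H HG; set mm : R := m%:R; have mm0 : 0 <= mm by rewrite /mm ler0n.
have y0r : `|y0 - y0| < r by rewrite subrr normr0.
have bF x t : `|x - x0| < r -> `|t - y0| < r -> bnd 1 (F x t).
  by move=> Hx Ht; have [[H1 _ _] _] := H x t Hx Ht; exact: bnd_orth.
have oF x t : `|x - x0| < r -> `|t - y0| < r -> (F x t)^T *m F x t = 1%:M.
  by move=> Hx Ht; have [[H1 _ _] _] := H x t Hx Ht; exact: mulmx1C.
pose k1 := mm * (1 * K).
have L0 x x' : `|x - x0| < r -> `|x' - x0| < r -> bnd (k1 * `|x' - x|) (F x' y0 - F x y0).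
  move=> Hx Hx'; apply: (@mxmvt _ _ _ (F ^~ y0) (fun s => F s y0 *m A s y0)) => s Hs;
  have [Hs' _] := between_abs Hx Hx' Hs; first exact: HG.
  have [_ [_ [bA _ _ _ _]]] := H s y0 Hs' y0r.
  by apply: bndM => //; exact: bF.
have lip (Y Y' : R -> R -> 'M[R]_m) : (forall s t, `|s - x0| < r -> `|t - y0| < r ->
      mxderiv (Y ^~ t) s (Y' s t) /\ bnd K (Y' s t)) ->
    forall x x' t, `|x - x0| < r -> `|x' - x0| < r -> `|t - y0| < r ->
    bnd (K * `|x' - x|) (Y x' t - Y x t).
  move=> HY x x' t Hx Hx' Ht; apply: (@mxmvt _ _ _ (Y ^~ t) (Y' ^~ t)) => s Hs;
  by have [Hs' _] := between_abs Hx Hx' Hs; have [] := HY s t Hs' Ht.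
have dB := lip B Bx (fun s t Hs Ht => let: conj _ (conj (And5 _ _ _ D _) (And5 _ _ b _ _)) := H s t Hs Ht in conj D b).
have dA := lip A Ax (fun s t Hs Ht => let: conj _ (conj (And5 _ _ D _ _) (And5 _ b _ _ _)) := H s t Hs Ht in conj D b).
have dBx := lip Bx Bxx (fun s t Hs Ht => let: conj _ (conj (And5 _ _ _ _ D) (And5 _ _ _ b _)) := H s t Hs Ht in conj D b).
pose E x x' t := F x' t *m (F x t)^T.
have dE x x' t : `|x - x0| < r -> `|x' - x0| < r -> `|t - y0| < r ->
    mxderiv (E x x') t (F x' t *m (B x' t - B x t) *m (F x t)^T).
  move=> Hx Hx' Ht; have [[_ _ sB] [[D _ _ _ _] _]] := H x t Hx Ht.
  have [_ [[D' _ _ _ _] _]] := H x' t Hx' Ht.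
  have := mxderivM D' (mxderivT D); congr (mxderiv _ _ _).
  by rewrite trmx_mul sB mulmxBr mulmxBl mulNmx mulmxN mulmxA.
pose k2 := mm * ((mm * (1 * K)) * 1).
pose k3 := k2 * r + mm * (k1 * 1).
pose C1 := mm * (k3 * 1).
have k10 : 0 <= k1 by rewrite !mulr_ge0.
have k20 : 0 <= k2 by rewrite !mulr_ge0.
have k30 : 0 <= k3 by rewrite addr_ge0 ?mulr_ge0 // ltW.
have C10 : 0 <= C1 by rewrite !mulr_ge0.
have FE x x' t : `|x - x0| < r -> `|t - y0| < r -> F x' t - F x t = (E x x' t - 1%:M) *m F x t.
  by move=> Hx Ht; rewrite mulmxBl mul1mx /E -mulmxA oF // mulmx1.
have E1 x x' t : `|x - x0| < r -> `|x' - x0| < r -> `|t - y0| < r ->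
    bnd (k3 * `|x' - x|) (E x x' t - 1%:M).
  move=> Hx Hx' Ht.
  have b1 : bnd (k2 * `|x' - x| * `|t - y0|) (E x x' t - E x x' y0).
    apply: (@mxmvt _ _ _ (E x x') _ _ _ _ (fun s Hs => dE x x' s Hx Hx' (between_abs y0r Ht Hs).1)) => s Hs.
    have [Hs' _] := between_abs y0r Ht Hs.
    have := bndM (_ : 0 <= mm * (1 * (K * `|x' - x|)))
      (bndM ler01 (bF x' s Hx' Hs') (dB x x' s Hx Hx' Hs')) (bndT (bF x s Hx Hs')).
    rewrite !mulr_ge0 // => /(_ isT) /bndW; apply.
    by rewrite /k2 -/mm; apply: eq_ler; ring.
  have b2 : bnd (mm * (k1 * `|x' - x| * 1)) (E x x' y0 - 1%:M).
    have -> : E x x' y0 - 1%:M = (F x' y0 - F x y0) *m (F x y0)^T.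
      by have [[hort _ _] _] := H x y0 Hx y0r; rewrite mulmxBl hort.
    by apply: bndM; [rewrite mulr_ge0|exact: L0|exact/bndT/bF].
  have -> : E x x' t - 1%:M = (E x x' t - E x x' y0) + (E x x' y0 - 1%:M) by rewrite addrA subrK.
  apply: bndW (bndD b1 b2) _.
  have : k2 * `|x' - x| * `|t - y0| <= k2 * `|x' - x| * r.
    by rewrite ler_wpM2l ?mulr_ge0 // ltW.
  by rewrite /k3; move=> Hle; apply: le_trans (lerD Hle (lexx _)) _; apply: eq_ler; ring.
have F1 x x' t : `|x - x0| < r -> `|x' - x0| < r -> `|t - y0| < r ->
    bnd (C1 * `|x' - x|) (F x' t - F x t).
  move=> Hx Hx' Ht; rewrite FE //; apply: bndW (bndM _ (E1 x x' t Hx Hx' Ht) (bF x t Hx Ht)) _.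
    by rewrite mulr_ge0.
  by rewrite /C1 -/mm; apply: eq_ler; ring.
pose k4 := mm * ((mm * (C1 * K) + mm * (1 * K)) * 1).
pose k5 := mm * (C1 * K) + mm * (1 * K).
pose C2 := mm * ((k4 * r + mm * (k5 * 1)) * 1).
have k50 : 0 <= k5 by rewrite addr_ge0 ?mulr_ge0.
have k40 : 0 <= k4 by rewrite !mulr_ge0 // addr_ge0 ?mulr_ge0.
have C20 : 0 <= C2 by rewrite !mulr_ge0 // addr_ge0 ?mulr_ge0 // ltW.
have F2 x x' t : `|x - x0| < r -> `|x' - x0| < r -> `|t - y0| < r ->
    bnd (C2 * `|x' - x| ^+ 2) (F x' t - F x t - (x' - x) *: (F x t *m A x t)).
  move=> Hx Hx' Ht; set h := x' - x.
  have h0 : 0 <= `|h| by [].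
  pose N s := F x s *m A x s *m (F x s)^T.
  have dN s : `|s - y0| < r -> mxderiv N s (F x s *m Bx x s *m (F x s)^T).
    move=> Hs; have [[_ sA sB] [[D DA _ _ _] [_ _ _ _ fl]]] := H x s Hx Hs.
    have := mxderivM (mxderivM D DA) (mxderivT D); congr (mxderiv _ _ _).
    have -> : Bx x s = Ay x s - (A x s *m B x s - B x s *m A x s).
      by rewrite -[LHS]subr0 -fl; mx_abel.
    rewrite trmx_mul sB !(mulmxBr, mulmxBl, mulmxDl, mulmxDr, mulmxN, mulNmx) !mulmxA.
    by mx_abel.
  pose D s := E x x' s - 1%:M - h *: N s.
  have dD s : `|s - y0| < r -> mxderiv D s
     (((F x' s - F x s) *m (B x' s - B x s) + F x s *m (B x' s - B x s - h *: Bx x s)) *m (F x s)^T).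
    move=> Hs.
    have := mxderivD (mxderivD (dE x x' s Hx Hx' Hs) (mxderiv_cst (- 1%:M) s)) (mxderivZ (- h) (dN s Hs)).
    rewrite addr0; congr mxderiv.
      by apply/funext => u; rewrite /D scaleNr.
    by rewrite !(mulmxBr, mulmxBl, mulmxDl, mulmxN, mulNmx) -!scalemxAr -!scalemxAl; mx_abel.
  have bB2 s : `|s - y0| < r -> bnd (K * `|h| * `|h|) (B x' s - B x s - h *: Bx x s).
    move=> Hs; apply: (@mxmvt_affine _ _ _ (B ^~ s) (Bx ^~ s)) => u Hu;
      have [Hu' Hu''] := between_abs Hx Hx' Hu.
      by have [_ [[_ _ _ DB _] _]] := H u s Hu' Hs.
    by apply: bndW (dBx x u s Hx Hu' Hs) _; rewrite ler_wpM2l.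
  have bG2 : bnd (k5 * `|h| * `|h|) (F x' y0 - F x y0 - h *: (F x y0 *m A x y0)).
    apply: (@mxmvt_affine _ _ _ (F ^~ y0) (fun u => F u y0 *m A u y0)) => u Hu;
      have [Hu' Hu''] := between_abs Hx Hx' Hu; first exact: HG.
    have -> : F u y0 *m A u y0 - F x y0 *m A x y0
       = (F u y0 - F x y0) *m A u y0 + F x y0 *m (A u y0 - A x y0).
      by rewrite mulmxBl mulmxBr addrA subrK.
    have [_ [_ [bA _ _ _ _]]] := H u y0 Hu' y0r.
    apply: bndW (bndD (bndM _ (F1 x u y0 Hx Hu' y0r) bA) (bndM ler01 (bF x y0 Hx y0r) (dA x u y0 Hx Hu' y0r))) _.
      by rewrite mulr_ge0.
    apply: (@le_trans _ _ (k5 * `|u - x|)); last by rewrite ler_wpM2l.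
    by rewrite /k5 -/mm; apply: eq_ler; ring.
  have bD : bnd ((k4 * r + mm * (k5 * 1)) * `|h| ^+ 2) (D t).
    have b1 : bnd (k4 * `|h| ^+ 2 * `|t - y0|) (D t - D y0).
      apply: (@mxmvt _ _ _ D _ _ _ _ (fun s Hs => dD s (between_abs y0r Ht Hs).1)) => s Hs.
      have [Hs' _] := between_abs y0r Ht Hs.
      have P1 := bndM (mulr_ge0 C10 h0) (F1 x x' s Hx Hx' Hs') (dB x x' s Hx Hx' Hs').
      have P2 := bndM ler01 (bF x s Hx Hs') (bB2 s Hs').
      apply: bndW (bndM _ (bndD P1 P2) (bndT (bF x s Hx Hs'))) _.
        by rewrite addr_ge0 ?mulr_ge0.
      by rewrite /k4 -/mm -/h; apply: eq_ler; ring.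
    have b2 : bnd (mm * (k5 * `|h| * `|h| * 1)) (D y0).
      have -> : D y0 = (F x' y0 - F x y0 - h *: (F x y0 *m A x y0)) *m (F x y0)^T.
        have [[hort _ _] _] := H x y0 Hx y0r.
        by rewrite /D /E /N !mulmxBl hort -scalemxAl.
      by apply: bndM (bndT (bF x y0 Hx y0r)) => //; rewrite !mulr_ge0.
    have -> : D t = (D t - D y0) + D y0 by rewrite subrK.
    apply: bndW (bndD b1 b2) _.
    have : k4 * `|h| ^+ 2 * `|t - y0| <= k4 * `|h| ^+ 2 * r.
      by rewrite ler_wpM2l ?mulr_ge0 ?exprn_ge0 // ltW.
    by move=> Hle; apply: le_trans (lerD Hle (lexx _)) _; apply: eq_ler; ring.
  have -> : F x' t - F x t - h *: (F x t *m A x t) = D t *m F x t.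
    rewrite /D mulmxBl -FE // -scalemxAl /N -[_ *m F x t]mulmxA oF // mulmx1 //.
  apply: bndW (bndM _ bD (bF x t Hx Ht)) _.
    by rewrite mulr_ge0 ?exprn_ge0 // addr_ge0 ?mulr_ge0 // ltW.
  by rewrite /C2 -/mm; apply: eq_ler; ring.
exists (C1 + C2); split=> [|x x' t Hx Hx' Ht]; first by rewrite addr_ge0.
split; [apply: bndW (F1 x x' t Hx Hx' Ht) _|apply: bndW (F2 x x' t Hx Hx' Ht) _].
  by rewrite mulrDl lerDl mulr_ge0.
by rewrite mulrDl lerDr mulr_ge0 // exprn_ge0.
Qed.

(** A first order expansion with a quadratic remainder determines the derivative. *)
Lemma is_derive_quadratic (f : R -> R) (x d C r : R) : 0 < r -> 0 <= C ->
  (forall y, `|y - x| < r -> `|f y - f x - (y - x) * d| <= C * `|y - x| ^+ 2) ->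
  is_derive x 1 f d.
Proof.
move=> r0 C0 H; suff L : (fun h : R => h^-1 *: ((f \o shift x) (h *: 1) - f x)) @ 0^' --> d.
  by apply: DeriveDef; [apply/cvg_ex; exists d|exact: cvg_lim L].
apply/cvgrPdist_le => e e0.
have C1 : 0 < C + 1 by rewrite ltr_wpDl.
near=> h.
have h0 : h != 0 by near: h; exact: nbhs_dnbhs_neq.
have hr : `|h| < r by near: h; exact: dnbhs0_lt.
have he : `|h| < e / (C + 1) by near: h; apply: dnbhs0_lt; rewrite divr_gt0.
rewrite /= [_%:A]mulr1.
have := H (h + x); rewrite addrK => /(_ hr) Hh.
rewrite -(ler_pM2l (_ : 0 < `|h|)) ?normr_gt0 // -normrM mulrBr /GRing.scale /= mulrA divff // mul1r.
rewrite distrC; apply: le_trans Hh _.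
rewrite expr2 mulrCA ler_pM2l ?normr_gt0 //.
rewrite ltr_pdivlMr // in he; apply: le_trans (ltW he).
by rewrite mulrC ler_wpM2l // lerDl.
Unshelve. all: by end_near. Qed.

End LocalFrame.

Section Connection.
Context {R : realType}.
Local Notation V := 'rV[R]_2.

Definition pmx {p q} (k : 'I_2) (X : V -> 'M[R]_(p, q)) (z : V) : 'M[R]_(p, q) :=
  \matrix_(i, j) 'D_(delta_mx 0 k) (fun w => X w i j) z.

Definition rCk {p q} k (U : set V) (X : V -> 'M[R]_(p, q)) :=
  forall i j, Ck k U (fun w => X w i j).

(** An orthogonal solution of dF = F (A dx + B dy).  Differentiability is part of
    the definition because the partial derivatives [pmx] alone say little. *)
Definition parallel_frame {m} (A B : V -> 'M[R]_m) (W : set V) (F : V -> 'M[R]_m) :=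
  forall z, W z -> [/\ F z *m (F z)^T = 1%:M,
    forall i j, differentiable (fun w => F w i j) z,
    pmx 0 F z = F z *m A z & pmx 1 F z = F z *m B z].

Lemma rCk_pmx {p q} k U (X : V -> 'M[R]_(p, q)) l : rCk k.+1 U X -> rCk k U (pmx l X).
Proof.
move=> H i j; have [_ D] := CkSP (H i j); have := D l; congr Ck.
by apply/funext => w; rewrite mxE.
Qed.

Lemma mxderiv_x {p q} (X : V -> 'M[R]_(p, q)) x y :
  (forall i j, differentiable (fun w => X w i j) (pt x y)) ->
  mxderiv (fun t => X (pt t y)) x (pmx 0 X (pt x y)).
Proof. by move=> H i j; rewrite mxE; apply: is_derive_pt_x; exact: H. Qed.

Lemma mxderiv_y {p q} (X : V -> 'M[R]_(p, q)) x y :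
  (forall i j, differentiable (fun w => X w i j) (pt x y)) ->
  mxderiv (fun t => X (pt x t)) y (pmx 1 X (pt x y)).
Proof. by move=> H i j; rewrite mxE; apply: is_derive_pt_y; exact: H. Qed.

Lemma local_bnd {p q} (X : V -> 'M[R]_(p, q)) (z : V) :
  (forall i j, {for z, continuous (fun w => X w i j)}) ->
  exists K, 0 <= K /\ \forall w \near z, bnd K (X w).
Proof.
move=> cX; exists (\sum_i \sum_j (`|X z i j| + 1)); split.
  by apply: sumr_ge0 => i _; apply: sumr_ge0 => j _; rewrite addr_ge0.
have : \forall w \near z, forall i, forall j, `|X z i j - X w i j| <= 1.
  suff : \forall w \near z, forall ij : 'I_p * 'I_q, `|X z ij.1 ij.2 - X w ij.1 ij.2| <= 1.
    by apply: filterS => w H i j; exact: (H (i, j)).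
  apply: (@filter_forall _ _ _ (nbhs z) (nbhs_filter z)) => -[i j] /=.
  by have /cvgrPdist_le /(_ 1 ltr01) := cX i j.
apply: filterS => w H i j.
apply: (@le_trans _ _ (`|X z i j| + 1)).
  have := H i j; rewrite -{2}[X w i j](subKr (X z i j)) => Hij.
  by apply: le_trans (ler_normB _ _) _; rewrite lerD2l.
rewrite (bigD1 i) //= (bigD1 j) //= -addrA lerDl addr_ge0 //.
  by apply: sumr_ge0 => l _; rewrite addr_ge0.
by apply: sumr_ge0 => l _; apply: sumr_ge0 => l' _; rewrite addr_ge0.
Qed.

Lemma continuous_pt_comp (f : V -> R) (u v : R -> R) (t : R) :
  {for t, continuous u} -> {for t, continuous v} -> {for pt (u t) (v t), continuous f} ->
  {for t, continuous (fun s => f (pt (u s) (v s)))}.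
Proof.
move=> cu cv cf; apply: (@continuous_comp _ _ _ (fun s => pt (u s) (v s)) f) => //.
apply/cvgrPdist_le => e e0.
have /cvgrPdist_le /(_ _ e0) Hu := cu; have /cvgrPdist_le /(_ _ e0) Hv := cv.
near=> s; rewrite norm2_le !mxE /=; apply/andP; split; near: s; [exact: Hu|exact: Hv].
Unshelve. all: by end_near. Qed.

Lemma continuous_mulmx {p q s} (X : V -> 'M[R]_(p, q)) (Y : V -> 'M[R]_(q, s)) (z : V) i j :
  (forall i j, {for z, continuous (fun w => X w i j)}) ->
  (forall i j, {for z, continuous (fun w => Y w i j)}) ->
  {for z, continuous (fun w => (X w *m Y w) i j)}.
Proof.
move=> cX cY; rewrite (_ : (fun w => _) = (fun w => \sum_l X w i l * Y w l j)).
  by apply: continuous_sum => l; apply: continuousM; [exact: cX|exact: cY].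
by apply/funext => w; rewrite mxE.
Qed.

(** Solve along the horizontal line through p, then along the vertical lines; the
    equation in x comes from [frame_x_estimate], and F is differentiable because
    both partial derivatives are continuous.  Clamping the coordinates lets the one-variable equations be
    defined on the whole line. *)
Lemma local_frame {m} (A B : V -> 'M[R]_m) (L : set V) (p : V) :
  open L -> rCk 2 L A -> rCk 2 L B ->
  (forall z, L z -> (A z)^T = - A z) -> (forall z, L z -> (B z)^T = - B z) ->
  (forall z, L z -> pmx 0 B z - pmx 1 A z + (A z *m B z - B z *m A z) = 0) ->
  L p ->
  exists r F, [/\ 0 < r, ball p r `<=` L, F p = 1%:M & parallel_frame A B (ball p r) F].
Proof.
move=> oL cA cB sA sB fl Lp.
have cA1 := rCk_pmx 0 cA; have cB1 := rCk_pmx 0 cB; have cB2 := rCk_pmx 0 cB1.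
have [K1 [K10 N1]] := @local_bnd _ _ A p (fun i j => CkS_continuous (cA i j) Lp).
have [K2 [K20 N2]] := @local_bnd _ _ B p (fun i j => CkS_continuous (cB i j) Lp).
have [K3 [K30 N3]] := @local_bnd _ _ (pmx 0 A) p (fun i j => CkS_continuous (cA1 i j) Lp).
have [K4 [K40 N4]] := @local_bnd _ _ (pmx 0 B) p (fun i j => CkS_continuous (cB1 i j) Lp).
have [K5 [K50 N5]] := @local_bnd _ _ (pmx 0 (pmx 0 B)) p (fun i j => CkS_continuous (cB2 i j) Lp).
have NL : \forall w \near p, L w by exact: open_nbhs_nbhs.
pose K := 1 + (K1 + K2 + K3 + K4 + K5).
have K0 : 0 < K by rewrite /K; lra.
have /nbhs_ballP[d /= d0 Hd] : \forall w \near p, L w /\ [/\ bnd K (A w), bnd K (B w),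
    bnd K (pmx 0 A w), bnd K (pmx 0 B w) & bnd K (pmx 0 (pmx 0 B) w)].
  near=> w; split; first by near: w.
  split.
  - by apply: (@bndW _ _ _ K1); [near: w|rewrite /K; lra].
  - by apply: (@bndW _ _ _ K2); [near: w|rewrite /K; lra].
  - by apply: (@bndW _ _ _ K3); [near: w|rewrite /K; lra].
  - by apply: (@bndW _ _ _ K4); [near: w|rewrite /K; lra].
  - by apply: (@bndW _ _ _ K5); [near: w|rewrite /K; lra].
clear N1 N2 N3 N4 N5 NL.
pose r := Num.min (d / 2) (2^-1 / (m.+1%:R * K)).
have mK : 0 < m.+1%:R * K by rewrite mulr_gt0 // ltr0n.
have r0 : 0 < r by rewrite lt_min !divr_gt0.
have rd : r < d.
  by apply: (@le_lt_trans _ _ (d / 2)); [rewrite ge_min lexx|rewrite ltr_pdivrMr //; lra].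
have rK : m.+1%:R * K * r <= 2^-1.
  by rewrite mulrC -ler_pdivlMr // ge_min lexx orbT.
pose x0 := p 0 0; pose y0 := p 0 1.
pose cx := clamp (x0 - r) (x0 + r); pose cy := clamp (y0 - r) (y0 + r).
have cxb x : `|cx x - x0| < d.
  have : x0 - r <= cx x <= x0 + r by apply: clamp_in; lra.
  by rewrite ltr_norml; lra.
have cyb y : `|cy y - y0| < d.
  have : y0 - r <= cy y <= y0 + r by apply: clamp_in; lra.
  by rewrite ltr_norml; lra.
have cxE x : `|x - x0| < r -> cx x = x by rewrite ltr_norml => H; apply: clamp_id; lra.
have cyE y : `|y - y0| < r -> cy y = y by rewrite ltr_norml => H; apply: clamp_id; lra.
have inb x y : `|x - x0| < d -> `|y - y0| < d -> ball p d (pt x y).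
  by move=> Hx Hy; apply/ball2P; rewrite pt_x pt_y.
have y0d : `|y0 - y0| < d by rewrite subrr normr0.
have y0r : `|y0 - y0| < r by rewrite subrr normr0.
have x0r : `|x0 - x0| < r by rewrite subrr normr0.
have Lin x y : `|x - x0| < d -> `|y - y0| < d -> L (pt x y) by move=> Hx Hy; have [] := Hd _ (inb x y Hx Hy).
have cc a b : continuous (clamp a b) := @continuous_clamp R a b.
have [G [G0 dG]] : exists X : R -> 'M[R]_m, X x0 = 1%:M /\
    forall t, x0 - r < t < x0 + r -> mxderiv X t (X t *m A (pt (cx t) y0)).
  apply: (@picard R m (fun t => A (pt (cx t) y0)) x0 r K) => // [i j t|t].
    apply: (@continuous_pt_comp (fun w => A w i j) cx (fun=> y0)); [exact: cc|exact: cst_continuous|].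
    exact: CkS_continuous (cA i j) (Lin _ _ (cxb t) y0d).
  by have [_ []] := Hd _ (inb _ _ (cxb t) y0d).
have /choice[Phi HPhi] : forall x, exists X : R -> 'M[R]_m, X y0 = 1%:M /\
    forall t, y0 - r < t < y0 + r -> mxderiv X t (X t *m B (pt (cx x) (cy t))).
  move=> x; apply: (@picard R m (fun t => B (pt (cx x) (cy t))) y0 r K) => // [i j t|t].
    apply: (@continuous_pt_comp (fun w => B w i j) (fun=> cx x) cy); [exact: cst_continuous|exact: cc|].
    exact: CkS_continuous (cB i j) (Lin _ _ (cxb x) (cyb t)).
  by have [_ []] := Hd _ (inb _ _ (cxb x) (cyb t)).
have itv (c t : R) : `|t - c| < r -> c - r < t < c + r by rewrite ltr_norml; lra.
have ltd (u : R) : u < r -> u < d by move=> /lt_trans; apply.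
pose F x t := G x *m Phi x t.
have oG x : `|x - x0| < r -> G x *m (G x)^T = 1%:M.
  apply: (@orth_of_skew _ _ G (fun t => A (pt (cx t) y0)) x0) => // t.
    by move=> /itv; exact: dG.
  exact/sA/Lin.
have oPhi x t : `|t - y0| < r -> Phi x t *m (Phi x t)^T = 1%:M.
  have [P0 dP] := HPhi x.
  apply: (@orth_of_skew _ _ (Phi x) (fun t => B (pt (cx x) (cy t))) y0) => // s.
    by move=> /itv; exact: dP.
  exact/sB/Lin.
have oF x t : `|x - x0| < r -> `|t - y0| < r -> F x t *m (F x t)^T = 1%:M.
  move=> Hx Ht; rewrite /F trmx_mul mulmxA -[_ *m Phi x t *m _]mulmxA oPhi // mulmx1 oG //.
have dFy x t : `|x - x0| < r -> `|t - y0| < r -> mxderiv (F x) t (F x t *m B (pt x t)).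
  move=> Hx Ht; have [_ dP] := HPhi x.
  have := mxderivM (mxderiv_cst (G x) t) (dP t (itv _ _ Ht)).
  by rewrite mul0mx add0r mulmxA cxE // cyE.
have F0 x : F x y0 = G x by rewrite /F (HPhi x).1 mulmx1.
have dF0 x : `|x - x0| < r -> mxderiv (F ^~ y0) x (F x y0 *m A (pt x y0)).
  move=> Hx; have := dG x (itv _ _ Hx); rewrite F0 cxE //; congr mxderiv.
  by apply/funext => u; rewrite F0.
have [|C [C0 HC]] := @frame_x_estimate R m F (fun x t => A (pt x t)) (fun x t => B (pt x t))
   (fun x t => pmx 0 A (pt x t)) (fun x t => pmx 1 A (pt x t))
   (fun x t => pmx 0 B (pt x t)) (fun x t => pmx 0 (pmx 0 B) (pt x t)) x0 y0 r K r0 (ltW K0) _ dF0.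
  move=> x t Hx Ht; have Lxt := Lin x t (ltd _ Hx) (ltd _ Ht).
  have [_ [b1 b2 b3 b4 b5]] := Hd _ (inb x t (ltd _ Hx) (ltd _ Ht)).
  split; first by split; [exact: oF|exact: sA|exact: sB].
  split; last by split => //; exact: fl.
  split; first exact: dFy.
  - by apply: mxderiv_y => i j; exact: Ck_differentiable (cA i j) Lxt.
  - by apply: mxderiv_x => i j; exact: Ck_differentiable (cA i j) Lxt.
  - by apply: mxderiv_x => i j; exact: Ck_differentiable (cB i j) Lxt.
  - by apply: mxderiv_x => i j; exact: Ck_differentiable (cB1 i j) Lxt.
have dFx x t : `|x - x0| < r -> `|t - y0| < r -> mxderiv (F ^~ t) x (F x t *m A (pt x t)).
  move=> Hx Ht i j.
  apply: (@is_derive_quadratic _ _ _ _ C (r - `|x - x0|)) => //; first by rewrite subr_gt0.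
  move=> y Hy; have Hy' : `|y - x0| < r.
    rewrite -(subrK x y) -addrA; apply: le_lt_trans (ler_normD _ _) _.
    by rewrite -ltrBrDr.
  have [_ /(_ i j)] := HC x y t Hx Hy' Ht.
  by rewrite !mxBE [X in _ - _ - X]mxE.
exists r, (fun z => F (z 0 0) (z 0 1)); split=> //.
- by move=> w Hw; have [] := Hd w (le_ball (ltW rd) Hw).
- by rewrite -/x0 -/y0 F0 G0.
move=> z Hz; have /ball2P[Hx Ht] := Hz.
set x := z 0 0 in Hx *; set t := z 0 1 in Ht *.
have Lz : L z by have [] := Hd z (le_ball (ltW rd) Hz).
have cF i j : {for z, continuous (fun w : V => F (w 0 0) (w 0 1) i j)}.
  apply/(@cvgrPdist_le _ _ _ (nbhs z)) => e e0.
  have e20 : 0 < e / 2 by rewrite divr_gt0.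
  have cFt : {for t, continuous (fun s => F x s i j)}.
    apply: differentiable_continuous; apply/derivable1_diffP.
    by have [] := dFy x t Hx Ht i j.
  have c1 : {for z, continuous (fun w : V => F x (w 0 1) i j)}.
    apply: (@continuous_comp _ _ _ (fun w : V => w 0 1) (fun s => F x s i j)) => //.
    exact: coord_continuous.
  have /cvgrPdist_le /(_ _ e20) N1 := c1.
  have C1 : 0 < C + 1 by rewrite ltr_wpDl.
  have e2C : 0 < e / 2 / (C + 1) by rewrite divr_gt0.
  have cx0 : {for z, continuous (fun w : V => w 0 0)} by exact: coord_continuous.
  have /cvgrPdist_lt /(_ _ e2C) N2 := cx0.
  have N3 : \forall w \near z, ball p r w by apply: open_nbhs_nbhs; split=> //; exact: ball_open.
  near=> w.
  have /ball2P[Hw0 Hw1] : ball p r w by near: w.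
  have [/(_ i j) HCw _] := HC x (w 0 0) (w 0 1) Hx Hw0 Hw1; rewrite mxBE in HCw.
  have H1 : `|x - w 0 0| < e / 2 / (C + 1) by near: w.
  have H2 : `|F x t i j - F x (w 0 1) i j| <= e / 2 by near: w.
  rewrite (_ : _ - _ = (F x t i j - F x (w 0 1) i j) - (F (w 0 0) (w 0 1) i j - F x (w 0 1) i j)); last by ring.
  apply: le_trans (ler_normB _ _) _.
  rewrite [leRHS]splitr lerD //; apply: le_trans HCw _.
  rewrite distrC; rewrite ltr_pdivlMr // in H1; apply: le_trans (ltW H1).
  by rewrite mulrC ler_wpM2l // lerDl.
have zpt : z = pt x t by rewrite -ptE.
have HD i j := @C1_differentiable R (fun w : V => F (w 0 0) (w 0 1) i j)
   (fun w => (F (w 0 0) (w 0 1) *m A w) i j) (fun w => (F (w 0 0) (w 0 1) *m B w) i j) z.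
have /nbhs_ballP[r' /= r'0 Hr'] : \forall w \near z, ball p r w.
  by apply: open_nbhs_nbhs; split=> //; exact: ball_open.
have {}HD i j := HD i j r' r'0.
have {}HD i j : [/\ differentiable (fun w : V => F (w 0 0) (w 0 1) i j) z,
   'D_(delta_mx 0 0) (fun w : V => F (w 0 0) (w 0 1) i j) z = (F x t *m A z) i j &
   'D_(delta_mx 0 1) (fun w : V => F (w 0 0) (w 0 1) i j) z = (F x t *m B z) i j].
  apply: HD.
  - move=> w /Hr' /ball2P[Hw0 Hw1].
    have := dFx _ _ Hw0 Hw1 i j; rewrite -ptE; congr is_derive.
    by apply/funext => u; rewrite pt_x pt_y.
  - move=> w /Hr' /ball2P[Hw0 Hw1].
    have := dFy _ _ Hw0 Hw1 i j; rewrite -ptE; congr is_derive.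
    by apply/funext => u; rewrite pt_x pt_y.
  - by apply: continuous_mulmx => // k l; exact: CkS_continuous (cA k l) Lz.
  - by apply: continuous_mulmx => // k l; exact: CkS_continuous (cB k l) Lz.
split.
- exact: oF.
- by move=> i j; have [] := HD i j.
- by apply/matrixP => i j; rewrite mxE; have [_ -> _] := HD i j.
- by apply/matrixP => i j; rewrite mxE; have [_ _ ->] := HD i j.
Unshelve. all: by end_near. Qed.

End Connection.

(** * Monodromy over a simply connected domain *)

Section Cousin.
Context {R : realType}.

(** Compactness of [0, 1] as an induction principle: a property of intervals
    that is additive and holds for all small intervals around each point holds
    for [0, 1]. *)
Lemma cousin (P : R -> R -> Prop) :
  (forall a b c, a <= b -> b <= c -> P a b -> P b c -> P a c) ->
  (forall x, 0 <= x <= 1 -> exists2 e, 0 < e &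
     forall a b, x - e < a -> a <= x -> x <= b -> b < x + e -> P a b) ->
  P 0 1.
Proof.
move=> add loc; pose S := [set x : R | 0 <= x <= 1 /\ P 0 x].
have S0 : S 0.
  split; first by rewrite lexx ler01.
  have [|e e0 He] := loc 0; first by rewrite lexx ler01.
  by apply: He => //; lra.
have S1 : ubound S 1 by move=> x [/andP[]].
have hS : has_sup S by split; [exists 0|exists 1].
pose s := sup S.
have s0 : 0 <= s by apply: ub_le_sup => //; exact: hS.2.
have s1 : s <= 1 by apply: ge_sup; first exact: hS.1.
have [|e e0 He] := loc s; first by rewrite s0 s1.
have [x [/andP[x0 x1] Px] xs] := sup_adherent e0 hS; rewrite -/s in xs.
have xs' : x <= s by apply: ub_le_sup; [exact: hS.2|split=> //; apply/andP].
pose y := Num.min 1 (s + e / 2).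
have e20 : 0 < e / 2 by rewrite divr_gt0.
have sy : s <= y by rewrite le_min s1; lra.
have ye : y < s + e by rewrite gt_min; apply/orP; right; lra.
have Py : P 0 y.
  apply: (add _ x) => //; first exact: le_trans sy.
  exact: He.
have y1 : y <= 1 by rewrite ge_min lexx.
have : y <= s by apply: ub_le_sup; [exact: hS.2|split=> //; rewrite y1 (le_trans s0)].
rewrite ge_min => /orP[H|]; last by lra.
by have -> : 1 = y; first by apply: le_anti; rewrite y1 (le_trans H).
Qed.

End Cousin.

Section Globalization.
Context {R : realType} {m : nat}.
Local Notation V := 'rV[R]_2.
Variables (A B : V -> 'M[R]_m) (L : set V).
Hypotheses (sA : forall z, L z -> (A z)^T = - A z) (sB : forall z, L z -> (B z)^T = - B z).
Local Notation frame := (parallel_frame A B).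
Hypothesis local : forall p, L p -> exists r F,
  [/\ 0 < r, ball p r `<=` L, F p = 1%:M & frame (ball p r) F].

Lemma parallel_frame_subset (W W' : set V) F : W' `<=` W -> frame W F -> frame W' F.
Proof. by move=> WW H z /WW; exact: H. Qed.

Lemma parallel_frame_scale (W : set V) F (c : 'M[R]_m) : c *m c^T = 1%:M ->
  frame W F -> frame W (fun z => c *m F z).
Proof.
move=> oc H z Wz; have [ho d1 p0 p1] := H z Wz.
have D v i j : 'D_v (fun w => (c *m F w) i j) z = \sum_l c i l * 'D_v (fun w => F w l j) z
    /\ differentiable (fun w => (c *m F w) i j) z.
  have E : (fun w => (c *m F w) i j) = \sum_(l < m) (c i l *: (fun w => F w l j)).
    by apply/funext => w; rewrite mxE fct_sumE.
  have dl l : differentiable (c i l *: (fun w => F w l j)) z by apply: differentiableZ; exact: d1.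
  split; last by rewrite E; exact: differentiable_sum.
  rewrite E derive_sum => [|l]; last exact: diff_derivable.
  by apply: eq_bigr => l _; rewrite deriveZ //; apply: diff_derivable; exact: d1.
have pE k : pmx k (fun w => c *m F w) z = c *m pmx k F z.
  apply/matrixP => i j; rewrite mxE (D _ i j).1 mxE; apply: eq_bigr => l _.
  by rewrite mxE.
split.
- by rewrite trmx_mul mulmxA -[_ *m F z *m _]mulmxA ho mulmx1.
- by move=> i j; have [_] := D 0 i j.
- by rewrite pE p0 mulmxA.
- by rewrite pE p1 mulmxA.
Qed.

(** Two parallel frames differ by a constant factor on the left, the derivative
    of F1 F2^T being zero for skew A and B. *)
Lemma parallel_frame_unique (p : V) (r : R) F1 F2 : ball p r `<=` L ->
  frame (ball p r) F1 -> frame (ball p r) F2 ->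
  forall z w, ball p r z -> ball p r w -> F1 z *m (F2 z)^T = F1 w *m (F2 w)^T.
Proof.
move=> bL H1 H2 z w Hz Hw; apply/matrixP => i j.
have E : (fun u => (F1 u *m (F2 u)^T) i j)
    = \sum_(l < m) ((fun u => F1 u i l) * (fun u => F2 u j l)).
  by apply/funext => u; rewrite mxE fct_sumE; apply: eq_bigr => l _; rewrite mxE.
apply: (@zero_derivative_ball R 2 p r (fun u => (F1 u *m (F2 u)^T) i j)) => // u.
  move=> Hu; have [_ d1 _ _] := H1 u Hu; have [_ d2 _ _] := H2 u Hu.
  by rewrite E; apply: differentiable_sum => l; apply: differentiableM.
move=> v Hu; have [_ d1 p10 p11] := H1 u Hu; have [_ d2 p20 p21] := H2 u Hu.
have dE k : 'D_(delta_mx 0 k) (fun u => (F1 u *m (F2 u)^T) i j) u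
    = (F1 u *m (pmx k F2 u)^T + pmx k F1 u *m (F2 u)^T) i j.
  rewrite E derive_sum => [|l]; last by apply: diff_derivable; apply: differentiableM.
  rewrite !mxE -big_split; apply: eq_bigr => l _ /=.
  rewrite deriveM; [|exact: diff_derivable..].
  by rewrite !mxE /GRing.scale /= [F2 u j l * _]mulrC.
have d : differentiable (fun u => (F1 u *m (F2 u)^T) i j) u.
  by rewrite E; apply: differentiable_sum => l; apply: differentiableM.
have -> : v = v 0 0 *: delta_mx 0 0 + v 0 1 *: delta_mx 0 1.
  by apply: row2P; rewrite !mxE /= ?mulr1 ?mulr0 ?addr0 ?add0r.
rewrite derive_lin // !dE p10 p11 p20 p21 !trmx_mul sA ?sB; [|exact: bL..].
by rewrite !mulNmx !mulmxN !mulmxA !addNr !mxE !mulr0 addr0.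
Qed.

(** The parallel transport along a map h that is merely continuous: no
    differential equation can be imposed on G, so G is required to be, around
    each point, the pullback of a parallel frame of a disc. *)
Definition frame_along {X : topologicalType} (h : X -> V) (Q : set X) (G : X -> 'M[R]_m) :=
  forall x, Q x -> exists r F, [/\ 0 < r, ball (h x) r `<=` L, frame (ball (h x) r) F &
    \forall y \near x, Q y -> G y = F (h y)].

Section AlongAMap.
Context {X : topologicalType}.
Implicit Types (h : X -> V) (Q : set X) (G : X -> 'M[R]_m).

Lemma frame_along_subset h Q Q' G : Q' `<=` Q -> frame_along h Q G -> frame_along h Q' G.
Proof.
move=> QQ H x /QQ /H [r [F [r0 bL HF N]]]; exists r, F; split=> //.
by apply: filterS N => y Hy /QQ; exact: Hy.
Qed.

Lemma frame_along_ext h h' Q G : (forall x, Q x -> h x = h' x) -> frame_along h Q G -> frame_along h' Q G.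
Proof.
move=> hh H x Qx; have [r [F [r0 bL HF N]]] := H x Qx; exists r, F; rewrite -hh //.
by split=> //; apply: filterS N => y Hy Qy; rewrite -hh //; exact: Hy.
Qed.

Lemma frame_along_scale h Q G (c : 'M[R]_m) : c *m c^T = 1%:M ->
  frame_along h Q G -> frame_along h Q (fun x => c *m G x).
Proof.
move=> oc H x /H [r [F [r0 bL HF N]]]; exists r, (fun z => c *m F z); split=> //.
  exact: parallel_frame_scale.
by apply: filterS N => y Hy Qy; rewrite Hy.
Qed.

Lemma frame_along_orth h Q G x : frame_along h Q G -> Q x -> G x *m (G x)^T = 1%:M.
Proof.
move=> H Qx; have [r [F [r0 bL HF N]]] := H x Qx.
have -> : G x = F (h x) by exact: (nbhs_singleton N).
by have [] := HF (h x) (ballxx _ r0).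
Qed.

(** The quotient G1 G2^T is locally constant by [parallel_frame_unique]. *)
Lemma frame_along_unique h Q G1 G2 : continuous h -> connected Q -> frame_along h Q G1 -> frame_along h Q G2 ->
  forall x y, Q x -> Q y -> G1 x *m (G2 x)^T = G1 y *m (G2 y)^T.
Proof.
move=> ch cQ H1 H2.
apply: (connected_locally_const (f := fun x => G1 x *m (G2 x)^T)) => // x Qx.
have [r1 [F1 [r10 bL1 HF1 N1]]] := H1 x Qx; have [r2 [F2 [r20 bL2 HF2 N2]]] := H2 x Qx.
pose r := Num.min r1 r2; have r0 : 0 < r by rewrite lt_min r10.
have rr1 : r <= r1 by rewrite ge_min lexx.
have rr2 : r <= r2 by rewrite ge_min lexx orbT.
have Nr : \forall y \near x, ball (h x) r (h y).
  by have /cvg_ballP/(_ r r0) := ch x; apply.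
have E1 : G1 x = F1 (h x) by exact: (nbhs_singleton N1).
have E2 : G2 x = F2 (h x) by exact: (nbhs_singleton N2).
near=> y => Qy.
have -> : G1 y = F1 (h y) by move: Qy; near: y.
have -> : G2 y = F2 (h y) by move: Qy; near: y.
rewrite E1 E2; apply: (@parallel_frame_unique (h x) r F1 F2).
- by move=> w /(le_ball rr1); exact: bL1.
- by apply: parallel_frame_subset HF1; exact: le_ball.
- by apply: parallel_frame_subset HF2; exact: le_ball.
- by near: y.
- exact: ballxx.
Unshelve. all: by end_near. Qed.

Lemma frame_along_const h Q G (p : V) : connected Q -> (forall x, Q x -> h x = p) -> frame_along h Q G ->
  forall x y, Q x -> Q y -> G x = G y.
Proof.
move=> cQ hp H; apply: connected_locally_const => // x Qx.
have [r [F [r0 bL HF N]]] := H x Qx.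
have E : G x = F (h x) by exact: (nbhs_singleton N).
by apply: filterS N => y Hy Qy; rewrite Hy // E !hp.
Qed.

Lemma frame_along_of_frame h Q F (p : V) (r : R) : ball p r `<=` L -> frame (ball p r) F ->
  (forall x, Q x -> ball p r (h x)) -> frame_along h Q (fun x => F (h x)).
Proof.
move=> bL HF Qb x Qx; have bx := Qb x Qx.
have /nbhs_ballP[d /= d0 Hd] : nbhs (h x) (ball p r).
  by apply: open_nbhs_nbhs; split=> //; exact: ball_open.
exists d, F; split=> //.
- by move=> w /Hd; exact: bL.
- exact: parallel_frame_subset HF.
- exact: nearW.
Qed.

(** The two frames differ on the connected intersection by one constant factor,
    which is absorbed in the second; closedness makes a point outside of Q1 or
    Q2 have a neighbourhood that avoids that set. *)
Lemma frame_along_glue h Q1 Q2 : continuous h -> closed Q1 -> closed Q2 -> connected (Q1 `&` Q2) ->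
  (exists G, frame_along h Q1 G) -> (exists G, frame_along h Q2 G) -> exists G, frame_along h (Q1 `|` Q2) G.
Proof.
move=> ch cl1 cl2 cn [G1 H1] [G2' H2'].
have [G2 H2 agree] : exists2 G2, frame_along h Q2 G2 & forall x, Q1 x -> Q2 x -> G1 x = G2 x.
  have [[x0 [Qx1 Qx2]]|ne] := pselect (exists x, Q1 x /\ Q2 x); last first.
    by exists G2' => // x q1 q2; case: ne; exists x.
  have o1 := frame_along_orth H1 Qx1; have o2 := frame_along_orth H2' Qx2.
  set c := G1 x0 *m (G2' x0)^T.
  have oc : c *m c^T = 1%:M.
    rewrite /c trmx_mul trmxK mulmxA -[_ *m _ *m G2' x0]mulmxA.
    by rewrite (mulmx1C o2) mulmx1.
  exists (fun x => c *m G2' x); first exact: frame_along_scale.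
  move=> x q1 q2.
  have := @frame_along_unique h (Q1 `&` Q2) G1 G2' ch cn (frame_along_subset (@subIsetl _ _ _) H1)
     (frame_along_subset (@subIsetr _ _ _) H2') x x0 (conj q1 q2) (conj Qx1 Qx2).
  rewrite -/c => <-; have ox := frame_along_orth H2' q2.
  by rewrite -mulmxA (mulmx1C ox) mulmx1.
pose G x := if `[< Q1 x >] then G1 x else G2 x.
have GE1 x : Q1 x -> G x = G1 x by move=> q; rewrite /G; case: asboolP.
have GE2 x : Q2 x -> G x = G2 x.
  by move=> q; rewrite /G; case: asboolP => // q1; exact: agree.
exists G => x Qx.
have far (Q : set X) : closed Q -> ~ Q x -> \forall y \near x, ~ Q y.
  by move=> cQ nQ; apply: open_nbhs_nbhs; split=> //; exact: closed_openC.
have [q1|nq1] := pselect (Q1 x); last first.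
  have q2 : Q2 x by case: Qx.
  have [r [F [r0 bL HF N]]] := H2 x q2; exists r, F; split=> //.
  near=> y; have n1 : ~ Q1 y by near: y; exact: far.
  by case=> // q; rewrite GE2 //; move: q; near: y.
have [q2|nq2] := pselect (Q2 x); last first.
  have [r [F [r0 bL HF N]]] := H1 x q1; exists r, F; split=> //.
  near=> y; have n1 : ~ Q2 y by near: y; exact: far.
  by case=> // q; rewrite GE1 //; move: q; near: y.
have [r1 [F1 [r10 bL1 HF1 N1]]] := H1 x q1; have [r2 [F2 [r20 bL2 HF2 N2]]] := H2 x q2.
pose r := Num.min r1 r2; have r0 : 0 < r by rewrite lt_min r10.
have rr1 : r <= r1 by rewrite ge_min lexx.
have rr2 : r <= r2 by rewrite ge_min lexx orbT.
have Nr : \forall y \near x, ball (h x) r (h y).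
  by have /cvg_ballP/(_ r r0) := ch x; apply.
have E1 : G1 x = F1 (h x) by exact: (nbhs_singleton N1).
have E2 : G2 x = F2 (h x) by exact: (nbhs_singleton N2).
have F12 w : ball (h x) r w -> F1 w = F2 w.
  move=> Hw; have bL : ball (h x) r `<=` L by move=> u /(le_ball rr1); exact: bL1.
  have HF1' : frame (ball (h x) r) F1 by apply: parallel_frame_subset HF1; exact: le_ball.
  have HF2' : frame (ball (h x) r) F2 by apply: parallel_frame_subset HF2; exact: le_ball.
  have := parallel_frame_unique bL HF1' HF2' Hw (ballxx _ r0).
  rewrite -E1 -E2 agree // (frame_along_orth H2 q2) => K.
  have [ow _ _ _] := HF2' w Hw.
  by rewrite -[F1 w]mulmx1 -(mulmx1C ow) mulmxA K mul1mx.
exists r1, F1; split=> //; near=> y.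
have By : ball (h x) r (h y) by near: y.
case=> q; first by rewrite GE1 //; move: q; near: y.
by rewrite GE2 // F12 //; move: q; near: y.
Unshelve. all: by end_near. Qed.

Lemma frame_along_small h x : continuous h -> L (h x) ->
  exists2 N, nbhs x N & forall Q, Q `<=` N -> exists G, frame_along h Q G.
Proof.
move=> ch Lx; have [r [F [r0 bL _ HF]]] := local Lx.
exists [set y | ball (h x) r (h y)]; first by have /cvg_ballP/(_ r r0) := ch x; apply.
by move=> Q QN; exists (fun y => F (h y)); exact: frame_along_of_frame bL HF _.
Qed.

End AlongAMap.

Lemma frame_along_comp {X Y : topologicalType} (u : Y -> X) (h : X -> V) Q Q' G :
  continuous u -> (forall y, Q' y -> Q (u y)) -> frame_along h Q G ->
  frame_along (h \o u) Q' (G \o u).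
Proof.
move=> cu QQ H y /QQ /H [r [F [r0 bL HF N]]]; exists r, F; split=> //.
have K : \forall z \near y, Q (u z) -> G (u z) = F (h (u z)) := cu y _ N.
by apply: filterS K => z Hz /QQ; exact: Hz.
Qed.

Lemma continuous_within_comp {X Y Z : topologicalType} (Q : set Y) (g : Y -> Z) (u : X -> Y) :
  {within Q, continuous g} -> continuous u -> (forall x, Q (u x)) -> continuous (g \o u).
Proof.
move=> cg cu Qu x W HW.
have K : within Q (nbhs (u x)) (g @^-1` W) := (subspace_continuousP Q g).1 cg (u x) (Qu x) W HW.
have K' : \forall z \near x, Q (u z) -> W (g (u z)) := cu x _ K.
by apply: filterS K' => z; exact.
Qed.

Lemma continuous_pair {T X Y : topologicalType} (u : T -> X) (v : T -> Y) :
  continuous u -> continuous v -> continuous (fun t => (u t, v t)).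
Proof. by move=> cu cv t; exact: (cvg_pair (cu t) (cv t)). Qed.

Definition unit_itv : set R := [set t | 0 <= t <= 1].

Lemma connected_unit_itv : connected unit_itv.
Proof.
have -> : unit_itv = `[0, 1]%classic by apply/seteqP; split=> t /=; rewrite in_itv.
exact: segment_connected.
Qed.

(** The case of a path, by Cousin's lemma: small intervals are mapped into discs
    that carry a frame, and adjacent intervals meet in a point. *)
Lemma frame_along_segment (h : R -> V) : continuous h -> (forall t, L (h t)) ->
  exists G, frame_along h unit_itv G.
Proof.
move=> ch hL; pose I (a b : R) : set R := [set t | a <= t <= b].
have clI a b : closed (I a b).
  have -> : I a b = `[a, b]%classic by apply/seteqP; split=> t /=; rewrite in_itv.
  exact: interval_closed.
apply: (@cousin R (fun a b => exists G, frame_along h (I a b) G)) => [a b c ab bc H1 H2|x Hx].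
  have -> : I a c = I a b `|` I b c.
    apply/seteqP; split=> t /=; last by rewrite /I /=; case=> /andP[H3 H4]; apply/andP; split;
      [|exact: le_trans bc| exact: le_trans H3|].
    rewrite /I /= => /andP[H3 H4]; have [tb|/ltW tb] := leP t b; [left|right]; exact/andP.
  apply: frame_along_glue => //.
  have -> : I a b `&` I b c = [set b].
    apply/seteqP; split=> t /=.
      by rewrite /I /= => -[/andP[_ H3] /andP[H4 _]]; apply: le_anti; rewrite H3.
    by move=> ->; rewrite /I /= !lexx ab bc.
  exact: connected1.
have [N /nbhs_ballP[e /= e0 He] HN] := @frame_along_small R h x ch (hL x).
exists e => // a b H1 H2 H3 H4; apply: HN => t; rewrite /I /= => Ht; apply: He.
by rewrite -ball_normE /= ltr_norml; lra.
Qed.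

(** Cousin's lemma in each variable: rectangles are glued along a common edge,
    vertically into thin strips and then strips into the square. *)
Lemma frame_along_square (h : R * R -> V) : continuous h -> (forall t, L (h t)) ->
  exists G, frame_along h [set q | 0 <= q.1 <= 1 /\ 0 <= q.2 <= 1] G.
Proof.
move=> ch hL; pose I (a b c d : R) : set (R * R) := [set q | a <= q.1 <= b /\ c <= q.2 <= d].
have cfst : continuous (fst : R * R -> R) by move=> q; exact: cvg_fst.
have csnd : continuous (snd : R * R -> R) by move=> q; exact: cvg_snd.
have clI a b c d : closed (I a b c d).
  have -> : I a b c d = (fst @^-1` `[a, b]%classic) `&` (snd @^-1` `[c, d]%classic).
    by apply/seteqP; split=> t /=; rewrite !in_itv.
  apply: closedI; apply: preimage_closed; try exact: interval_closed.
    by move=> q _; exact: cfst.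
  by move=> q _; exact: csnd.
have cpair (u v : R -> R) : continuous u -> continuous v -> continuous (fun t => (u t, v t)).
  exact: continuous_pair.
have connI (u v : R -> R) (a b : R) : continuous u -> continuous v ->
    connected ((fun t => (u t, v t)) @` `[a, b]%classic).
  move=> cu cv; apply: connected_continuous_connected; first exact: segment_connected.
  by apply: continuous_subspaceT; exact: cpair.
have cid_ : continuous (fun t : R => t) by move=> t; exact: cvg_id.
have ccst (b : R) : continuous (fun _ : R => b) by move=> t; exact: cvg_cst.
pose P a b c d := exists G, frame_along h (I a b c d) G.
apply: (@cousin R (fun a b => P a b 0 1)) => [a b c ab bc H1 H2|x Hx].
  rewrite /P; have -> : I a c 0 1 = I a b 0 1 `|` I b c 0 1.
    apply/seteqP; split=> t /=; last first.
      by rewrite /I /=; case=> -[/andP[H3 H4] ->]; split=> //; apply/andP; split=> //;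
      [exact: le_trans bc|exact: le_trans H3].
    rewrite /I /= => -[/andP[H3 H4] ->]; have [tb|/ltW tb] := leP t.1 b; [left|right]; split=> //; exact/andP.
  apply: frame_along_glue => //.
  have -> : I a b 0 1 `&` I b c 0 1 = (fun t => (b, t)) @` `[0, 1]%classic.
    apply/seteqP; split=> [[s t] /=|_ /= [t + <-]].
      rewrite /I /= => -[[/andP[_ H3] Ht] [/andP[H4 _] _]]; exists t; first by rewrite in_itv.
      by congr pair; apply: le_anti; rewrite H3 H4.
    by rewrite /I /= in_itv /= => ->; rewrite !lexx ab bc.
  exact: connI.
pose Q c d := exists2 e, 0 < e & forall a b, x - e < a -> a <= x -> x <= b -> b < x + e -> P a b c d.
suff : Q 0 1 by [].
apply: (@cousin R Q) => [c d f cd df [e1 e10 H1] [e2 e20 H2]|y Hy].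
  exists (Num.min e1 e2) => [|a b K1 K2 K3 K4]; first by rewrite lt_min e10.
  have ee1 : Num.min e1 e2 <= e1 by rewrite ge_min lexx.
  have ee2 : Num.min e1 e2 <= e2 by rewrite ge_min lexx orbT.
  have {}H1 : P a b c d by apply: H1 => //; lra.
  have {}H2 : P a b d f by apply: H2 => //; lra.
  have ab := le_trans K2 K3.
  rewrite /P; have -> : I a b c f = I a b c d `|` I a b d f.
    apply/seteqP; split=> t /=; last first.
      by rewrite /I /=; case=> -[-> /andP[H3 H4]]; split=> //; apply/andP; split=> //;
      [exact: le_trans df|exact: le_trans H3].
    rewrite /I /= => -[-> /andP[H3 H4]]; have [tb|/ltW tb] := leP t.2 d; [left|right]; split=> //; exact/andP.
  apply: frame_along_glue => //.
  have -> : I a b c d `&` I a b d f = (fun t => (t, d)) @` `[a, b]%classic.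
    apply/seteqP; split=> [[s t] /=|_ /= [t + <-]].
      rewrite /I /= => -[[Hs /andP[_ H3]] [_ /andP[H4 _]]]; exists s; first by rewrite in_itv.
      by congr pair; apply: le_anti; rewrite H3 H4.
    by rewrite /I /= in_itv /= => ->; rewrite !lexx cd df.
  exact: connI.
have [N /nbhs_ballP[e /= e0 He] HN] := @frame_along_small (R * R)%type h (x, y) ch (hL _).
exists e => // c d K1 K2 K3 K4; exists e => // a b H1 H2 H3 H4; apply: HN => -[s t]; rewrite /I /= => -[Hs Ht]; apply: He.
by split=> /=; rewrite -ball_normE /= ltr_norml; lra.
Qed.

Hypothesis scL : simply_connected R L.

Let cl (t : R) : R := clamp 0 1 t.
Let clI t : 0 <= cl t <= 1. Proof. exact: clamp_in ler01. Qed.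
Let cl_id t : 0 <= t <= 1 -> cl t = t. Proof. exact: clamp_id. Qed.
Let ccl : continuous cl. Proof. exact: continuous_clamp. Qed.

(** Pull the connection back to the square by a contraction of the loop.  The
    frame so obtained is constant on the three sides that are mapped to the base
    point, hence takes the same value at both ends of the fourth side, which is
    the loop. *)
Lemma trivial_monodromy (g : R -> V) G : continuous g -> (forall t, L (g t)) -> g 0 = g 1 ->
  frame_along g unit_itv G -> G 0 = G 1.
Proof.
move=> cg gL g01 HG.
have [_ /(_ g _ g01) [|H [cH HL H0 H1 Hs]]] := scL.
  split; first exact: continuous_subspaceT.
  by move=> _ [t _ <-].
pose h (q : R * R) := H (cl q.1, cl q.2).
pose u (q : R * R) := (cl q.1, cl q.2).
have cu : continuous u.
  apply: continuous_pair => q.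
    by apply: (@continuous_comp _ _ _ fst cl); [exact: cvg_fst|exact: ccl].
  by apply: (@continuous_comp _ _ _ snd cl); [exact: cvg_snd|exact: ccl].
have uS q : (`[0, 1]%classic `*` `[0, 1]%classic) (u q) by split=> /=; rewrite in_itv /= clI.
have ch : continuous h by exact: (continuous_within_comp cH cu uS).
have hL q : L (h q) by apply: HL; exists (u q).
have [K HK] := frame_along_square ch hL.
have unit0 : unit_itv 0 by rewrite /unit_itv /= lexx ler01.
have unit1 : unit_itv 1 by rewrite /unit_itv /= lexx ler01.
have cpair (v w : R -> R) : continuous v -> continuous w -> continuous (fun t => (v t, w t)).
  exact: continuous_pair.
have cid_ : continuous (fun t : R => t) by move=> t; exact: cvg_id.
have ccst (b : R) : continuous (fun _ : R => b) by move=> t; exact: cvg_cst.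
have edge (v w : R -> R) : continuous v -> continuous w ->
    (forall t, unit_itv t -> 0 <= v t <= 1 /\ 0 <= w t <= 1) ->
    frame_along (fun t => h (v t, w t)) unit_itv (fun t => K (v t, w t)).
  move=> cv cw vw.
  exact: (@frame_along_comp _ _ (fun t => (v t, w t)) h _ unit_itv K (cpair _ _ cv cw) vw HK).
have cu1 := connected_unit_itv.
have i0 : 0 <= (0 : R) <= 1 by rewrite lexx ler01.
have i1 : 0 <= (1 : R) <= 1 by rewrite lexx ler01.
have E1 : K (0, 0) = K (1, 0).
  apply: (frame_along_const (p := g 0) cu1 _ (edge id (fun=> 0) cid_ (ccst 0) _)) => // t Ht.
  by rewrite /h /= !cl_id //; have [-> _] := Hs t ltac:(by rewrite in_itv).
have E2 : K (1, 0) = K (1, 1).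
  apply: (frame_along_const (p := g 0) cu1 _ (edge (fun=> 1) id (ccst 1) cid_ _)) => // t Ht.
  by rewrite /h /= !cl_id //; rewrite H1 ?in_itv.
have E3 : K (0, 1) = K (1, 1).
  apply: (frame_along_const (p := g 0) cu1 _ (edge id (fun=> 1) cid_ (ccst 1) _)) => // t Ht.
  by rewrite /h /= !cl_id //; have [_ ->] := Hs t ltac:(by rewrite in_itv).
have HK0 : frame_along g unit_itv (fun t => K (0, t)).
  apply: (frame_along_ext _ (edge (fun=> 0) id (ccst 0) cid_ _)) => // t Ht.
  by rewrite /h /= !cl_id // H0 ?in_itv.
have := frame_along_unique cg cu1 HG HK0 unit0 unit1.
rewrite E1 E2 -E3 => E.
have oK := frame_along_orth HK0 unit1.
by rewrite -[G 0]mulmx1 -[G 1]mulmx1 -(mulmx1C oK) !mulmxA E.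
Qed.

(** The value c at x of the frame that is transported from the identity at x0
    along some path. *)
Definition transport (x0 x : V) (c : 'M[R]_m) := exists (g : R -> V) (G : R -> 'M[R]_m),
  [/\ continuous g, forall t, L (g t), g 0 = x0 & g 1 = x] /\
  [/\ frame_along g unit_itv G, G 0 = 1%:M & G 1 = c].

Let unit0 : unit_itv 0. Proof. by rewrite /unit_itv /= lexx ler01. Qed.
Let unit1 : unit_itv 1. Proof. by rewrite /unit_itv /= lexx ler01. Qed.

Lemma frame_along_normalized (h : R -> V) : continuous h -> (forall t, L (h t)) ->
  exists2 G, frame_along h unit_itv G & G 0 = 1%:M.
Proof.
move=> ch hL; have [G HG] := frame_along_segment ch hL.
have o0 := frame_along_orth HG unit0.
exists (fun t => (G 0)^T *m G t); last exact: mulmx1C.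
by apply: frame_along_scale HG; rewrite trmxK; exact: mulmx1C.
Qed.

Lemma transport_exists x0 x : L x0 -> L x -> exists c, transport x0 x c.
Proof.
move=> L0 Lx; have [/(_ x0 x L0 Lx) [g [[cg gL] g0 g1]] _] := scL.
have ch : continuous (g \o cl).
  apply: continuous_within_comp cg ccl _ => t /=; by rewrite in_itv /= clI.
have hL t : L ((g \o cl) t) by apply: gL; exists (cl t) => //=; rewrite in_itv /= clI.
have [G HG G0] := frame_along_normalized ch hL.
exists (G 1), (g \o cl), G; split=> //.
by split=> //=; rewrite cl_id // ?lexx ler01.
Qed.

(** The value does not depend on the path, and it varies like a local parallel
    frame: go to x along the first path, then straight to y inside the disc, and
    back along the second path.  This loop has trivial monodromy. *)
Lemma transport_step x0 x y c c' (r : R) F : L x0 -> transport x0 x c -> transport x0 y c' ->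
  ball x r `<=` L -> frame (ball x r) F -> F x = 1%:M -> 0 < r -> ball x r y -> c' = c *m F y.
Proof.
move=> L0 [gx [Gx [[cgx gxL gx0 gx1] [HGx Gx0 Gx1]]]] [gy [Gy [[cgy gyL gy0 gy1] [HGy Gy0 Gy1]]]].
move=> bL HF Fx r0 Hy.
(* The three pieces of the loop are added instead of being defined by cases:
   outside its third of [0, 1] each summand is constant, so continuity is
   immediate. *)
pose g t := gx (cl (3 * t)) + cl (3 * t - 1) *: (y - x) + (gy (cl (- 3 * t + 3)) - y).
have clL t : t <= 0 -> cl t = 0.
  by move=> t0; rewrite /cl /clamp (min_idPr _) ?(max_idPl _) //; lra.
have clR t : 1 <= t -> cl t = 1.
  by move=> t0; rewrite /cl /clamp (min_idPl _) ?(max_idPr _) //; lra.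
have ca (a b : R) : continuous (fun t : R => a * t + b).
  move=> t; apply: (@continuousD _ _ _ (fun t => a * t)); last exact: cst_continuous.
  by apply: continuousM; [exact: cst_continuous|exact: cvg_id].
have ccla (a b : R) : continuous (fun t : R => cl (a * t + b)).
  by move=> t; apply: (@continuous_comp _ _ _ (fun t => a * t + b) cl); [exact: ca|exact: ccl].
have cg : continuous g.
  have ccomp (f : R -> R) (p : R -> V) : continuous f -> continuous p ->
      continuous (fun t : R => p (f t)).
    by move=> cf cp t; exact: (@continuous_comp _ _ _ f p t (cf t) (cp (f t))).
  have c1 : continuous (fun t : R => gx (cl (3 * t))).
    apply: (ccomp (fun t : R => cl (3 * t)) gx) => // t.
    by have := ccla 3 0 t; congr continuous_at; apply/funext => s; rewrite addr0.
  have c2 : continuous (fun t : R => cl (3 * t - 1) *: (y - x)).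
    by move=> t; apply: (@continuousZl _ _ _ (fun t : R => cl (3 * t - 1))); exact: ccla.
  have c3 : continuous (fun t : R => gy (cl (- 3 * t + 3))).
    by apply: (ccomp (fun t : R => cl (- 3 * t + 3)) gy).
  move=> t; apply: (@continuousD _ _ _ (fun t : R => gx (cl (3 * t)) + cl (3 * t - 1) *: (y - x))).
    by apply: (@continuousD _ _ _ (fun t : R => gx (cl (3 * t)))); [exact: c1|exact: c2].
  apply: (@continuousB _ _ _ (fun t : R => gy (cl (- 3 * t + 3)))); first exact: c3.
  exact: cst_continuous.
have gA t : t <= 3^-1 -> g t = gx (cl (3 * t)).
  move=> Ht; rewrite /g (clL (3 * t - _)) ?(clR (- 3 * t + 3)); [|lra..].
  by rewrite scale0r addr0 gy1 subrr addr0.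
have gB t : 3^-1 <= t <= 2 / 3 -> g t = x + (3 * t - 1) *: (y - x).
  move=> Ht; rewrite /g (clR (3 * t)) ?(clR (- 3 * t + 3)) ?cl_id; [|lra..].
  by rewrite gx1 gy1 subrr addr0.
have gC t : 2 / 3 <= t -> g t = gy (cl (- 3 * t + 3)).
  move=> Ht; rewrite /g (clR (3 * t)) ?(clR (3 * t - 1)); [|lra..].
  by rewrite gx1 scale1r [x + _]addrC subrK addrC subrK.
have gL t : L (g t).
  have [t1|/ltW t1] := leP t 3^-1; first by rewrite gA.
  have [t2|/ltW t2] := leP t (2 / 3); last by rewrite gC.
  rewrite gB ?t1 //; apply: bL; apply: ball_segment => //; last exact: ballxx.
  by lra.
have g0 : g 0 = x0 by rewrite gA ?mulr0 ?(clL 0) // invr_ge0.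
have g1 : g 1 = x0 by rewrite gC ?(clL (- 3 * 1 + 3)) //; lra.
have [G HG G0] := frame_along_normalized cg gL.
have G01 := trivial_monodromy cg gL (etrans g0 (esym g1)) HG.
have third (a b : R) : (forall t, unit_itv t -> unit_itv (a * t + b)) ->
   frame_along (fun t => g (a * t + b)) unit_itv (fun t => G (a * t + b)).
  by move=> H; exact: (@frame_along_comp _ _ (fun t => a * t + b) g _ unit_itv G (ca a b) H HG).
have cu1 := connected_unit_itv.
(* On each third of [0, 1] the frame of the loop is determined, by uniqueness,
   by its value at the left end. *)
have T1 : G 3^-1 = c.
  have Hl : frame_along gx unit_itv (fun t => G (3^-1 * t + 0)).
    apply: (frame_along_ext _ (third 3^-1 0 _)) => t; rewrite /unit_itv /= => Ht; last by lra.
    by rewrite addr0 gA ?mulrA ?divff ?mul1r ?cl_id //; lra.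
  have := frame_along_unique cgx cu1 Hl HGx unit1 unit0.
  rewrite mulr1 mulr0 !addr0 G0 Gx0 trmx1 mulmx1 Gx1 => E.
  have oc : c *m c^T = 1%:M by rewrite -Gx1; exact: frame_along_orth HGx unit1.
  by rewrite -[G _]mulmx1 -(mulmx1C oc) mulmxA E mul1mx.
have T2 : G (2 / 3) = c *m F y.
  pose s t := x + t *: (y - x).
  have cs : continuous s.
    move=> t; apply: (@continuousD _ _ _ (fun _ : R => x)); first exact: cst_continuous.
    by apply: (@continuousZl _ _ _ (fun t : R => t)); exact: cvg_id.
  have Hl : frame_along s unit_itv (fun t => G (3^-1 * t + 3^-1)).
    apply: (frame_along_ext _ (third 3^-1 3^-1 _)) => t; rewrite /unit_itv /= => Ht; last by lra.
    by rewrite gB; [rewrite mulrDr mulrA divff // mul1r addrK|lra].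
  have Hl' : frame_along s unit_itv (fun t => F (s t)).
    apply: frame_along_of_frame bL HF _ => t Ht; apply: ball_segment => //; exact: ballxx.
  have := frame_along_unique cs cu1 Hl Hl' unit1 unit0.
  rewrite mulr1 mulr0 add0r /s scale1r scale0r addr0 [x + _]addrC subrK Fx trmx1 mulmx1 T1.
  have -> : 3^-1 + 3^-1 = 2 / 3 :> R by lra.
  have [oy _ _ _] := HF y Hy.
  by move=> <-; rewrite -mulmxA (mulmx1C oy) mulmx1.
have Hl : frame_along gy unit_itv (fun t => G (- 3^-1 * t + 1)).
  apply: (frame_along_ext _ (third (- 3^-1) 1 _)) => t; rewrite /unit_itv /= => Ht; last by lra.
  by rewrite gC ?cl_id; [congr gy|..]; lra.
have := frame_along_unique cgy cu1 Hl HGy unit1 unit0.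
rewrite mulr1 mulr0 add0r -G01 G0 Gy0 trmx1 mulmx1 Gy1.
have -> : - 3^-1 + 1 = 2 / 3 :> R by lra.
rewrite T2 => E; have oc : c' *m c'^T = 1%:M by rewrite -Gy1; exact: frame_along_orth HGy unit1.
by rewrite -[c']mul1mx -E -mulmxA (mulmx1C oc) mulmx1.
Qed.

(** The frame at x is the transport of the identity along any path from a base
    point; [transport_step] makes it parallel near x. *)
Lemma global_frame : L !=set0 -> exists F, frame L F.
Proof.
move=> [x0 L0].
have /choice[F HF] : forall x, exists c, L x -> transport x0 x c.
  move=> x; have [Lx|nL] := pselect (L x); last by exists 0.
  by have [c Hc] := transport_exists L0 Lx; exists c.
exists F => x Lx; have [r [phi [r0 bL phix Hphi]]] := local Lx.
have E y : ball x r y -> F y = F x *m phi y.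
  by move=> Hy; apply: (transport_step L0 (HF x Lx) (HF y (bL y Hy)) bL Hphi).
have oFx : F x *m (F x)^T = 1%:M.
  have [g [G [_ [HG _ <-]]]] := HF x Lx; exact: frame_along_orth HG unit1.
have [ho1 d1 p0 p1] := parallel_frame_scale oFx Hphi (ballxx x r0).
have N : \forall y \near x, F x *m phi y = F y.
  by apply/nbhs_ballP; exists r => //= y Hy; rewrite (E y Hy).
have Nij i j : \forall y \near x, (F x *m phi y) i j = F y i j.
  by apply: filterS N => y ->.
have Ex : F x *m phi x = F x by rewrite phix mulmx1.
rewrite Ex in ho1 p0 p1; split=> //.
- by move=> i j; apply: near_eq_differentiable (Nij i j) (d1 i j).
- by rewrite -p0; apply/matrixP => i j; rewrite !mxE; apply/esym/near_eq_derive.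
- by rewrite -p1; apply/matrixP => i j; rewrite !mxE; apply/esym/near_eq_derive.
Qed.

End Globalization.

(** * Integration of a flat u(3)-valued form *)

Section ComplexFrame.
Context {R : realType}.
Local Notation C := R[i].
Local Notation V := 'rV[R]_2.

Lemma I2P (k : 'I_2) : k = 0 \/ k = 1.
Proof. by case: k => -[|[|//]] Hk; [left|right]; apply/val_inj. Qed.

Lemma parallel_frame_exists {m} (A B : V -> 'M[R]_m) (L : set V) (x0 : V) :
  open L -> simply_connected R L -> L x0 -> rCk 2 L A -> rCk 2 L B ->
  (forall z, L z -> (A z)^T = - A z) -> (forall z, L z -> (B z)^T = - B z) ->
  (forall z, L z -> pmx 0 B z - pmx 1 A z + (A z *m B z - B z *m A z) = 0) ->
  exists2 F, parallel_frame A B L F & F x0 = 1%:M.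
Proof.
move=> oL scL L0 cA cB sA sB fl.
have loc p : L p -> exists r F, [/\ 0 < r, ball p r `<=` L, F p = 1%:M & parallel_frame A B (ball p r) F].
  exact: local_frame.
have [|F HF] := global_frame sA sB loc scL; first by exists x0.
have [ho _ _ _] := HF x0 L0.
exists (fun z => (F x0)^T *m F z); last exact: mulmx1C.
by apply: parallel_frame_scale HF; rewrite trmxK; exact: mulmx1C.
Qed.

(** The action of X on C^3 = R^6, which turns skew-hermitian matrices into
    skew-symmetric ones, so that the real theory of parallel frames applies. *)
Definition realify (X : 'M[C]_3) : 'M[R]_(3 + 3) :=
  block_mx (map_mx (@complex.Re R) X) (- map_mx (@complex.Im R) X)
           (map_mx (@complex.Im R) X) (map_mx (@complex.Re R) X).

Lemma map_ReM (X Y : 'M[C]_3) : map_mx (@complex.Re R) (X *m Y)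
  = map_mx (@complex.Re R) X *m map_mx (@complex.Re R) Y
    - map_mx (@complex.Im R) X *m map_mx (@complex.Im R) Y.
Proof.
apply/matrixP => i j; rewrite !mxE Re_sum -sumrB; apply: eq_bigr => l _.
by rewrite !mxE cReM.
Qed.

Lemma map_ImM (X Y : 'M[C]_3) : map_mx (@complex.Im R) (X *m Y)
  = map_mx (@complex.Re R) X *m map_mx (@complex.Im R) Y
    + map_mx (@complex.Im R) X *m map_mx (@complex.Re R) Y.
Proof.
apply/matrixP => i j; rewrite !mxE Im_sum -big_split; apply: eq_bigr => l _.
by rewrite !mxE cImM.
Qed.

Lemma realifyM X Y : realify (X *m Y) = realify X *m realify Y.
Proof.
rewrite /realify mulmx_block map_ReM map_ImM; congr (block_mx _ _ _ _).
- by rewrite mulNmx.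
- by rewrite mulmxN mulNmx opprD.
- by rewrite addrC.
- by rewrite mulmxN addrC.
Qed.

Lemma realifyD X Y : realify (X + Y) = realify X + realify Y.
Proof.
rewrite /realify add_block_mx; congr (block_mx _ _ _ _); apply/matrixP => i j; rewrite !mxE ?cReD ?cImD //.
exact: opprD.
Qed.

Lemma realifyN X : realify (- X) = - realify X.
Proof.
rewrite /realify opp_block_mx; congr (block_mx _ _ _ _); apply/matrixP => i j; by rewrite !mxE ?cReN ?cImN.
Qed.

Lemma realify0 : realify 0 = 0.
Proof.
by rewrite /realify -[RHS](@block_mx_const _ 3 3 3 3); congr (block_mx _ _ _ _);
  apply/matrixP => i j; rewrite !mxE ?oppr0.
Qed.

Lemma realify_skew X : in_u3 X -> (realify X)^T = - realify X.
Proof.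
rewrite /in_u3 adj_sesqui => H.
have E i j : (X j i)^*%C = - X i j by have := congr1 (fun M : 'M[C]_3 => M i j) H; rewrite !mxE.
have ERe i j : complex.Re (X j i) = - complex.Re (X i j) by rewrite -cReJ E cReN.
have EIm i j : complex.Im (X j i) = complex.Im (X i j).
  by apply: oppr_inj; rewrite -cImJ E cImN.
rewrite /realify tr_block_mx opp_block_mx.
congr (block_mx _ _ _ _); apply/matrixP => i j.
- by rewrite !mxE ERe.
- by rewrite !mxE EIm opprK.
- by rewrite !mxE EIm.
- by rewrite !mxE ERe.
Qed.

Lemma rCk_realify k (U : set V) (X : V -> 'M[C]_3) : open U -> Ckmx k U X ->
  rCk k U (fun z => realify (X z)).
Proof.
move=> oU H i j.
case: (split_ordP i) => i' ->; case: (split_ordP j) => j' ->; have [H1 H2] := H i' j'.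
- by apply: (Ck_eq oU _ H1) => z _; rewrite /realify block_mxEul mxE.
- by apply: (Ck_eq oU _ (CkN H2 oU)) => z _; rewrite /realify block_mxEur !mxE.
- by apply: (Ck_eq oU _ H2) => z _; rewrite /realify block_mxEdl mxE.
- by apply: (Ck_eq oU _ H1) => z _; rewrite /realify block_mxEdr mxE.
Qed.

Lemma pmx_realify k (X : V -> 'M[C]_3) z : mxdiff X z ->
  pmx k (fun w => realify (X w)) z = realify (pdmx k X z).
Proof.
move=> dX; apply/matrixP => i j; rewrite mxE.
case: (split_ordP i) => i' ->; case: (split_ordP j) => j' ->; have [H1 H2] := dX i' j'.
- rewrite /realify block_mxEul !mxE /=; apply: derive_ext => w; by rewrite block_mxEul mxE.
- rewrite /realify block_mxEur !mxE /= -deriveN; last exact: diff_derivable.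
  by apply: derive_ext => w; rewrite block_mxEur !mxE.
- rewrite /realify block_mxEdl !mxE /=; apply: derive_ext => w; by rewrite block_mxEdl mxE.
- rewrite /realify block_mxEdr !mxE /=; apply: derive_ext => w; by rewrite block_mxEdr mxE.
Qed.

Lemma constant_mx {p q} (L : set V) (f : V -> 'M[C]_(p, q)) : open L -> connected L ->
  (forall z, L z -> mxdiff f z) -> (forall z k, L z -> pdmx k f z = 0) ->
  forall z w, L z -> L w -> f z = f w.
Proof.
move=> oL cL df Df z w Lz Lw; apply/matrixP => i j.
have D0 u v : L u -> dC (fun y => f y i j) u v = 0.
  move=> Lu; rewrite -dmxE dmx2; last exact: df.
  by rewrite !Df // !scaler0 addr0 mxE.
apply: complex_ext.
  apply: (@zero_derivative_connected R 2 L (fun u => complex.Re (f u i j))) => // u => [Lu|v Lu].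
    by have [] := df u Lu i j.
  by have [] := D0 u v Lu.
apply: (@zero_derivative_connected R 2 L (fun u => complex.Im (f u i j))) => // u => [Lu|v Lu].
  by have [] := df u Lu i j.
by have [] := D0 u v Lu.
Qed.

(** Bootstrap: if F is of class C^k, so is dF = F a. *)
Lemma integral_smooth (L : set V) (a : form1 (R := R)) F : open L ->
  smooth_mx L (fun z => (a z).1) -> smooth_mx L (fun z => (a z).2) ->
  (forall z, L z -> mxdiff F z) -> integrates L a F -> smooth_mx L F.
Proof.
move=> oL /smooth_mxP s1 /smooth_mxP s2 dF iF; apply/smooth_mxP; elim=> [|k IH].
  by move=> i j; split=> z Lz; apply: differentiable_continuous; have [] := dF z Lz i j.
apply: Ckmx_step => // l; case: (I2P l) => ->.
  by apply: (Ckmx_ext oL _ (CkmxM oL IH (s1 k))) => z Lz; have [-> _] := iF z Lz.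
by apply: (Ckmx_ext oL _ (CkmxM oL IH (s2 k))) => z Lz; have [_ ->] := iF z Lz.
Qed.

Lemma in_u3_adj (X : 'M[C]_3) : in_u3 X -> adj X = - X.
Proof. by rewrite /in_u3 adj_sesqui. Qed.

Lemma unitarymx_adj (X : 'M[C]_3) : X \is unitarymx <-> X *m adj X = 1%:M.
Proof. by rewrite -adj_sesqui; split=> [/unitarymxP|H]; [|apply/unitarymxP]. Qed.

(** The derivative of F (adj F) is F (a + adj a) (adj F) = 0. *)
Lemma integral_unitary (L : set V) (a : form1 (R := R)) F x0 : open L -> connected L -> L x0 ->
  u3_form L a -> (forall z, L z -> mxdiff F z) -> integrates L a F ->
  F x0 *m adj (F x0) = 1%:M -> forall z, L z -> F z *m adj (F z) = 1%:M.
Proof.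
move=> oL cL L0 [_ _ ua] dF iF F0 z Lz; rewrite -F0.
apply: (@constant_mx _ _ L (fun z => F z *m adj (F z))) => // {z Lz} z => [Lz|k Lz].
  by apply: mxdiffM; [exact: dF|exact/mxdiff_adj/dF].
have dFz := dF z Lz; have [u1 u2] := ua z Lz; have [i1 i2] := iF z Lz.
rewrite /pdmx dmxM //; last exact: mxdiff_adj.
rewrite dmx_adj //; case: (I2P k) => ->.
  by rewrite -/(pdmx 0 F z) i1 adjM (in_u3_adj u1) mulNmx mulmxN mulmxA addrN.
by rewrite -/(pdmx 1 F z) i2 adjM (in_u3_adj u2) mulNmx mulmxN mulmxA addrN.
Qed.

Lemma half_wedge_bracket (w : covector (R := R)) :
  2^-1 *: wedge_bracket w w = w.1 *m w.2 - w.2 *m w.1.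
Proof.
rewrite /wedge_bracket /lie opprB; set X := _ - _.
rewrite -[X in _ *: (X + _)]scale1r -[X in _ *: (_ + X)]scale1r -scalerDl scalerA.
by rewrite -[1 + 1]/(2%:R) mulVf ?scale1r // pnatr_eq0.
Qed.

(** The solution in U(3) of the realified equation is read off the upper three
    rows of a real 6 x 6 frame: right multiplication by a realified matrix acts
    on a row (u, v) as complex multiplication acts on u - i v. *)
Lemma flat_integrable (L : set V) (a : form1 (R := R)) : is_domain L -> simply_connected R L ->
  u3_form L a -> flat L a -> exists F, U3_map L F /\ integrates L a F.
Proof.
move=> [oL cL [x0 L0]] scL ua fl; have [s1 s2 uz] := ua.
have S1 := (smooth_mxP _ _).1 s1; have S2 := (smooth_mxP _ _).1 s2.
pose A z := realify (a z).1; pose B z := realify (a z).2.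
have d1 z : L z -> mxdiff (fun z => (a z).1) z by move=> Lz; exact: Ckmx_mxdiff (S1 1%N) Lz.
have d2 z : L z -> mxdiff (fun z => (a z).2) z by move=> Lz; exact: Ckmx_mxdiff (S2 1%N) Lz.
have [|||F6 HF F60] := @parallel_frame_exists _ A B L x0 oL scL L0 (rCk_realify oL (S1 2%N)) (rCk_realify oL (S2 2%N)).
- by move=> z Lz; apply: realify_skew; have [] := uz z Lz.
- by move=> z Lz; apply: realify_skew; have [] := uz z Lz.
- move=> z Lz; rewrite /A /B !pmx_realify; [|exact: d1|exact: d2].
  rewrite -!realifyM -!realifyN -!realifyD -[RHS]realify0; congr realify.
  by rewrite -[RHS](fl z Lz) half_wedge_bracket.
pose F z : 'M[C]_3 := \matrix_(i, j) (F6 z (lshift 3 i) (lshift 3 j) -i* F6 z (lshift 3 i) (rshift 3 j))%C.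
have dF z : L z -> mxdiff F z.
  move=> Lz i j; have [_ dd _ _] := HF z Lz; split.
    rewrite (_ : (fun y => _) = (fun w => F6 w (lshift 3 i) (lshift 3 j))); first exact: dd.
    by apply/funext => w; rewrite mxE.
  rewrite (_ : (fun y => _) = - (fun w => F6 w (lshift 3 i) (rshift 3 j))).
    exact/differentiableN/dd.
  by apply/funext => w; rewrite mxE.
have pF k (X : V -> 'M[C]_3) z : L z -> pmx k F6 z = F6 z *m realify (X z) ->
    pdmx k F z = F z *m X z.
  move=> Lz H; have [_ dd _ _] := HF z Lz; apply/matrixP => i j.
  have H1 := congr1 (fun M : 'M[R]_(3 + 3) => M (lshift 3 i) (lshift 3 j)) H.
  have H2 := congr1 (fun M : 'M[R]_(3 + 3) => M (lshift 3 i) (rshift 3 j)) H.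
  rewrite /= mxE [RHS]mxE big_split_ord /= in H1.
  rewrite /= mxE [RHS]mxE big_split_ord /= in H2.
  rewrite mxE [RHS]mxE; apply: complex_ext => /=.
    rewrite (_ : 'D_ _ _ _ = 'D_(delta_mx 0 k) (fun w => F6 w (lshift 3 i) (lshift 3 j)) z); last first.
      by apply: derive_ext => w; rewrite mxE.
    rewrite H1 Re_sum -big_split; apply: eq_bigr => l _ /=.
    by rewrite /realify block_mxEul block_mxEdl !mxE cReM /= mulNr opprK.
  rewrite (_ : 'D_ _ _ _ = - 'D_(delta_mx 0 k) (fun w => F6 w (lshift 3 i) (rshift 3 j)) z); last first.
    rewrite -deriveN; last exact/diff_derivable/dd.
    by apply: derive_ext => w; rewrite mxE.
  rewrite H2 Im_sum -big_split -sumrN; apply: eq_bigr => l _ /=.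
  by rewrite /realify block_mxEur block_mxEdr !mxE cImM /= opprD mulrN opprK mulNr.
have iF : integrates L a F.
  move=> z Lz; have [_ _ p0 p1] := HF z Lz; split.
    exact: (pF 0 (fun z => (a z).1)).
  exact: (pF 1 (fun z => (a z).2)).
have F0 : F x0 = 1%:M.
  apply/matrixP => i j; rewrite !mxE F60 !mxE eq_lshift eq_lrshift.
  by case: (i == j); apply: complex_ext => //=; rewrite ?oppr0.
exists F; split=> //; split; first exact: integral_smooth iF.
move=> z Lz; apply/unitarymx_adj; apply: (integral_unitary oL cL L0 ua dF iF) => //.
rewrite F0 mul1mx; apply/matrixP => i j; rewrite !mxE eq_sym.
by case: (i == j); apply: complex_ext => //=; rewrite ?oppr0.
Qed.

End ComplexFrame.

(** * The components under the order four automorphism *)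

Section ThreeByThree.
Context {R : realType}.
Local Notation C := R[i].
Local Notation ic := ('i%C : C).

Definition i0 : 'I_3 := @Ordinal 3 0 isT.
Definition i1 : 'I_3 := @Ordinal 3 1 isT.
Definition i2 : 'I_3 := @Ordinal 3 2 isT.

Lemma I3P (k : 'I_3) : [\/ k = i0, k = i1 | k = i2].
Proof.
by case: k => -[|[|[|//]]] Hk; [apply: Or31|apply: Or32|apply: Or33]; apply/val_inj.
Qed.

Lemma sum3 {M : nmodType} (f : 'I_3 -> M) : \sum_k f k = f i0 + f i1 + f i2.
Proof.
rewrite !big_ord_recr big_ord0 /= add0r.
by congr (f _ + f _ + f _); apply/val_inj.
Qed.

Lemma ord_max2 : ord_max = i2 :> 'I_3. Proof. exact/val_inj. Qed.

Lemma mx3E (a b c d e f g h k : C) :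
  let X := mx3 [:: [:: a; b; c]; [:: d; e; f]; [:: g; h; k]] in
  ((X i0 i0 = a) * (X i0 i1 = b) * (X i0 i2 = c) *
   (X i1 i0 = d) * (X i1 i1 = e) * (X i1 i2 = f) *
   (X i2 i0 = g) * (X i2 i1 = h) * (X i2 i2 = k))%type.
Proof. by rewrite /=; do !split; rewrite mxE. Qed.

Lemma m_compE (X : 'M[C]_3) :
  ((m_comp X i0 i0 = 0) * (m_comp X i0 i1 = 0) * (m_comp X i1 i0 = 0) *
   (m_comp X i1 i1 = 0) * (m_comp X i0 i2 = X i0 i2) * (m_comp X i1 i2 = X i1 i2) *
   (m_comp X i2 i0 = X i2 i0) * (m_comp X i2 i1 = X i2 i1) * (m_comp X i2 i2 = X i2 i2))%type.
Proof. by do !split; rewrite mxE. Qed.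

Lemma tau_mx3 (X : 'M[C]_3) : tau X = mx3
  [:: [:: - X i1 i1; X i0 i1; - X i2 i1];
      [:: X i1 i0; - X i0 i0; X i2 i0];
      [:: - X i1 i2; X i0 i2; - X i2 i2]].
Proof.
rewrite /tau T3V; apply/matrixP => j k; rewrite mxE mxE sum3.
rewrite !mxE !sum3 !mxE.
by case: (I3P j) => ->; case: (I3P k) => -> /=;
  rewrite !(mulr0, mul0r, addr0, add0r, mulr1, mul1r, mulrN1, mulN1r, opprK, mulrN, mulNr).
Qed.

Lemma tau_comp_expand k (X : 'M[C]_3) : tau_comp k X =
  4^-1 *: (X + (ic ^ k)^-1 *: tau X + (ic ^ k) ^- 2 *: tau (tau X) + (ic ^ k) ^- 3 *: tau (tau (tau X))).
Proof.
rewrite /tau_comp !big_ord_recr big_ord0 /= add0r expr0 invr1 scale1r expr1 //.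
Qed.

Lemma inv_i : ic^-1 = - ic.
Proof.
apply: (mulfI (@i_neq0 R)); rewrite divff ?i_neq0 // mulrN -expr2 sqr_i opprK //.
Qed.

Lemma tau_comp_m1 (X : 'M[C]_3) : tau_comp (-1) X = mx3
  [:: [:: 0; 0; 2^-1 * (X i0 i2 - ic * X i2 i1)];
      [:: 0; 0; 2^-1 * (X i1 i2 + ic * X i2 i0)];
      [:: 2^-1 * (X i2 i0 - ic * X i1 i2); 2^-1 * (X i2 i1 + ic * X i0 i2); 0]].
Proof.
have w : ic ^ (-1) = - ic by rewrite -inv_i.
have wV : (- ic)^-1 = ic by rewrite invrN inv_i opprK.
rewrite tau_comp_expand w -!exprVn wV sqr_i exprS sqr_i.
apply/matrixP => j k; rewrite !(tau_mx3, mxE).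
by case: (I3P j) => ->; case: (I3P k) => -> /=; field.
Qed.

Lemma tau_comp_1 (X : 'M[C]_3) : tau_comp 1 X = mx3
  [:: [:: 0; 0; 2^-1 * (X i0 i2 + ic * X i2 i1)];
      [:: 0; 0; 2^-1 * (X i1 i2 - ic * X i2 i0)];
      [:: 2^-1 * (X i2 i0 + ic * X i1 i2); 2^-1 * (X i2 i1 - ic * X i0 i2); 0]].
Proof.
have iN2 : (- ic) ^+ 2 = -1 by rewrite sqrrN sqr_i.
rewrite tau_comp_expand expr1z -!exprVn inv_i iN2 exprS iN2.
apply/matrixP => j k; rewrite !(tau_mx3, mxE).
by case: (I3P j) => ->; case: (I3P k) => -> /=; field.
Qed.

Lemma tau_comp_2 (X : 'M[C]_3) : tau_comp 2 X = mx3
  [:: [:: 2^-1 * (X i0 i0 + X i1 i1); 0; 0];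
      [:: 0; 2^-1 * (X i0 i0 + X i1 i1); 0];
      [:: 0; 0; X i2 i2]].
Proof.
have w : ic ^ 2 = -1 by exact: sqr_i.
rewrite tau_comp_expand w -!exprVn invrN1 sqrrN expr1n exprS sqrrN expr1n mulr1.
apply/matrixP => j k; rewrite !(tau_mx3, mxE).
by case: (I3P j) => ->; case: (I3P k) => -> /=; field.
Qed.

Lemma mxtrace3 (X : 'M[C]_3) : \tr X = X i0 i0 + X i1 i1 + X i2 i2.
Proof. exact: sum3. Qed.

(** The components of degrees -1, 0 and 1 are traceless; so only the component of
    degree 2 moves the determinant of a frame. *)
Lemma trace_tau_comp_2 (X : 'M[C]_3) : \tr (tau_comp 2 X) = \tr X.
Proof. by rewrite tau_comp_2 !mxtrace3 !mx3E; field. Qed.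

Lemma in_u3_entry (X : 'M[C]_3) j k : in_u3 X -> X k j = - (X j k)^*%C.
Proof.
move=> /in_u3_adj H; have := congr1 (fun M : 'M[C]_3 => M k j) H.
by rewrite !mxE => ->; rewrite opprK.
Qed.

Lemma i_mul_i : ic * ic = -1.
Proof. by rewrite -expr2 sqr_i. Qed.

(** The entries of [part_sum]: u, v are the entries of w.1 that one eigenspace
    projection mixes, and p, q those of w.2.  The two halves of dz and dzbar
    recombine into real coefficients. *)
Lemma part_algebra (u v p q : C) : [/\
  2^-1 * (2^-1 * (u - ic * v) - ic * (2^-1 * (p - ic * q)))
   + 2^-1 * (2^-1 * (u + ic * v) + ic * (2^-1 * (p + ic * q))) = 2^-1 * (u - q),
  2^-1 * (2^-1 * (u + ic * v) - ic * (2^-1 * (p + ic * q)))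
   + 2^-1 * (2^-1 * (u - ic * v) + ic * (2^-1 * (p - ic * q))) = 2^-1 * (u + q),
  ic * (2^-1 * (2^-1 * (u - ic * v) - ic * (2^-1 * (p - ic * q))))
   + - ic * (2^-1 * (2^-1 * (u + ic * v) + ic * (2^-1 * (p + ic * q)))) = 2^-1 * (p + v) &
  ic * (2^-1 * (2^-1 * (u + ic * v) - ic * (2^-1 * (p + ic * q))))
   + - ic * (2^-1 * (2^-1 * (u - ic * v) + ic * (2^-1 * (p - ic * q)))) = 2^-1 * (p - v)].
Proof.
move: ic i_mul_i => I II; split.
- by transitivity (2^-1 * (u + I * I * q)); [field|rewrite II; ring].
- by transitivity (2^-1 * (u - I * I * q)); [field|rewrite II; ring].
- by transitivity (2^-1 * (- (I * I) * (p + v))); [field|rewrite II; ring].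
- by transitivity (2^-1 * (- (I * I) * (p - v))); [field|rewrite II; ring].
Qed.

Lemma part_sum (w : covector (R := R)) :
  part10 (cov_map (tau_comp (-1)) w) + part01 (cov_map (tau_comp 1) w) =
  (mx3 [:: [:: 0; 0; 2^-1 * (w.1 i0 i2 - w.2 i2 i1)];
           [:: 0; 0; 2^-1 * (w.1 i1 i2 + w.2 i2 i0)];
           [:: 2^-1 * (w.1 i2 i0 - w.2 i1 i2); 2^-1 * (w.1 i2 i1 + w.2 i0 i2); 0]],
   mx3 [:: [:: 0; 0; 2^-1 * (w.2 i0 i2 + w.1 i2 i1)];
           [:: 0; 0; 2^-1 * (w.2 i1 i2 - w.1 i2 i0)];
           [:: 2^-1 * (w.2 i2 i0 + w.1 i1 i2); 2^-1 * (w.2 i2 i1 - w.1 i0 i2); 0]]).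
Proof.
case: w => X Y.
have gen1 (P Q P' Q' : 'M[C]_3) j k :
    (2^-1 *: (P - ic *: Q) + 2^-1 *: (P' + ic *: Q')) j k
    = 2^-1 * (P j k - ic * Q j k) + 2^-1 * (P' j k + ic * Q' j k).
  by rewrite !mxE.
have gen2 (P Q P' Q' : 'M[C]_3) j k :
    (ic *: (2^-1 *: (P - ic *: Q)) + - ic *: (2^-1 *: (P' + ic *: Q'))) j k
    = ic * (2^-1 * (P j k - ic * Q j k)) + - ic * (2^-1 * (P' j k + ic * Q' j k)).
  by rewrite !mxE.
transitivity (2^-1 *: (tau_comp (-1) X - ic *: tau_comp (-1) Y)
    + 2^-1 *: (tau_comp 1 X + ic *: tau_comp 1 Y),
  ic *: (2^-1 *: (tau_comp (-1) X - ic *: tau_comp (-1) Y))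
    + - ic *: (2^-1 *: (tau_comp 1 X + ic *: tau_comp 1 Y))); first by [].
rewrite !tau_comp_m1 !tau_comp_1 ![(X, Y).1]/fst ![(X, Y).2]/snd.
congr pair; apply/matrixP => j k; rewrite ?gen1 ?gen2.
- have A u v p q := let: And4 a _ _ _ := part_algebra u v p q in a.
  have B u v p q := let: And4 _ a _ _ := part_algebra u v p q in a.
  by case: (I3P j) => ->; case: (I3P k) => ->; rewrite !mx3E;
    first [exact: A | exact: B | by rewrite !(mulr0, subr0, addr0)].
- have A u v p q := let: And4 _ _ a _ := part_algebra u v p q in a.
  have B u v p q := let: And4 _ _ _ a := part_algebra u v p q in a.
  by case: (I3P j) => ->; case: (I3P k) => ->; rewrite !mx3E;
    first [exact: A | exact: B | by rewrite !(mulr0, subr0, addr0)].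
Qed.

(** The components of degrees -1 and 1 vanish on the diagonal, which gives the
    first two equations.  The other equations say that the
    third column of w.2 is the image of that of w.1 under the quaternionic
    structure (u, v) -> (- conj v, conj u) of C^2. *)
Lemma m_conditionP (w : covector (R := R)) : in_u3 w.1 -> in_u3 w.2 ->
  cov_map m_comp w = part10 (cov_map (tau_comp (-1)) w) + part01 (cov_map (tau_comp 1) w)
  <-> [/\ w.1 i2 i2 = 0, w.2 i2 i2 = 0, w.2 i0 i2 = - (w.1 i1 i2)^*%C & w.2 i1 i2 = (w.1 i0 i2)^*%C].
Proof.
case: w => X Y uX uY; rewrite part_sum /cov_map ![(X, Y).1]/fst ![(X, Y).2]/snd.
rewrite ![fst _]/= ![snd _]/= in uX uY *.
have X20 := in_u3_entry i0 i2 uX; have X21 := in_u3_entry i1 i2 uX.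
have Y20 := in_u3_entry i0 i2 uY; have Y21 := in_u3_entry i1 i2 uY.
have two (x y : C) : x = 2^-1 * (x + y) -> x = y.
  move=> H; have : 2 * x = x + y by rewrite {1}H mulrA divff ?mul1r ?pnatr_eq0.
  by rewrite mulr2n mulrDl mul1r => /addrI.
have half (x : C) : x = 2^-1 * (x + x).
  by field.
split=> [[H1 H2]|[h1 h2 h3 h4]].
  have e1 j k := congr1 (fun M : 'M[C]_3 => M j k) H1.
  have e2 j k := congr1 (fun M : 'M[C]_3 => M j k) H2.
  have := e1 i2 i2; have := e2 i2 i2; have := e1 i0 i2; have := e1 i1 i2.
  cbv beta; rewrite !m_compE !mx3E => E3 E4 E2 E1; split=> //.
    by have := two _ _ E3; rewrite Y20 => ->; rewrite rmorphN /= conjcK opprK.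
  by have := two _ _ E4; rewrite Y21 opprK => ->; rewrite conjcK.
have Y20' : Y i2 i0 = X i1 i2 by rewrite Y20 h3 rmorphN /= conjcK opprK.
have Y21' : Y i2 i1 = - X i0 i2 by rewrite Y21 h4 conjcK.
congr pair; apply/matrixP => j k; case: (I3P j) => ->; case: (I3P k) => ->;
rewrite m_compE mx3E ?X20 ?X21 ?Y20' ?Y21' ?h1 ?h2 ?h3 ?h4 ?opprK //; exact: half.
Qed.

End ThreeByThree.

(** * Cones over a map of the plane *)

Section BasePoint.
Context {R : realType}.
Local Notation C := R[i].
Local Notation V := 'rV[R]_2.
Local Notation V3 := 'rV[R]_3.

Lemma base_ptE (q : V3) : base_pt q = pt (q 0 i0) (q 0 i1).
Proof. by apply: row2P; rewrite !mxE /=; congr (q _ _); apply/val_inj. Qed.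

Lemma continuous_base_pt : continuous (@base_pt R).
Proof.
move=> q; apply/(@cvgrPdist_le _ _ _ (nbhs q)) => e e0.
have c0 : {for q, continuous (fun w : V3 => w 0 i0)} by exact: coord_continuous.
have c1 : {for q, continuous (fun w : V3 => w 0 i1)} by exact: coord_continuous.
have /cvgrPdist_le /(_ _ e0) N0 := c0; have /cvgrPdist_le /(_ _ e0) N1 := c1.
near=> w; rewrite !base_ptE norm2_le !mxE /=.
by apply/andP; split; near: w.
Unshelve. all: by end_near. Qed.

Lemma base_pt_linear (a : R) (v w : V3) : base_pt (a *: v + w) = a *: base_pt v + base_pt w.
Proof. by apply/rowP => j; rewrite !mxE. Qed.

Lemma base_pt_comp (g : V -> R) (q v : V3) : differentiable g (base_pt q) ->
  differentiable (fun q => g (base_pt q)) q /\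
  'D_v (fun q => g (base_pt q)) q = 'D_(base_pt v) g (base_pt q).
Proof.
move=> dg; have lin : linear (@base_pt R) by move=> a u w; exact: base_pt_linear.
pose LM := GRing.isLinear.Build _ _ _ _ _ lin.
pose B : {linear V3 -> V} := HB.pack (@base_pt R) LM.
have cB : continuous B := @continuous_base_pt.
have dB : differentiable B q by exact: linear_differentiable.
have dc : differentiable (g \o B) q by exact: differentiable_comp.
split; first exact: dc.
rewrite -[LHS]/('D_v (g \o B) q) deriveE // diff_comp //= deriveE //.
have e : 'd B q = B :> (V3 -> V) by exact: diff_lin.
by congr ('d g _ _); exact: (congr1 (fun h => h v) e).
Qed.

Lemma base_delta : (base_pt (delta_mx 0 i0 : V3) = delta_mx 0 0) *
  (base_pt (delta_mx 0 i1 : V3) = delta_mx 0 1) * (base_pt (delta_mx 0 i2 : V3) = 0).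
Proof. by do !split; apply: row2P; rewrite !mxE. Qed.

Lemma open_base (U : set V) : open U -> open (@base_pt R @^-1` U).
Proof. by apply: open_comp => q _; exact: continuous_base_pt. Qed.

(** By induction, the derivatives along the third axis being zero. *)
Lemma Ck_base k (U : set V) (g : V -> R) : open U -> Ck k U g ->
  Ck k (@base_pt R @^-1` U) (fun q => g (base_pt q)).
Proof.
move=> oU; elim: k g => [|k IH] g.
  move=> cg q Uq; apply: (@continuous_comp _ _ _ (@base_pt R) g).
    exact: continuous_base_pt.
  exact: cg.
move=> [dg Dg]; split=> [q Uq|i].
  by have [] := base_pt_comp 0 (dg _ Uq).
apply: (@Ck_eq _ _ _ _ (fun q => 'D_(base_pt (delta_mx 0 i)) g (base_pt q))).
- exact: open_base.
- by move=> q Uq; have [_ ->] := base_pt_comp (delta_mx 0 i) (dg _ Uq).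
case: (I3P i) => ->; rewrite base_delta; [exact: IH (Dg 0)|exact: IH (Dg 1)|].
apply: (Ck_eq (open_base oU) _ (Ck_cst k _ 0)) => q _; by rewrite derive0.
Qed.

Lemma dC_base (h : V -> C) (q v : V3) : cdiff h (base_pt q) ->
  cdiff (fun q => h (base_pt q)) q /\
  dC (fun q => h (base_pt q)) q v = dC h (base_pt q) (base_pt v).
Proof.
move=> [h1 h2]; have [d1 e1] := base_pt_comp v h1; have [d2 e2] := base_pt_comp v h2.
by split; [split|rewrite /dC e1 e2].
Qed.

Lemma cone_map_diff (f : V -> 'cV[C]_3) (p v : V3) : mxdiff f (base_pt p) ->
  mxdiff (cone_map f) p /\ dmx (cone_map f) p v
  = (v 0 ord_max)%:C%C *: f (base_pt p) + (p 0 ord_max)%:C%C *: dmx f (base_pt p) (base_pt v).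
Proof.
move=> df.
have dr : cdiff (fun q : V3 => (q 0 ord_max)%:C%C) p.
  by split; [exact: differentiable_coord|exact: differentiable_cst].
have Dr : dC (fun q : V3 => (q 0 ord_max)%:C%C) p v = (v 0 ord_max)%:C%C.
  rewrite /dC /= derive_cst; congr Complex.
  rewrite deriveE; last exact: differentiable_coord.
  have @L : {linear V3 -> R}.
    by exists (fun N : V3 => N 0 ord_max); do 2![eexists]; do ?[constructor];
     rewrite ?mxE// => ? *; rewrite ?mxE//; move=> ?; rewrite !mxE.
  by rewrite (_ : (fun _ => _) = L) // diff_lin //; exact: coord_continuous.
have E j k : (fun q => cone_map f q j k) = (fun q => (q 0 ord_max)%:C%C * f (base_pt q) j k).
  by apply/funext => q; rewrite mxE.
have db j k := dC_base v (df j k).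
split=> [j k|]; first by rewrite E; apply: cdiffM => //; exact: (db j k).1.
apply/matrixP => j k; rewrite dmxE E dCM //; last exact: (db j k).1.
by rewrite Dr (db j k).2 !mxE.
Qed.

Lemma cone_map_smooth (U : set V) (f : V -> 'cV[C]_3) : open U -> smooth_mx U f ->
  smooth_mx (cone_domain U) (cone_map f).
Proof.
move=> oU /smooth_mxP sf; apply/smooth_mxP => k.
have oW := open_base oU.
have sub : cone_domain U `<=` @base_pt R @^-1` U by move=> q [].
apply: (Ckmx_subset sub) => i j.
apply: (@CkC_ext _ _ _ _ (fun q => (q 0 ord_max)%:C%C * f (base_pt q) i j)) => //.
  by move=> q _; rewrite mxE.
apply: CkCM => //; first by apply: CkC_real; exact: Ck_coord.
by have [h1 h2] := sf k i j; split; apply: (@Ck_base k U (fun z => _ (f z i j))).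
Qed.

Lemma open_cone_domain (U : set V) : open U -> open (cone_domain U).
Proof.
move=> oU; have -> : cone_domain U = (@base_pt R @^-1` U) `&` ((fun q : V3 => q 0 ord_max) @^-1` [set x | 0 < x]).
  by apply/seteqP; split.
apply: openI; first exact: open_base.
by apply: open_comp; [move=> q _; exact: coord_continuous|exact: open_gt].
Qed.

End BasePoint.

(** * Hermitian products and determinants in dimension three *)

Section Hermitian.
Context {R : realType}.
Local Notation C := R[i].

(** Linear in u and conjugate linear in v, with real part [cdot] and imaginary
    part minus the symplectic form; the two parts are treated together since a
    unitary matrix preserves both. *)
Definition herm {m} (u v : 'cV[C]_m) : C := (adj v *m u) 0 0.

Lemma cdot_herm {m} (u v : 'cV[C]_m) : cdot u v = complex.Re (herm u v).
Proof.
by rewrite /cdot /herm mxE; congr complex.Re; apply: eq_bigr => k _; rewrite !mxE mulrC.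
Qed.

Lemma omega_herm {m} (u v : 'cV[C]_m) : omega u v = complex.Im (herm v u).
Proof.
by rewrite /omega /herm mxE; congr complex.Im; apply: eq_bigr => k _; rewrite !mxE.
Qed.

Lemma herm_unitary {m} (F : 'M[C]_m) u v : adj F *m F = 1%:M -> herm (F *m u) (F *m v) = herm u v.
Proof. by move=> H; rewrite /herm adjM -mulmxA [adj F *m _]mulmxA H mul1mx. Qed.

Definition cv3 (x y w : C) : 'cV[C]_3 := \col_j [:: x; y; w]`_j.

Lemma cv3E x y w : ((cv3 x y w i0 0 = x) * (cv3 x y w i1 0 = y) * (cv3 x y w i2 0 = w))%type.
Proof. by do !split; rewrite mxE. Qed.

Lemma herm_cv3 x y w x' y' w' :
  herm (cv3 x y w) (cv3 x' y' w') = x'^*%C * x + y'^*%C * y + w'^*%C * w.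
Proof. by rewrite /herm mxE sum3 ![adj _ _ _]mxE ![(map_mx _ _) _ _]mxE !cv3E. Qed.

Lemma cv3_lin (a b : C) x y w x' y' w' : a *: cv3 x y w + b *: cv3 x' y' w' =
  cv3 (a * x + b * x') (a * y + b * y') (a * w + b * w').
Proof. by apply/colP => j; case: (I3P j) => ->; rewrite !mxE. Qed.

Lemma Re_real (x : R) : complex.Re (x%:C)%C = x. Proof. by []. Qed.

End Hermitian.

Section DetThree.
Context {R : realType}.
Local Notation C := R[i].

Lemma minor_entry m (M : 'M[C]_m.+1) i j (a b : 'I_m) : row' i (col' j M) a b = M (lift i a) (lift j b).
Proof. by rewrite !mxE. Qed.

Lemma det2 (M : 'M[C]_2) : \det M = M 0 0 * M 1 1 - M 0 1 * M 1 0.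
Proof.
rewrite (expand_det_row M ord0) !big_ord_recl big_ord0 /cofactor !det_mx11 addr0.
rewrite !minor_entry addn0 add0n expr0 mul1r expr1 mulN1r mulrN.
by congr (M _ _ * M _ _ - M _ _ * M _ _); apply/val_inj.
Qed.

Lemma det3 (M : 'M[C]_3) : \det M =
  M i0 i0 * (M i1 i1 * M i2 i2 - M i1 i2 * M i2 i1)
  - M i0 i1 * (M i1 i0 * M i2 i2 - M i1 i2 * M i2 i0)
  + M i0 i2 * (M i1 i0 * M i2 i1 - M i1 i1 * M i2 i0).
Proof.
rewrite (expand_det_row M i0) sum3 /cofactor !det2.
rewrite !minor_entry.
have l00 : lift i0 0 = i1 by exact/val_inj.
have l01 : lift i0 1 = i2 by exact/val_inj.
have l10 : lift i1 0 = i0 by exact/val_inj.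
have l11 : lift i1 1 = i2 by exact/val_inj.
have l20 : lift i2 0 = i0 by exact/val_inj.
have l21 : lift i2 1 = i1 by exact/val_inj.
rewrite l00 l01 l10 l11 l20 l21.
have s0 : (-1) ^+ (i0 + i0) = 1 :> C by exact: expr0.
have s1 : (-1) ^+ (i0 + i1) = -1 :> C by exact: expr1.
have s2 : (-1) ^+ (i0 + i2) = 1 :> C by rewrite -[LHS]/((-1) ^+ 2) sqrrN expr1n.
by rewrite s0 s1 s2 !mul1r mulN1r mulrN.
Qed.

Variable n : nat.
Local Notation V := 'rV[R]_n.

Lemma cdiffN (h : V -> C) x : cdiff h x -> cdiff (fun y => - h y) x.
Proof.
move=> ch; apply: (@cdiff_ext _ _ (fun y => -1 * h y)) => [y|]; first by rewrite mulN1r.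
by apply: cdiffM => //; exact: cdiff_cst.
Qed.

Lemma dCN (h : V -> C) x v : cdiff h x -> dC (fun y => - h y) x v = - dC h x v.
Proof.
move=> ch; rewrite (@dC_ext _ _ _ (fun y => -1 * h y)); last by move=> y; rewrite mulN1r.
by rewrite dCM ?dC_cst ?mul0r ?add0r ?mulN1r //; exact: cdiff_cst.
Qed.

(** Jacobi's formula, on the explicit expansion of the determinant. *)
Lemma dC_det (F : V -> 'M[C]_3) (x v : V) (X : 'M[C]_3) : mxdiff F x ->
  dmx F x v = F x *m X -> dC (fun y => \det (F y)) x v = \det (F x) * \tr X.
Proof.
move=> dF E; have e j k : dC (fun y => F y j k) x v = F x j i0 * X i0 k + F x j i1 * X i1 k + F x j i2 * X i2 k.
  by rewrite -dmxE E mxE sum3.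
rewrite (@dC_ext _ _ _ (fun y =>
  F y i0 i0 * (F y i1 i1 * F y i2 i2 + - (F y i1 i2 * F y i2 i1))
  + - (F y i0 i1 * (F y i1 i0 * F y i2 i2 + - (F y i1 i2 * F y i2 i0)))
  + F y i0 i2 * (F y i1 i0 * F y i2 i1 + - (F y i1 i1 * F y i2 i0)))); last first.
  by move=> y; rewrite det3.
have c2 j k l m : cdiff (fun y => F y j k * F y l m) x by apply: cdiffM; exact: dF.
have c22 j k l m j' k' l' m' : cdiff (fun y => F y j k * F y l m + - (F y j' k' * F y l' m')) x.
  by apply: cdiffD => //; exact: cdiffN.
have c3 a b j k l m j' k' l' m' : cdiff (fun y => F y a b * (F y j k * F y l m + - (F y j' k' * F y l' m'))) x.
  by apply: cdiffM => //; exact: dF.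
have d2 j k l m : dC (fun y => F y j k * F y l m) x v
   = dC (fun y => F y j k) x v * F x l m + F x j k * dC (fun y => F y l m) x v.
  by apply: dCM; exact: dF.
have d22 j k l m j' k' l' m' : dC (fun y => F y j k * F y l m + - (F y j' k' * F y l' m')) x v
   = dC (fun y => F y j k * F y l m) x v - dC (fun y => F y j' k' * F y l' m') x v.
  by rewrite dCD ?dCN //; exact: cdiffN.
have d3 a b j k l m j' k' l' m' :
    dC (fun y => F y a b * (F y j k * F y l m + - (F y j' k' * F y l' m'))) x v
    = dC (fun y => F y a b) x v * (F x j k * F x l m - F x j' k' * F x l' m')
      + F x a b * dC (fun y => F y j k * F y l m + - (F y j' k' * F y l' m')) x v.
  by rewrite dCM //; exact: dF.
rewrite dCD //; last by apply: cdiffD => //; exact: cdiffN.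
rewrite dCD //; last exact: cdiffN.
rewrite dCN // !d3 !d22 !d2 !e det3 mxtrace3.
move: (F x i0 i0) (F x i0 i1) (F x i0 i2) (F x i1 i0) (F x i1 i1) (F x i1 i2)
      (F x i2 i0) (F x i2 i1) (F x i2 i2) => f00 f01 f02 f10 f11 f12 f20 f21 f22.
ring.
Qed.

End DetThree.

(** * Geometry of a link that carries a Legendrian frame *)

Lemma dmxB_dir {R : realType} {n p q} (f : 'rV[R]_n -> 'M[R[i]]_(p, q)) x v w :
  mxdiff f x -> dmx f x (v - w) = dmx f x v - dmx f x w.
Proof.
move=> df; have -> : v - w = 1 *: v + (-1) *: w by rewrite scale1r scaleN1r.
rewrite dmx_lin // (_ : (-1)%:C%C = -1) ?scaleN1r ?scale1r //.
by apply: complex_ext; rewrite //= oppr0.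
Qed.

Lemma herm_scalars {R : realType} (s t : R[i]) (a b a' b' : R) :
  ((a'%:C * s - b'%:C * t^*)^* * (a%:C * s - b%:C * t^*)
   + (a'%:C * t + b'%:C * s^*)^* * (a%:C * t + b%:C * s^*)
   = (a * a' + b * b')%:C * (s^* * s + t^* * t))%C.
Proof. by case: s => s1 s2; case: t => t1 t2; apply: complex_ext => /=; ring. Qed.

Lemma herm_rescale {R : realType} (r : R) (x y x' y' : R[i]) :
  ((r%:C * x)^* * (r%:C * x') + (r%:C * y)^* * (r%:C * y')
   = (r ^+ 2)%:C * (x^* * x' + y^* * y'))%C.
Proof.
by case: x => ? ?; case: y => ? ?; case: x' => ? ?; case: y' => ? ?;
  apply: complex_ext => /=; ring.
Qed.

Lemma herm00 {R : realType} (m : nat) : herm (0 : 'cV[R[i]]_m) 0 = 0.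
Proof. by rewrite /herm mulmx0 mxE. Qed.

Section LegendrianFrame.
Context {R : realType}.
Local Notation C := R[i].
Local Notation V := 'rV[R]_2.
Local Notation V3 := 'rV[R]_3.
Variables (f : V -> 'cV[C]_3) (F : V -> 'M[C]_3) (s t : V -> C).

(** The unitary matrix F carries (0, 0, 1) to f and a vector of C^2 to f_x; that
    f_y comes from its image under the quaternionic structure makes the tangent
    plane of the link a Lagrangian plane orthogonal to f and i f. *)
Definition legendrian_frame (z : V) := [/\ mxdiff f z, adj (F z) *m F z = 1%:M,
  f z = F z *m cv3 0 0 1, pdmx 0 f z = F z *m cv3 (s z) (t z) 0 &
  pdmx 1 f z = F z *m cv3 (- (t z)^*%C) ((s z)^*%C) 0].

(** By [link_herm], f pulls the round metric back to conf (dx^2 + dy^2). *)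
Definition conf (z : V) : R := complex.Re (s z) ^+ 2 + complex.Im (s z) ^+ 2
  + (complex.Re (t z) ^+ 2 + complex.Im (t z) ^+ 2).

Lemma conj_mul (x : C) : x^*%C * x = (complex.Re x ^+ 2 + complex.Im x ^+ 2)%:C%C.
Proof. by case: x => a b; apply: complex_ext => /=; ring. Qed.

Lemma conf_herm z : (s z)^*%C * s z + (t z)^*%C * t z = (conf z)%:C%C.
Proof. by rewrite !conj_mul -rmorphD. Qed.

Lemma conf_ge0 z : 0 <= conf z.
Proof. by rewrite /conf !addr_ge0 // sqr_ge0. Qed.

Lemma conf_eq0 z : conf z = 0 -> s z = 0 /\ t z = 0.
Proof.
move=> /eqP; rewrite /conf !paddr_eq0 ?addr_ge0 ?sqr_ge0 // !sqrf_eq0.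
by move=> /andP[/andP[/eqP a /eqP b] /andP[/eqP c /eqP d]]; split; apply: complex_ext.
Qed.

Lemma rdot2 (u v : V) : rdot u v = u 0 0 * v 0 0 + u 0 1 * v 0 1.
Proof.
rewrite /rdot !big_ord_recr big_ord0 /= add0r.
by congr (u _ _ * v _ _ + u _ _ * v _ _); apply/val_inj.
Qed.

Lemma rdot_eq0 (u : V) : rdot u u = 0 -> u = 0.
Proof.
rewrite rdot2 -!expr2 => /eqP; rewrite paddr_eq0 ?sqr_ge0 // !sqrf_eq0.
by move=> /andP[/eqP a /eqP b]; apply: row2P; rewrite mxE.
Qed.

Section AtAPoint.
Variable z : V.
Hypothesis H : legendrian_frame z.

Lemma link_differential (u : V) : dmx f z u = F z *m
  cv3 ((u 0 0)%:C%C * s z - (u 0 1)%:C%C * (t z)^*%C)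
      ((u 0 0)%:C%C * t z + (u 0 1)%:C%C * (s z)^*%C) 0.
Proof.
have [df _ _ f0 f1] := H; rewrite dmx2 // f0 f1 !scalemxAr -mulmxDr cv3_lin.
by rewrite mulrN !mulr0 addr0.
Qed.

(** (s, t) and (- conj t, conj s) are orthogonal of the same norm for the hermitian
    product, not only for its real part: the vanishing real part gives
    conformality, the vanishing imaginary part the Lagrangian condition. *)
Lemma link_herm (u v : V) : herm (dmx f z u) (dmx f z v) = (conf z * rdot u v)%:C%C.
Proof.
have [_ uF _ _ _] := H; rewrite !link_differential herm_unitary // herm_cv3 mulr0 addr0.
by rewrite herm_scalars conf_herm rdot2 -rmorphM mulrC.
Qed.

Lemma immersive_conf : immersive f z <-> 0 < conf z.
Proof.
have [df uF _ _ _] := H.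
split=> [inj|c0 u v E].
  rewrite lt_neqAle conf_ge0 andbT; apply/eqP => c0.
  have [s0 t0] := conf_eq0 (esym c0).
  have E u : dmx f z u = 0.
    rewrite link_differential s0 t0 conjc0 !mulr0 subrr addr0.
    by rewrite (_ : cv3 0 0 0 = 0) ?mulmx0 //; apply/colP => j; case: (I3P j) => ->; rewrite !mxE.
  have := inj (delta_mx 0 0) 0; rewrite !E => /(_ erefl) /rowP /(_ 0) /eqP.
  by rewrite !mxE oner_eq0.
have E0 : dmx f z (u - v) = 0 by rewrite dmxB_dir // E subrr.
apply/eqP; rewrite -subr_eq0; apply/eqP/rdot_eq0.
have := link_herm (u - v) (u - v); rewrite E0.
rewrite herm00 =>  /(congr1 (@complex.Re R)) /= /esym /eqP.
by rewrite mulf_eq0 (gt_eqF c0) => /eqP.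
Qed.

(** Where the conformal factor vanishes, so do s and t, hence df. *)
Lemma link_weakly_conformal : weakly_conformal f z.
Proof.
have [c0|c0] := ltP 0 (conf z).
  right; split; first exact/immersive_conf.
  by exists (conf z) => // v w; rewrite cdot_herm link_herm.
left=> v; have cz : conf z = 0 by apply: le_anti; rewrite c0 conf_ge0.
have [s0 t0] := conf_eq0 cz; rewrite link_differential s0 t0 conjc0 !mulr0 subrr addr0.
by rewrite (_ : cv3 0 0 0 = 0) ?mulmx0 //; apply/colP => j; case: (I3P j) => ->; rewrite !mxE.
Qed.

Variable p : V3.
Hypothesis pz : base_pt p = z.

Lemma cone_differential (v : V3) : dmx (cone_map f) p v = F z *m
  cv3 ((p 0 i2)%:C%C * ((v 0 i0)%:C%C * s z - (v 0 i1)%:C%C * (t z)^*%C))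
      ((p 0 i2)%:C%C * ((v 0 i0)%:C%C * t z + (v 0 i1)%:C%C * (s z)^*%C)) ((v 0 i2)%:C%C).
Proof.
have [df _ fz _ _] := H; rewrite -pz in df.
have [_ ->] := cone_map_diff v df; rewrite pz fz link_differential base_ptE pt_x pt_y ord_max2.
by rewrite !scalemxAr -mulmxDr cv3_lin !mulr0 !add0r mulr1 addr0.
Qed.

Lemma cone_herm (v w : V3) : herm (dmx (cone_map f) p v) (dmx (cone_map f) p w) =
  (p 0 i2 ^+ 2 * conf z * (v 0 i0 * w 0 i0 + v 0 i1 * w 0 i1) + v 0 i2 * w 0 i2)%:C%C.
Proof.
have [_ uF _ _ _] := H; rewrite !cone_differential herm_unitary // herm_cv3.
rewrite herm_rescale herm_scalars conf_herm conjc_real -!rmorphM -rmorphD.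
by congr (_%:C)%C; ring.
Qed.

Lemma cone_immersive : 0 < p 0 i2 -> 0 < conf z -> immersive (cone_map f) p.
Proof.
move=> p0 c0 u v E.
have k0 : 0 < p 0 i2 ^+ 2 * conf z := mulr_gt0 (exprn_gt0 2 p0) c0.
have [df _ _ _ _] := H; rewrite -pz in df.
have [dc _] := cone_map_diff 0 df.
have E0 : dmx (cone_map f) p (u - v) = 0 by rewrite (dmxB_dir u v dc) E subrr.
apply/eqP; rewrite -subr_eq0; apply/eqP; move: (u - v) E0 => w E0.
have := cone_herm w w; rewrite E0.
rewrite herm00.
move=> /(congr1 (@complex.Re R)) /= /esym /eqP; rewrite -!expr2.
rewrite paddr_eq0; [|exact: mulr_ge0 (ltW k0) (addr_ge0 (sqr_ge0 _) (sqr_ge0 _))|exact: sqr_ge0].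
rewrite mulf_eq0 (gt_eqF k0) /= paddr_eq0; [|exact: sqr_ge0|exact: sqr_ge0]; rewrite !sqrf_eq0.
move=> /andP[/andP[/eqP a /eqP b] /eqP c].
by apply/rowP => j; case: (I3P j) => ->; rewrite mxE.
Qed.

Lemma cone_lagrangian (v w : V3) :
  omega (dmx (cone_map f) p v) (dmx (cone_map f) p w) = 0.
Proof. by rewrite omega_herm cone_herm. Qed.

(** The columns of P are the rescaled coordinate vectors.  Their images form F M
    with M in SU(2) extended by 1, so the phase of the tangent space is det F. *)
Lemma cone_angle (b : R) : 0 < p 0 i2 -> 0 < conf z ->
  \det (F z) = (cos b +i* sin b)%C -> lagrangian_angle (cone_map f) p b.
Proof.
move=> p0 c0 dF; set r := p 0 i2 in p0.
have q0 : 0 < Num.sqrt (conf z) by rewrite sqrtr_gt0.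
pose k := (r * Num.sqrt (conf z))^-1.
have k0 : 0 < k by rewrite invr_gt0 mulr_gt0.
have k2 : r ^+ 2 * conf z * k ^+ 2 = 1.
  rewrite /k exprVn exprMn sqr_sqrtr ?conf_ge0 // divff // mulf_neq0 ?expf_neq0 ?gt_eqF //.
pose P : 'M[R]_3 := diag_mx (\row_j [:: k; k; 1]`_j).
pose E : 'M[C]_3 := \matrix_(i, j) dmx (cone_map f) p (row j P) i 0.
have Ecol j : col j E = dmx (cone_map f) p (row j P).
  by apply/colP => i; rewrite !mxE.
have rP : ((row i0 P 0 i0 = k) * (row i0 P 0 i1 = 0) * (row i0 P 0 i2 = 0) *
  (row i1 P 0 i0 = 0) * (row i1 P 0 i1 = k) * (row i1 P 0 i2 = 0) *
  (row i2 P 0 i0 = 0) * (row i2 P 0 i1 = 0) * (row i2 P 0 i2 = 1))%type.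
  by do !split; rewrite !mxE.
exists E; first split.
- exists P => //; rewrite det_diag !big_ord_recr big_ord0 /= !mxE /= mul1r mulr1.
  by rewrite mulr_gt0.
- move=> j l; rewrite !Ecol cdot_herm cone_herm Re_real -/r.
  case: (I3P j) => ->; case: (I3P l) => ->; rewrite !rP ?(mulr0, mul0r, addr0, add0r, mulr1) -?expr2 ?k2 //.
pose M : 'M[C]_3 := mx3 [:: [:: (r * k)%:C%C * s z; (r * k)%:C%C * - (t z)^*%C; 0];
                            [:: (r * k)%:C%C * t z; (r * k)%:C%C * (s z)^*%C; 0];
                            [:: 0; 0; 1]].
have EM : E = F z *m M.
  apply/matrixP => i j; rewrite mxE cone_differential -/r.
  rewrite [LHS]mxE [RHS]mxE; apply: eq_bigr => l _; congr (_ * _).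
  case: (I3P j) => ->; rewrite !rP; case: (I3P l) => ->; rewrite cv3E mx3E ?rmorphM ?rmorph0 ?rmorph1 /=; ring.
rewrite EM det_mulmx dF det3 !mx3E.
suff -> : (r * k)%:C%C * s z * ((r * k)%:C%C * (s z)^*%C * 1 - 0 * 0)
   - (r * k)%:C%C * - (t z)^*%C * ((r * k)%:C%C * t z * 1 - 0 * 0) +
   0 * ((r * k)%:C%C * t z * 0 - (r * k)%:C%C * (s z)^*%C * 0) = 1 :> C by rewrite mulr1.
transitivity ((r * k)%:C%C ^+ 2 * ((s z)^*%C * s z + (t z)^*%C * t z)); first by ring.
rewrite conf_herm -rmorphXn -rmorphM /= (_ : _ * _ = 1) //.
by rewrite -k2; ring.
Qed.

Lemma cone_metric : metric (cone_map f) p =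
  diag_mx (\row_j [:: p 0 i2 ^+ 2 * conf z; p 0 i2 ^+ 2 * conf z; 1]`_j).
Proof.
apply/matrixP => j l; rewrite mxE cdot_herm /pdmx cone_herm Re_real !mxE.
case: (I3P j) => ->; case: (I3P l) => ->; rewrite /= ?(mulr0, mul0r, addr0, add0r, mulr1) //.
Qed.

End AtAPoint.

(** In the coordinates (x, y, r) the cone metric is r^2 conf (dx^2 + dy^2) + dr^2,
    with density r^2 conf.  In the flux of a function of (x, y) the density cancels
    the inverse metric, so the flat Laplacian remains. *)
Lemma cone_laplace (W : set V) (b : V -> R) (p : V3) : open W ->
  (forall z, W z -> legendrian_frame z) -> (forall z, W z -> 0 < conf z) -> Ck 2 W b ->
  W (base_pt p) -> 0 < p 0 i2 ->
  'D_(delta_mx 0 0) ('D_(delta_mx 0 0) b) (base_pt p)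
    + 'D_(delta_mx 0 1) ('D_(delta_mx 0 1) b) (base_pt p) = 0 ->
  laplace_beltrami (cone_map f) (fun q => b (base_pt q)) p = 0.
Proof.
move=> oW HW cW [db Db] Wp p0 Lap.
pose W3 := cone_domain W; have oW3 : open W3 by exact: open_cone_domain.
pose k (q : V3) := q 0 i2 ^+ 2 * conf (base_pt q).
have rhoE q : W3 q -> Num.sqrt (\det (metric (cone_map f) q)) = k q.
  move=> [Wq q0]; rewrite ord_max2 in q0.
  rewrite (cone_metric (HW _ Wq) erefl) det_diag !big_ord_recr big_ord0 /= !mxE /= mul1r mulr1.
  by rewrite -expr2 sqrtr_sqr ger0_norm // mulr_ge0 ?sqr_ge0 ?conf_ge0.
have flux i q : W3 q ->
    Num.sqrt (\det (metric (cone_map f) q)) *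
      \sum_j invmx (metric (cone_map f) q) i j * 'D_(delta_mx 0 j) (fun q => b (base_pt q)) q
    = 'D_(base_pt (delta_mx 0 i)) b (base_pt q).
  move=> Hq; have [Wq q0] := Hq; rewrite ord_max2 in q0; rewrite rhoE //.
  have kq : 0 < k q by rewrite mulr_gt0 ?exprn_gt0 ?cW.
  have -> : invmx (metric (cone_map f) q) = diag_mx (\row_j [:: (k q)^-1; (k q)^-1; 1]`_j).
    set N := RHS; have MN : metric (cone_map f) q *m N = 1%:M.
      rewrite (cone_metric (HW _ Wq) erefl) mulmx_diag; apply/matrixP => j l.
      rewrite !mxE -!/(k q); congr (_ *+ _).
      by case: (I3P j) => -> /=; rewrite ?divff ?gt_eqF ?mulr1.
    have [uM _] := mulmx1_unit MN.
    by rewrite -[LHS]mulmx1 -MN mulmxA mulVmx ?mul1mx.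
  have D j : 'D_(delta_mx 0 j) (fun q => b (base_pt q)) q = 'D_(base_pt (delta_mx 0 j)) b (base_pt q).
    by have [_ ->] := base_pt_comp (delta_mx 0 j) (db _ Wq).
  rewrite (bigD1 i) //= big1 ?addr0 => [|j ji]; last first.
    by rewrite !mxE eq_sym (negPf ji) mul0r.
  rewrite D mxE eqxx mulr1n mxE.
  case: (I3P i) => -> /=; rewrite ?mulrA ?divff ?gt_eqF ?mul1r //.
  by rewrite base_delta derive0 mulr0.
have Hp : W3 p by split=> //; rewrite ord_max2.
have E i : 'D_(delta_mx 0 i) (fun q => Num.sqrt (\det (metric (cone_map f) q)) *
      \sum_j invmx (metric (cone_map f) q) i j * 'D_(delta_mx 0 j) (fun q => b (base_pt q)) q) p
   = 'D_(delta_mx 0 i) (fun q => 'D_(base_pt (delta_mx 0 i)) b (base_pt q)) p.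
  by apply: near_eq_derive; apply: (near_on_open oW3) Hp => q; exact: flux.
rewrite /laplace_beltrami; apply/eqP; rewrite mulf_eq0; apply/orP; right; apply/eqP.
rewrite sum3 !E !base_delta.
have [dd0 _] := Db 0; have [dd1 _] := Db 1.
have T0 := (base_pt_comp (delta_mx 0 i0) (dd0 _ Wp)).2.
have T1 := (base_pt_comp (delta_mx 0 i1) (dd1 _ Wp)).2.
have T2 : 'D_(delta_mx 0 i2) (fun q : V3 => 'D_0 b (base_pt q)) p = 0.
  rewrite (@derive_ext _ _ _ (fun=> 0)) => [|q]; [exact: derive_cst|exact: derive0].
rewrite base_delta in T0; rewrite base_delta in T1.
by rewrite [X in _ + X]T2 addr0 [X in X + _]T0 [X in _ + X]T1.
Qed.

End LegendrianFrame.

(** * Lifting a unit complex function to an angle *)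

Section Angles.
Context {R : realType}.
Local Notation C := R[i].

Lemma unit_angle (x y : R) : x ^+ 2 + y ^+ 2 = 1 -> exists b, x = cos b /\ y = sin b.
Proof.
move=> H; have x1 : -1 <= x <= 1.
  by rewrite -ler_norml -(@ler_pXn2r _ 2) ?nnegrE // expr1n real_normK ?num_real // -H lerDl sqr_ge0.
have sy : Num.sqrt (1 - x ^+ 2) = `|y| by rewrite -H addrAC subrr add0r sqrtr_sqr.
have [y0|y0] := lerP 0 y.
  exists (acos x); rewrite acosK; last by rewrite in_itv.
  by rewrite sin_acos // sy ger0_norm.
exists (- acos x); rewrite cosN acosK; last by rewrite in_itv.
by rewrite sinN sin_acos // sy ltr0_norm // opprK.
Qed.

Lemma unit_atan (P Q : R) : 0 < P -> P ^+ 2 + Q ^+ 2 = 1 ->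
  cos (atan (Q / P)) = P /\ sin (atan (Q / P)) = Q.
Proof.
move=> P0 H; have c : cos (atan (Q / P)) = P.
  rewrite cos_atan -[RHS]invrK; congr (_^-1).
  have -> : 1 + (Q / P) ^+ 2 = P^-1 ^+ 2.
    by rewrite exprMn -[1](@divff _ (P ^+ 2)) ?sqrf_eq0 ?gt_eqF // exprVn -mulrDl H mul1r.
  by rewrite sqrtr_sqr ger0_norm // invr_ge0 ltW.
split=> //; have := atanK (Q / P); rewrite /tan c => /(congr1 ( *%R^~ P)).
by rewrite !divfK // gt_eqF.
Qed.

Context {n : nat}.
Local Notation V := 'rV[R]_n.

Lemma open_positive (L : set V) (g : V -> R) : open L ->
  (forall z, L z -> {for z, continuous g}) -> open [set z | L z /\ 0 < g z].
Proof.
move=> oL cg; rewrite openE => z [Lz gz].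
have nL : nbhs z L by exact: open_nbhs_nbhs.
have ng : nbhs z (g @^-1` [set x | 0 < x]) by apply: cg => //; apply: open_nbhs_nbhs; split => //; exact: open_gt.
by apply: filterS (filterI nL ng) => w [].
Qed.

(** After dividing by its value at z0 the function has positive real part near z0,
    where the arctangent of the slope is a smooth argument. *)
Lemma angle_lift (L : set V) (h : V -> C) z0 : open L -> (forall k, CkC k L h) ->
  (forall z, L z -> complex.Re (h z) ^+ 2 + complex.Im (h z) ^+ 2 = 1) -> L z0 ->
  exists W, exists b : V -> R, [/\ open W, W z0, W `<=` L, smooth W b &
    forall z, W z -> h z = (cos (b z) +i* sin (b z))%C].
Proof.
move=> oL Ch uh L0; have [b0 [e1 e2]] := unit_angle (uh z0 L0).
pose P z := complex.Re (h z) * cos b0 + complex.Im (h z) * sin b0.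
pose Q z := complex.Im (h z) * cos b0 - complex.Re (h z) * sin b0.
have CP k : Ck k L P.
  by have [C1 C2] := Ch k; apply: (CkD _ _ oL); apply: (CkM _ _ oL) => //; exact: Ck_cst.
have CQ k : Ck k L Q.
  have [C1 C2] := Ch k; apply: (CkD _ _ oL); first by apply: (CkM _ _ oL) => //; exact: Ck_cst.
  by apply: (CkN _ oL); apply: (CkM _ _ oL) => //; exact: Ck_cst.
pose W := [set z | L z /\ 0 < P z].
have oW : open W by apply: open_positive => // z Lz; exact: (CP 0%N).
have WL : W `<=` L by move=> z [].
have cs := cos2Dsin2 b0.
have PQ z : L z -> P z ^+ 2 + Q z ^+ 2 = 1.
  move=> Lz; rewrite -[1]mulr1 -{1}(uh z Lz) -{1}cs /P /Q; ring.
exists W, (fun z => b0 + atan (Q z * (P z)^-1)); split => //.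
- by split => //; rewrite /P e1 e2 -!expr2 cs.
- move=> k; apply: (CkD _ _ oW); first exact: Ck_cst.
  apply: Ck_atan => //; apply: (CkM _ _ oW); first exact: Ck_subset WL (CQ k).
  by apply: Ck_inv => // [z [_ P0]|]; [rewrite gt_eqF|exact: Ck_subset WL (CP k)].
move=> z [Lz P0]; have [c s] := unit_atan P0 (PQ z Lz).
rewrite cosD sinD c s; apply: complex_ext; rewrite /P /Q /=.
  by rewrite -[LHS]mulr1 -cs; ring.
by rewrite -[LHS]mulr1 -cs; ring.
Qed.

(** With h = exp(i b) one has dh = i h db, to be compared with dh = h m. *)
Lemma angle_derivative (W : set V) (h : V -> C) (b : V -> R) z v (m : C) : open W ->
  (forall w, W w -> h w = (cos (b w) +i* sin (b w))%C) -> W z -> differentiable b z ->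
  dC h z v = h z * m -> 'D_v b z = complex.Im m.
Proof.
move=> oW hb Wz db.
rewrite (dC_near v (near_on_open oW hb Wz)) hb // /dC /=.
have [_ ->] := is_derive_comp1 v (is_derive_cos (b z)) db.
have [_ ->] := is_derive_comp1 v (is_derive_sin (b z)) db.
move: ('D_v b z) (b z) => D t; case: m => m1 m2 [E1 E2] /=.
rewrite -[LHS]mul1r -[RHS]mul1r -(cos2Dsin2 t).
transitivity (cos t * (cos t * D) - sin t * (- sin t * D)); first by ring.
by rewrite E1 E2; ring.
Qed.

End Angles.

Section Traces.
Context {R : realType} {n : nat}.
Local Notation C := R[i].
Local Notation V := 'rV[R]_n.

Lemma dC_trace (X : V -> 'M[C]_3) x v : mxdiff X x ->
  dC (fun y => \tr (X y)) x v = \tr (dmx X x v).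
Proof.
move=> dX; rewrite /mxtrace dC_sum => [|i]; last exact: dX.
by apply: eq_bigr => i _; rewrite dmxE.
Qed.

Lemma CkC_det k (U : set V) (X : V -> 'M[C]_3) : open U -> Ckmx k U X ->
  CkC k U (fun y => \det (X y)).
Proof.
move=> oU CX; apply: (CkC_ext oU (fun y _ => esym (det3 (X y)))).
by do ![apply: CkCD => //|apply: CkCM => //|apply: CkCN => //].
Qed.

Lemma mxdiff_tau_comp_2 (X : V -> 'M[C]_3) x : mxdiff X x ->
  mxdiff (fun y => tau_comp 2 (X y)) x.
Proof.
move=> dX j k.
have h0 : cdiff (fun y => 2^-1 * (X y i0 i0 + X y i1 i1)) x.
  by apply: cdiffM; [exact: cdiff_cst|apply: cdiffD].
have E y := tau_comp_2 (X y).
case: (I3P j) => ->; case: (I3P k) => ->;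
  first [ apply: (cdiff_ext _ h0) => y; by rewrite E mx3E
        | apply: (cdiff_ext _ (dX i2 i2)) => y; by rewrite E mx3E
        | apply: (cdiff_ext _ (cdiff_cst 0 x)) => y; by rewrite E mx3E ].
Qed.

End Traces.

(** * From an integrated form to a link *)

Section IntegratedForms.
Context {R : realType}.
Local Notation C := R[i].
Local Notation V := 'rV[R]_2.

Lemma schwarz_mx {p q} (U : set V) (X : V -> 'M[C]_(p, q)) z : open U -> Ckmx 2 U X -> U z ->
  pdmx 0 (pdmx 1 X) z = pdmx 1 (pdmx 0 X) z.
Proof.
move=> oU CX Uz; apply/matrixP => j k; have [C1 C2] := CX j k.
apply: (etrans (dmxE _ _ _ _ _)); apply: (etrans _ (esym (dmxE _ _ _ _ _))).
have E (g : V -> R) (a b : 'I_2) (h : V -> R) : (forall y, h y = 'D_(delta_mx 0 b) g y) ->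
    'D_(delta_mx 0 a) h z = 'D_(delta_mx 0 a) ('D_(delta_mx 0 b) g) z.
  by move=> /funext ->.
apply: complex_ext; rewrite /dC [LHS]/= [RHS]/=.
  rewrite (E (fun y => complex.Re (X y j k)) 0 1) => [|y]; last by rewrite mxE.
  rewrite (E (fun y => complex.Re (X y j k)) 1 0) => [|y]; last by rewrite mxE.
  exact: schwarz oU C1 Uz.
rewrite (E (fun y => complex.Im (X y j k)) 0 1) => [|y]; last by rewrite mxE.
rewrite (E (fun y => complex.Im (X y j k)) 1 0) => [|y]; last by rewrite mxE.
exact: schwarz oU C2 Uz.
Qed.

Lemma eps3E : eps3 = cv3 0 0 1 :> 'cV[C]_3.
Proof. by apply/colP => j; case: (I3P j) => ->; rewrite !mxE. Qed.

Lemma mul_eps3 (X : 'M[C]_3) : X *m eps3 = cv3 (X i0 i2) (X i1 i2) (X i2 i2).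
Proof.
by rewrite /eps3 -colE ord_max2; apply/colP => j; case: (I3P j) => ->; rewrite !mxE.
Qed.

Lemma adj_unitary (X : 'M[C]_3) : X \is unitarymx -> adj X *m X = 1%:M.
Proof. by move=> /unitarymx_adj /mulmx1C. Qed.

(** The third columns of the two coefficients of the form are the coordinates of
    f_x and f_y in the frame F, and [m_conditionP] describes them. *)
Lemma frame_of_form (L : set V) (a : form1 (R := R)) F f : open L -> u3_form L a ->
  m_condition L a -> U3_map L F -> integrates L a F ->
  (forall z, L z -> last_column F z = f z) -> forall z, L z ->
  legendrian_frame f F (fun z => (a z).1 i0 i2) (fun z => (a z).1 i1 i2) z.
Proof.
move=> oL [s1 s2 ua] ma [sF uF] iF Ff z Lz.
have [u1 u2] := ua z Lz.
have [x22 y22 y02 y12] := (m_conditionP u1 u2).1 (ma z Lz).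
have [F0 F1] := iF z Lz.
have dF : mxdiff F z by apply: Ckmx_mxdiff Lz; exact: ((smooth_mxP L F).1 sF 1%N).
have nf : \near z, last_column F z = f z by apply: near_on_open Ff Lz.
have dl : mxdiff (last_column F) z by apply: mxdiffM => //; exact: mxdiff_cst.
have pl k : pdmx k (last_column F) z = pdmx k F z *m eps3.
  by rewrite /pdmx dmxM // ?dmx_cst ?mulmx0 ?addr0 //; exact: mxdiff_cst.
split.
- exact: mxdiff_near nf dl.
- by apply: adj_unitary; exact: uF.
- by rewrite -Ff // -eps3E.
- by rewrite /pdmx -(dmx_near _ nf) -/(pdmx 0 (last_column F) z) pl F0 -mulmxA mul_eps3 x22.
- by rewrite /pdmx -(dmx_near _ nf) -/(pdmx 1 (last_column F) z) pl F1 -mulmxA mul_eps3 y22 y02 y12.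
Qed.

Lemma unit_cdot (X : 'M[C]_3) : adj X *m X = 1%:M -> cdot (X *m eps3) (X *m eps3) = 1.
Proof.
move=> uX; rewrite cdot_herm herm_unitary // eps3E herm_cv3 !mulr0 !add0r mulr1.
by rewrite conjc1.
Qed.

Lemma immersion_locus_conf (L : set V) f F (s t : V -> C) :
  (forall z, L z -> legendrian_frame f F s t z) ->
  immersion_locus L f = [set z | L z /\ 0 < conf s t z].
Proof.
move=> H; apply/seteqP; split=> z [Lz h]; split=> //; exact/(immersive_conf (H z Lz)).
Qed.

Lemma open_immersion_locus (L : set V) f F (s t : V -> C) : open L ->
  (forall z, L z -> legendrian_frame f F s t z) -> CkC 0 L s -> CkC 0 L t ->
  open (immersion_locus L f).
Proof.
move=> oL H [s1 s2] [t1 t2]; rewrite (immersion_locus_conf H).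
apply: open_positive => // z Lz.
by apply: (@CkS_continuous _ _ 0%N L) => //; do ![apply: (CkD _ _ oL)|apply: (CkM _ _ oL)].
Qed.

Lemma link_of_integral (L : set V) (a : form1 (R := R)) F : open L ->
  u3_form L a -> m_condition L a -> U3_map L F -> integrates L a F ->
  let f := last_column F in
  [/\ maps_to_sphere L f, forall z, L z -> weakly_conformal f z &
      parametrizes_lagrangian_link (immersion_locus L f) f].
Proof.
move=> oL ua ma UF iF f; have [sF uF] := UF.
have H := frame_of_form oL ua ma UF iF (fun z _ => erefl (last_column F z)).
have sf : smooth_mx L f.
  by apply/smooth_mxP => k; apply: CkmxM => //; [exact: ((smooth_mxP L F).1 sF)|exact: Ckmx_cst].
have c1 z : L z -> cdot (f z) (f z) = 1 by move=> Lz; apply: unit_cdot; apply: adj_unitary; exact: uF.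
have sub : immersion_locus L f `<=` L by move=> z [].
split; first by [].
  by move=> z Lz; exact: link_weakly_conformal (H z Lz).
split; first split.
- by apply/smooth_mxP => k; apply: Ckmx_subset sub _; exact: ((smooth_mxP L f).1 sf).
- by move=> z [Lz _]; exact: c1.
split.
  apply/smooth_mxP => k; apply: (@Ckmx_subset _ _ _ _ _ (cone_domain L)).
    by move=> p [[Lp _] p0].
  by apply: (smooth_mxP _ _).1; exact: cone_map_smooth.
move=> p [[Lp ip] p0]; rewrite ord_max2 in p0; split.
  by apply: (cone_immersive (H _ Lp) erefl p0); exact/(immersive_conf (H _ Lp)).
by move=> v w; exact: (cone_lagrangian (H _ Lp) erefl).
Qed.

End IntegratedForms.

(** * The Lagrangian angle as the phase of the determinant *)

Section LagrangianAngle.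
Context {R : realType}.
Local Notation C := R[i].
Local Notation V := 'rV[R]_2.

Lemma det_modulus (X : 'M[C]_3) : adj X *m X = 1%:M ->
  complex.Re (\det X) ^+ 2 + complex.Im (\det X) ^+ 2 = 1.
Proof.
move=> /(congr1 determinant); rewrite det_mulmx det1 /adj det_tr det_map_mx.
by rewrite conj_mul => /(congr1 (@complex.Re R)).
Qed.

Lemma coclosed_trace (a : form1 (R := R)) z :
  mxdiff (fun w => (a w).1) z -> mxdiff (fun w => (a w).2) z ->
  ext_d (fun w => hodge (form_comp 2 a w)) z = 0 ->
  dC (fun w => \tr (a w).1) z (delta_mx 0 0) + dC (fun w => \tr (a w).2) z (delta_mx 0 1) = 0.
Proof.
move=> d1 d2 E0.
have E : pdmx 0 (fun w => tau_comp 2 (a w).1) z - pdmx 1 (fun w => - tau_comp 2 (a w).2) z = 0 := E0.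
have t1 := mxdiff_tau_comp_2 d1; have t2 := mxdiff_tau_comp_2 d2.
have tr k (Y : V -> 'M[C]_3) : mxdiff (fun w => tau_comp 2 (Y w)) z ->
    dC (fun w => \tr (Y w)) z (delta_mx 0 k) = \tr (pdmx k (fun w => tau_comp 2 (Y w)) z).
  move=> dY; rewrite /pdmx -dC_trace //; apply: dC_ext => w.
  by rewrite trace_tau_comp_2.
have N : pdmx 1 (fun w => - tau_comp 2 (a w).2) z = - pdmx 1 (fun w => tau_comp 2 (a w).2) z.
  apply/matrixP => j k; apply: (etrans (dmxE _ _ _ _ _)); rewrite [RHS]mxE.
  apply: (etrans _ (congr1 -%R (esym (dmxE _ _ _ _ _)))).
  rewrite -dCN; last exact: t2.
  by apply: dC_ext => w; rewrite mxE.
rewrite (tr 0 _ t1) (tr 1 _ t2) -mxtraceD.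
rewrite N opprK in E.
exact: (etrans (congr1 _ E) (mxtrace0 _ _)).
Qed.

(** The angle is a local argument of det F, hence pulled back from the plane, and
    its partial derivatives are the imaginary parts of the traces of the
    coefficients of the form.  Its Laplacian is the divergence of these, that is
    the trace of the exterior derivative of the Hodge dual of the degree 2 part. *)
Lemma stationary_of_coclosed (L : set V) (a : form1 (R := R)) F f : open L ->
  u3_form L a -> m_condition L a -> U3_map L F -> integrates L a F ->
  (forall z, L z -> last_column F z = f z) -> coclosed L (form_comp 2 a) ->
  hamiltonian_stationary_cone (immersion_locus L f) f.
Proof.
move=> oL ua ma UF iF Ff co; have [sF uF] := UF; have [s1 s2 _] := ua.
have H := frame_of_form oL ua ma UF iF Ff.
set s := (fun z => (a z).1 i0 i2) in H; set t := (fun z => (a z).1 i1 i2) in H.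
have S1 := (smooth_mxP _ _).1 s1; have S2 := (smooth_mxP _ _).1 s2.
have SF := (smooth_mxP _ _).1 sF.
have oI : open (immersion_locus L f) := open_immersion_locus oL H (S1 0%N i0 i2) (S1 0%N i1 i2).
have mod1 z : L z -> complex.Re (\det (F z)) ^+ 2 + complex.Im (\det (F z)) ^+ 2 = 1.
  by move=> Lz; apply/det_modulus/adj_unitary/uF.
move=> p [Ip p0].
have [W0 [b [oW0 W0p W0L sb bE]]] := angle_lift oL (fun k => CkC_det oL (SF k)) mod1 Ip.1.
pose W := W0 `&` immersion_locus L f.
have oW : open W by exact: openI.
have WL : W `<=` L by move=> z [_ []].
have sbW : smooth W b by move=> k; apply: Ck_subset (sb k) => z [].
have HW z : W z -> legendrian_frame f F s t z by move=> /WL; exact: H.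
have cW z : W z -> 0 < conf s t z by move=> Wz; apply/(immersive_conf (HW z Wz)); case: Wz => _ [].
have d1 z : L z -> mxdiff (fun z => (a z).1) z by move=> Lz; exact: Ckmx_mxdiff (S1 1%N) Lz.
have d2 z : L z -> mxdiff (fun z => (a z).2) z by move=> Lz; exact: Ckmx_mxdiff (S2 1%N) Lz.
have dF z : L z -> mxdiff F z by move=> Lz; exact: Ckmx_mxdiff (SF 1%N) Lz.
have Db z : W z -> 'D_(delta_mx 0 0) b z = complex.Im (\tr (a z).1) /\
    'D_(delta_mx 0 1) b z = complex.Im (\tr (a z).2).
  move=> Wz; have Lz := WL _ Wz; have [F0 F1] := iF z Lz.
  have db : differentiable b z := (sbW 1%N).1 z Wz.
  have bEW w : W w -> \det (F w) = (cos (b w) +i* sin (b w))%C by move=> [W0w _]; exact: bE.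
  by split; apply: (angle_derivative oW bEW Wz db); exact: dC_det (dF z Lz) _.
have Lap z : W z -> 'D_(delta_mx 0 0) ('D_(delta_mx 0 0) b) z
    + 'D_(delta_mx 0 1) ('D_(delta_mx 0 1) b) z = 0.
  move=> Wz; have Lz := WL _ Wz.
  have n0 : \near z, 'D_(delta_mx 0 0) b z = complex.Im (\tr (a z).1).
    by apply: near_on_open oW _ Wz => w Ww; case: (Db w Ww).
  have n1 : \near z, 'D_(delta_mx 0 1) b z = complex.Im (\tr (a z).2).
    by apply: near_on_open oW _ Wz => w Ww; case: (Db w Ww).
  have E0 : 'D_(delta_mx 0 0) ('D_(delta_mx 0 0) b) z
      = complex.Im (dC (fun w => \tr (a w).1) z (delta_mx 0 0)) by exact: near_eq_derive n0.
  have E1 : 'D_(delta_mx 0 1) ('D_(delta_mx 0 1) b) z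
      = complex.Im (dC (fun w => \tr (a w).2) z (delta_mx 0 1)) by exact: near_eq_derive n1.
  by rewrite E0 E1 -cImD (coclosed_trace (d1 z Lz) (d2 z Lz) (co z Lz)).
exists (cone_domain W), (fun q => b (base_pt q)); split.
- exact: open_cone_domain.
- by split.
- by move=> q [[_ Iq] q0].
- move=> k; apply: (@Ck_subset _ _ _ (@base_pt R @^-1` W)); first by move=> q [].
  exact: Ck_base.
move=> q [Wq q0]; split; last first.
  by apply: (cone_laplace oW HW cW (sbW 2%N) Wq _ (Lap _ Wq)); rewrite -ord_max2.
apply: (cone_angle (HW _ Wq) erefl); first by rewrite -ord_max2.
  exact: cW.
by apply: bE; case: Wq.
Qed.

(** By Jacobi's formula det F is constant once the form is traceless. *)
Lemma special_of_vanishing (L : set V) (a : form1 (R := R)) F f z0 : open L -> connected L -> L z0 ->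
  u3_form L a -> m_condition L a -> U3_map L F -> integrates L a F ->
  (forall z, L z -> last_column F z = f z) -> vanishes L (form_comp 2 a) ->
  special_lagrangian_cone (immersion_locus L f) f.
Proof.
move=> oL cL L0 ua ma UF iF Ff va; have [sF uF] := UF.
have H := frame_of_form oL ua ma UF iF Ff.
have SF := (smooth_mxP _ _).1 sF.
have dF z : L z -> mxdiff F z by move=> Lz; exact: Ckmx_mxdiff (SF 1%N) Lz.
have [b [e1 e2]] := unit_angle (det_modulus (adj_unitary (uF z0 L0))).
have tr0 z : L z -> \tr (a z).1 = 0 /\ \tr (a z).2 = 0.
  move=> Lz; have := va z Lz; rewrite /form_comp /cov_map => E.
  have E1 : tau_comp 2 (a z).1 = 0 := congr1 fst E.
  have E2 : tau_comp 2 (a z).2 = 0 := congr1 snd E.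
  split; first exact: (etrans (esym (trace_tau_comp_2 _)) (etrans (congr1 _ E1) (mxtrace0 _ _))).
  exact: (etrans (esym (trace_tau_comp_2 _)) (etrans (congr1 _ E2) (mxtrace0 _ _))).
have const z : L z -> \det (F z) = \det (F z0).
  move=> Lz; suff : (\det (F z))%:M = (\det (F z0))%:M :> 'M[C]_1.
    by move=> /(congr1 (fun X : 'M[C]_1 => X 0 0)); rewrite !mxE.
  apply: (@constant_mx _ _ _ L (fun z => (\det (F z))%:M)) => // {z Lz} z => [Lz|k Lz].
    have [C1 C2] := CkC_det oL (SF 1%N); have cd : cdiff (fun z => \det (F z)) z := CkC_cdiff (conj C1 C2) Lz.
    move=> i j; apply: (cdiff_ext _ cd) => y; by rewrite !ord1 mxE.
  have [F0 F1] := iF z Lz; have [t0 t1] := tr0 z Lz.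
  apply/matrixP => i j; rewrite !ord1 [RHS]mxE.
  apply: (etrans (dmxE _ _ _ _ _)).
  rewrite (@dC_ext _ _ _ (fun y => \det (F y))); last by move=> y; rewrite mxE.
  case: (I2P k) => ->; first by rewrite (dC_det (dF z Lz) F0) t0 mulr0.
  by rewrite (dC_det (dF z Lz) F1) t1 mulr0.
exists b => p [[Lp ip] p0]; rewrite ord_max2 in p0.
apply: (cone_angle (H _ Lp) erefl p0); first exact/(immersive_conf (H _ Lp)).
by rewrite const //; apply: complex_ext.
Qed.

End LagrangianAngle.

(** * The Maurer-Cartan form of the frame of a link *)

Section UnitaryFrame.
Context {R : realType}.
Local Notation C := R[i].
Local Notation V := 'rV[R]_2.
Variables (L : set V) (F : V -> 'M[C]_3).
Hypotheses (oL : open L) (CF : forall k, Ckmx k L F)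
  (uF : forall z, L z -> adj (F z) *m F z = 1%:M).

Let dF z : L z -> mxdiff F z := fun Lz => Ckmx_mxdiff (CF 1%N) Lz.

Lemma mc_adj z : L z ->
  ((maurer_cartan F z).1 = adj (F z) *m pdmx 0 F z) *
  ((maurer_cartan F z).2 = adj (F z) *m pdmx 1 F z).
Proof.
move=> Lz; rewrite /maurer_cartan.
suff -> : invmx (F z) = adj (F z) by [].
have [_ vF] := mulmx1_unit (uF Lz).
by rewrite -[LHS]mul1mx -(uF Lz) -mulmxA mulmxV ?mulmx1.
Qed.

Lemma mc_skew k z : L z -> adj (pdmx k F z) *m F z = - (adj (F z) *m pdmx k F z).
Proof.
move=> Lz; apply/eqP; rewrite -addr_eq0; apply/eqP.
have n1 : \near z, adj (F z) *m F z = 1%:M by apply: near_on_open oL _ Lz => w; exact: uF.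
have := dmx_near (delta_mx 0 k) n1; rewrite dmx_cst dmxM; [|exact/mxdiff_adj/dF|exact: dF].
by rewrite dmx_adj //; exact: dF.
Qed.

Lemma mc_u3 : u3_form L (maurer_cartan F).
Proof.
have S k l : Ckmx k L (fun z => adj (F z) *m pdmx l F z).
  by apply: CkmxM => //; [exact: Ckmx_adj|exact: CkmxS_dmx].
split.
- by apply/smooth_mxP => k; apply: (Ckmx_ext oL _ (S k 0)) => z Lz; rewrite mc_adj.
- by apply/smooth_mxP => k; apply: (Ckmx_ext oL _ (S k 1)) => z Lz; rewrite mc_adj.
- move=> z Lz; have [A B] := mc_adj Lz.
  by split; [rewrite A|rewrite B]; rewrite /in_u3 adj_sesqui adjM adjK; exact: mc_skew.
Qed.

(** Differentiate (adj F) F = 1; what remains is the symmetry of second derivatives. *)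
Lemma mc_flat : flat L (maurer_cartan F).
Proof.
move=> z Lz; rewrite half_wedge_bracket.
have n0 : \near z, (maurer_cartan F z).1 = adj (F z) *m pdmx 0 F z.
  by apply: near_on_open oL _ Lz => w Lw; rewrite mc_adj.
have n1 : \near z, (maurer_cartan F z).2 = adj (F z) *m pdmx 1 F z.
  by apply: near_on_open oL _ Lz => w Lw; rewrite mc_adj.
have dP k : mxdiff (pdmx k F) z by exact: Ckmx_mxdiff (CkmxS_dmx k (CF 2%N)) Lz.
have X k l : adj (pdmx k F z) *m pdmx l F z =
    - (adj (F z) *m pdmx k F z *m (adj (F z) *m pdmx l F z)).
  rewrite -mulNmx -mc_skew // -[in RHS]mulmxA [F z *m (_ *m _)]mulmxA.
  by rewrite (mulmx1C (uF Lz)) mul1mx.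
have D k l : pdmx k (fun w => adj (F w) *m pdmx l F w) z =
    - (adj (F z) *m pdmx k F z *m (adj (F z) *m pdmx l F z)) + adj (F z) *m pdmx k (pdmx l F) z.
  rewrite -X {1}/pdmx dmxM; [|exact/mxdiff_adj/dF|exact: dP].
  by rewrite dmx_adj //; exact: dF.
have E0 := etrans (dmx_near (delta_mx 0 0) n1) (D 0 1).
have E1 := etrans (dmx_near (delta_mx 0 1) n0) (D 1 0).
have E : ext_d (maurer_cartan F) z = - ((maurer_cartan F z).1 *m (maurer_cartan F z).2)
   + adj (F z) *m pdmx 0 (pdmx 1 F) z - (- ((maurer_cartan F z).2 *m (maurer_cartan F z).1)
   + adj (F z) *m pdmx 1 (pdmx 0 F) z).
  by rewrite !mc_adj //; exact: (congr2 (fun A B => A - B) E0 E1).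
rewrite E (schwarz_mx oL (CF 2%N) Lz).
have abel (A B D' : 'M[C]_3) : - A + D' - (- B + D') + (A - B) = 0 by mx_abel.
exact: abel.
Qed.

End UnitaryFrame.

Section LinkFrame.
Context {R : realType}.
Local Notation C := R[i].
Local Notation V := 'rV[R]_2.
Local Notation V3 := 'rV[R]_3.

Lemma hermC {m} (u v : 'cV[C]_m) : herm u v = ((herm v u)^*)%C.
Proof.
rewrite /herm !mxE rmorph_sum; apply: eq_bigr => k _.
by rewrite !mxE rmorphM /= conjcK mulrC.
Qed.

Lemma hermZ {m} (a b : R) (u v : 'cV[C]_m) :
  herm (a%:C%C *: u) (b%:C%C *: v) = (a * b)%:C%C * herm u v.
Proof.
rewrite /herm !mxE mulr_sumr; apply: eq_bigr => k _; rewrite !mxE.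
case: (u k 0) => u1 u2; case: (v k 0) => v1 v2; apply: complex_ext => /=; ring.
Qed.

Lemma adj_mul_entry {p q} (X : 'M[C]_(p, q)) j k :
  (adj X *m X) j k = herm (col k X) (col j X).
Proof. by rewrite /herm !mxE; apply: eq_bigr => l _; rewrite !mxE. Qed.

Lemma herm_self {m} (u : 'cV[C]_m) : herm u u = (cdot u u)%:C%C.
Proof.
have := hermC u u; rewrite cdot_herm; case: (herm u u) => x y [] /eqP.
by rewrite -addr_eq0 -mulr2n mulrn_eq0 => /eqP ->.
Qed.

Lemma dmx0 {n p q} (X : 'rV[R]_n -> 'M[C]_(p, q)) x : mxdiff X x -> dmx X x 0 = 0.
Proof. by move=> dX; rewrite -(subrr 0) dmxB_dir // subrr. Qed.

Lemma cv3_inj (x y w x' y' w' : C) : cv3 x y w = cv3 x' y' w' -> [/\ x = x', y = y' & w = w'].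
Proof.
move=> E; have e j := congr1 (fun u : 'cV[C]_3 => u j 0) E.
by have := e i0; have := e i1; have := e i2; rewrite !cv3E.
Qed.

(** The coordinates of the point r f(z) of the cone; read on tangent vectors as
    well. *)
Definition cone_pt (z : V) (r : R) : V3 := \row_j [:: z 0 0; z 0 1; r]`_j.

Lemma cone_ptE z r : (base_pt (cone_pt z r) = z) * (cone_pt z r 0 ord_max = r).
Proof. by split; [apply: row2P; rewrite !mxE|rewrite mxE]. Qed.

Variables (L : set V) (f : V -> 'cV[C]_3).
Hypotheses (oL : open L) (mf : maps_to_sphere L f) (cf : conformal_immersion L f)
  (pf : parametrizes_lagrangian_link L f).

Let Cf k : Ckmx k L f := (smooth_mxP L f).1 mf.1 k.
Let df z : L z -> mxdiff f z := fun Lz => Ckmx_mxdiff (Cf 1%N) Lz.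

Lemma cone_omega z u w r s : L z ->
  omega (r%:C%C *: f z + dmx f z u) (s%:C%C *: f z + dmx f z w) = 0.
Proof.
move=> Lz; have E (q : V) x : dmx (cone_map f) (cone_pt z 1) (cone_pt q x) = x%:C%C *: f z + dmx f z q.
  have dz : mxdiff f (base_pt (cone_pt z 1)) by rewrite cone_ptE; exact: df.
  by have [_ ->] := cone_map_diff (cone_pt q x) dz; rewrite !cone_ptE scale1r.
rewrite -!E; have [_ [_ H]] := pf.
by apply: (H _ _).2; split; rewrite cone_ptE.
Qed.

(** The real part vanishes since f stays on the sphere; the imaginary part since
    the cone contains the radial direction and is Lagrangian. *)
Lemma position_orthogonal z u : L z -> herm (f z) (dmx f z u) = 0.
Proof.
move=> Lz; apply: complex_ext; last first.
  rewrite -omega_herm; have := cone_omega u 0 0 1 Lz.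
  by rewrite scale0r scale1r add0r dmx0 ?addr0 //; exact: df.
have n1 : \near z, adj (f z) *m f z = 1%:M.
  apply: near_on_open oL _ Lz => w Lw; apply/matrixP => j k; rewrite !ord1 [RHS]mxE.
  by rewrite -[LHS]/(herm (f w) (f w)) herm_self (mf.2 w Lw).
have := dmx_near u n1; rewrite dmx_cst dmxM; [|exact/mxdiff_adj/df|exact: df].
rewrite dmx_adj; last exact: df.
move=> /matrixP /(_ 0 0); rewrite [LHS]mxE [RHS]mxE -/(herm _ _) -/(herm _ _).
rewrite [X in _ + X]hermC => /(congr1 (@complex.Re R)).
by rewrite cReD cReJ /= => /eqP; rewrite -mulr2n mulrn_eq0 => /eqP.
Qed.

(** Conformality controls the real part and the Lagrangian condition the imaginary
    part. *)
Lemma tangent_herm z : L z -> exists2 c : R, 0 < c &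
  forall u w, herm (dmx f z u) (dmx f z w) = (c * rdot u w)%:C%C.
Proof.
move=> Lz; have [_ [c c0 H]] := cf Lz; exists c => // u w; apply: complex_ext.
  by rewrite -cdot_herm H.
by rewrite -omega_herm; have := cone_omega w u 0 0 Lz; rewrite !scale0r !add0r.
Qed.

Definition speed z : R := Num.sqrt (cdot (pdmx 0 f z) (pdmx 0 f z)).

Definition link_frame z : 'M[C]_3 := \matrix_(j, k)
  [:: ((speed z)^-1)%:C%C * pdmx 0 f z j 0; ((speed z)^-1)%:C%C * pdmx 1 f z j 0; f z j 0]`_k.

Lemma link_frame_col z :
  ((col i0 (link_frame z) = ((speed z)^-1)%:C%C *: pdmx 0 f z) *
   (col i1 (link_frame z) = ((speed z)^-1)%:C%C *: pdmx 1 f z) *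
   (col i2 (link_frame z) = f z))%type.
Proof. by do !split; apply/colP => j; rewrite !mxE. Qed.

Lemma speed_gt0 z : L z -> 0 < cdot (pdmx 0 f z) (pdmx 0 f z).
Proof.
move=> Lz; have [c c0 H] := tangent_herm Lz.
by rewrite cdot_herm /pdmx H rdot2 !mxE /= mulr1 mulr0 addr0 mulr1.
Qed.

(** Conformality gives f_x and f_y the same norm, so one factor normalizes
    both. *)
Lemma link_frame_unitary z : L z -> adj (link_frame z) *m link_frame z = 1%:M.
Proof.
move=> Lz; have [c c0 H] := tangent_herm Lz; have c1 := speed_gt0 Lz.
have E00 : herm (pdmx 0 f z) (pdmx 0 f z) = c%:C%C.
  by rewrite /pdmx H rdot2 !mxE /= mulr1 mulr0 addr0 mulr1.
have E11 : herm (pdmx 1 f z) (pdmx 1 f z) = c%:C%C.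
  by rewrite /pdmx H rdot2 !mxE /= mulr1 mulr0 add0r mulr1.
have E01 : herm (pdmx 0 f z) (pdmx 1 f z) = 0.
  by rewrite /pdmx H rdot2 !mxE /= mulr0 mul0r addr0 mulr0.
have E10 : herm (pdmx 1 f z) (pdmx 0 f z) = 0 by rewrite hermC E01 conjc0.
have P k : herm (f z) (pdmx k f z) = 0 by exact: position_orthogonal.
have P' k : herm (pdmx k f z) (f z) = 0 by rewrite hermC P conjc0.
have ff : herm (f z) (f z) = 1 by rewrite herm_self mf.2.
have s2 : speed z ^+ 2 = c by rewrite sqr_sqrtr ?ltW // cdot_herm E00.
have k1 : (speed z)^-1 * (speed z)^-1 * c = 1.
  by rewrite -s2 -expr2 exprVn mulVf // s2 gt_eqF.
have h1 (u : 'cV[C]_3) : u = 1%:C%C *: u by rewrite scale1r.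
apply/matrixP => j k; rewrite adj_mul_entry mxE.
case: (I3P j) => ->; case: (I3P k) => ->; rewrite !link_frame_col /=.
- by rewrite hermZ E00 -rmorphM k1.
- by rewrite hermZ E10 mulr0.
- by rewrite {1}(h1 (f z)) hermZ P mulr0.
- by rewrite hermZ E01 mulr0.
- by rewrite hermZ E11 -rmorphM k1.
- by rewrite {1}(h1 (f z)) hermZ P mulr0.
- by rewrite (h1 (f z)) hermZ P' mulr0.
- by rewrite (h1 (f z)) hermZ P' mulr0.
- exact: ff.
Qed.

Lemma Ck_speed k : Ck k L speed.
Proof.
apply: Ck_sqrt => //; first exact: speed_gt0.
have C0 := CkmxS_dmx 0 (Cf k.+1).
have [] // : CkC k L (fun z => \sum_j pdmx 0 f z j 0 * ((pdmx 0 f z j 0)^*)%C).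
by apply: CkC_sum => // j; apply: CkCM => //; exact: CkCJ.
Qed.

Lemma link_frame_smooth : smooth_mx L link_frame.
Proof.
apply/smooth_mxP => k.
have Cs : CkC k L (fun z => ((speed z)^-1)%:C%C).
  apply/CkC_real/Ck_inv => //; last exact: Ck_speed.
  by move=> z Lz; rewrite gt_eqF // sqrtr_gt0 speed_gt0.
have C0 := CkmxS_dmx 0 (Cf k.+1); have C1 := CkmxS_dmx 1 (Cf k.+1).
move=> i j; case: (I3P j) => ->.
- by apply: (CkC_ext oL _ (CkCM oL Cs (C0 i 0))) => z _; rewrite [RHS]mxE.
- by apply: (CkC_ext oL _ (CkCM oL Cs (C1 i 0))) => z _; rewrite [RHS]mxE.
- by apply: (CkC_ext oL _ (Cf k i 0)) => z _; rewrite [RHS]mxE.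
Qed.

Local Notation F := link_frame.
Let CF k : Ckmx k L F := (smooth_mxP L F).1 link_frame_smooth k.
Let uF z (Lz : L z) := link_frame_unitary Lz.

Lemma frame_position z : F z *m eps3 = f z.
Proof. by rewrite /eps3 -colE ord_max2 link_frame_col. Qed.

Lemma link_frame_unitarymx z : L z -> F z \is unitarymx.
Proof. by move=> Lz; apply/unitarymx_adj/mulmx1C/link_frame_unitary. Qed.

Lemma mc_column k z : L z ->
  (adj (F z) *m pdmx k F z) *m eps3 = adj (F z) *m pdmx k f z.
Proof.
move=> Lz; rewrite -mulmxA; congr (_ *m _).
have n1 : \near z, F z *m eps3 = f z by apply: near_on_open oL _ Lz => w _; exact: frame_position.
rewrite /pdmx -(dmx_near _ n1) dmxM; [|exact: Ckmx_mxdiff (CF 1%N) Lz|exact: mxdiff_cst].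
by rewrite dmx_cst mulmx0 addr0.
Qed.

Lemma mc_column_frame z : L z ->
  (adj (F z) *m pdmx 0 f z = cv3 (speed z)%:C%C 0 0) *
  (adj (F z) *m pdmx 1 f z = cv3 0 (speed z)%:C%C 0).
Proof.
move=> Lz; have s0 : speed z != 0 by rewrite gt_eqF // sqrtr_gt0 speed_gt0.
have E (u : 'cV[C]_3) : u = (speed z)%:C%C *: (((speed z)^-1)%:C%C *: u).
  by rewrite scalerA -rmorphM divff // scale1r.
split; rewrite [pdmx _ f z]E.
  rewrite -(link_frame_col z).1.1 colE -scalemxAr mulmxA link_frame_unitary // mul1mx.
  by apply/colP => j; case: (I3P j) => ->; rewrite !mxE ?mulr1 ?mulr0.
rewrite -(link_frame_col z).1.2 colE -scalemxAr mulmxA link_frame_unitary // mul1mx.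
by apply/colP => j; case: (I3P j) => ->; rewrite !mxE ?mulr1 ?mulr0.
Qed.

(** The case s = speed, t = 0 of [m_conditionP]. *)
Lemma link_frame_m_condition : m_condition L (maurer_cartan F).
Proof.
move=> z Lz; have [_ _ ua] := mc_u3 oL CF uF; have [u1 u2] := ua z Lz.
apply/(m_conditionP u1 u2).
have A := mc_adj uF Lz.
have E0 : (maurer_cartan F z).1 *m eps3 = cv3 (speed z)%:C%C 0 0.
  by rewrite A -(mc_column_frame Lz); exact: mc_column.
have E1 : (maurer_cartan F z).2 *m eps3 = cv3 0 (speed z)%:C%C 0.
  by rewrite A -(mc_column_frame Lz); exact: mc_column.
clear A u1 u2 ua; case: (maurer_cartan F z) E0 E1 => X Y; rewrite [fst _]/= [snd _]/=.
rewrite !mul_eps3 => /cv3_inj[-> -> ->] /cv3_inj[-> -> ->].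
by rewrite conjc0 oppr0 conjc_real.
Qed.

(** The degree 2 part is diagonal with equal first two entries, and its last entry
    is that of the form, which vanishes. *)
Lemma link_frame_values : takes_values_in_CY L (form_comp 2 (maurer_cartan F)).
Proof.
move=> z v Lz; have [_ _ ua] := mc_u3 oL CF uF; have [u1 u2] := ua z Lz.
have [x22 y22 _ _] := (m_conditionP u1 u2).1 (link_frame_m_condition Lz).
rewrite /form_comp /cov_eval /cov_map; move: (maurer_cartan F z) x22 y22 => [X Y] /= x22 y22.
exists (- 'i%C * ((v 0 0)%:C%C * (2^-1 * (X i0 i0 + X i1 i1)) + (v 0 1)%:C%C * (2^-1 * (Y i0 i0 + Y i1 i1)))).
move: (v 0 0)%:C%C (v 0 1)%:C%C => a b.
rewrite !tau_comp_2 x22 y22.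
have I (w : C) : w = - 'i%C * w * 'i%C by rewrite mulrAC mulNr -expr2 sqr_i opprK mul1r.
apply/matrixP => j k; rewrite [LHS]mxE [X in X + _]mxE [X in _ + X]mxE [RHS]mxE /Yc.
case: (I3P j) => ->; case: (I3P k) => ->; rewrite !mx3E ?mulr0 ?addr0 //; exact: I.
Qed.

End LinkFrame.

Theorem theorem4p4 (R : realType) (L : set 'rV[R]_2)
    (L_domain : is_domain L) (L_simply_connected : simply_connected R L) :
  (forall f : 'rV[R]_2 -> 'cV[R[i]]_3,
     maps_to_sphere L f -> conformal_immersion L f ->
     parametrizes_lagrangian_link L f ->
     exists F : 'rV[R]_2 -> 'M[R[i]]_3,
       [/\ U3_map L F, forall z, L z -> last_column F z = f z &
           let a := maurer_cartan F in
           [/\ u3_form L a, flat L a, m_condition L a &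
               takes_values_in_CY L (form_comp 2 a)]])
  /\
  (forall a : form1, u3_form L a -> flat L a -> m_condition L a ->
     (exists F, U3_map L F /\ integrates L a F) /\
     (forall F, U3_map L F -> integrates L a F ->
        let f := last_column F in
        [/\ maps_to_sphere L f,
            forall z, L z -> weakly_conformal f z &
            parametrizes_lagrangian_link (immersion_locus L f) f]))
  /\
  (forall (a : form1) (F : 'rV[R]_2 -> 'M[R[i]]_3) (f : 'rV[R]_2 -> 'cV[R[i]]_3),
     u3_form L a -> flat L a -> m_condition L a ->
     U3_map L F -> integrates L a F -> (forall z, L z -> last_column F z = f z) ->
     (coclosed L (form_comp 2 a) ->
        hamiltonian_stationary_cone (immersion_locus L f) f) /\
     (vanishes L (form_comp 2 a) ->
        special_lagrangian_cone (immersion_locus L f) f)).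
Proof.
have [oL cL [z0 L0]] := L_domain; split; [|split].
- move=> f mf cf pf; exists (link_frame f); split.
  + by split; [exact: (link_frame_smooth oL mf cf pf)|move=> z; exact: link_frame_unitarymx].
  + by move=> z _; exact: frame_position.
  + have uF z (Lz : L z) := link_frame_unitary oL mf cf pf Lz.
    have CF := (smooth_mxP _ _).1 (link_frame_smooth oL mf cf pf).
    by split; [exact: mc_u3|exact: mc_flat|exact: link_frame_m_condition|exact: link_frame_values].
- move=> a ua fa ma; split; first exact: flat_integrable.
  by move=> F UF iF; exact: (link_of_integral oL ua ma UF iF).
- move=> a F f ua fa ma UF iF Ff; split=> ca.
    exact: (stationary_of_coclosed oL ua ma UF iF Ff ca).
  exact: (special_of_vanishing oL cL L0 ua ma UF iF Ff ca).
Qed.
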